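(* (i) For every finite metric space $X$ there exists a functor $\mathcal J(X)\colon \mathbb N^{\mathrm{op}}\times[0,\infty)\to\mathbf{Simp}$ that is a $\sqrt2$-approximation to the subdivision-Rips bifiltration $\mathcal{SR}(X)$ and whose $k$-skeleton, for each integer $k\ge0$, has size $O(|X|^{k+2})$ (with implied constant independent of $X$). (ii) There exists an infinite family $\mathfrak X$ of finite metric spaces such that for every $\delta\in[1,\sqrt2)$ there is no simplicial $\delta$-approximation to $\mathcal{SR}(X)$, $X\in\mathfrak X$, of size polynomial in $|X|$; that is, for every $\delta\in[1,\sqrt 2)$ there is no polynomial $q$ such that every $X\in\mathfrak X$ admits a finitely presented functor $\mathbb N^{\mathrm{op}}\times[0,\infty)\to\mathbf{Simp}$ that is a $\delta$-approximation to $\mathcal{SR}(X)$ and has size at most $q(|X|)$.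
   Context: Conventions: $\mathbb N=\{1,2,\dots\}$. $\mathbf{Simp}$ is the category of finite abstract simplicial complexes and simplicial maps, regarded as a subcategory of topological spaces $\mathbf{Top}$ via geometric realization. Posets are regarded as categories; products carry the product order. Rips filtration: For a finite metric space $X$ and $r\ge0$, $\mathcal R(X)_r$ is the simplicial complex on vertex set $X$ whose simplices are the nonempty subsets all of whose pairwise distances are at most $2r$. This gives a filtration $\mathcal R(X)\colon[0,\infty)\to\mathbf{Simp}$. Subdivision-Rips: For a simplicial complex $W$ and $k\in\mathbb N$, $\mathcal S(W)_k$ is the subcomplex of the barycentric subdivision of $W$ (whose simplices are the flags $\sigma_1\subset\cdots\subset\sigma_m$ of simplices of $W$) consisting of the flags whose minimum element has dimension at least $k-1$. $\mathcal{SR}(X)\colon\mathbb N^{\mathrm{op}}\times[0,\infty)\to\mathbf{Simp}$ is $\mathcal{SR}(X)_{k,r}=\mathcal S(\mathcal R(X)_r)_k$, with inclusions as structure maps. Approximation: For $\delta\ge1$ let $I^{(1,\delta)}$ be the thin category (at most one morphism between any two objects) with object set $\mathbb N^{\mathrm{op}}\times[0,\infty)\times\{0,1\}$ and a morphism $(k,r,i)\to(l,s,j)$ iff either $(k,r\delta)\le(l,s)$ in $\mathbb N^{\mathrm{op}}\times[0,\infty)$, or $i=j$ and $(k,r)\le(l,s)$. Let $E^i\colon \mathbb N^{\mathrm{op}}\times[0,\infty)\to I^{(1,\delta)}$, $E^i(k,r)=(k,r,i)$. Functors $\mathcal F,\mathcal F'\colon\mathbb N^{\mathrm{op}}\times[0,\infty)\to\mathbf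 C$ are $\delta$-interleaved if there is a functor $\mathcal Z\colon I^{(1,\delta)}\to\mathbf C$ with $\mathcal Z\circ E^0=\mathcal F$ and $\mathcal Z\circ E^1=\mathcal F'$. Two functors into $\mathbf{Top}$ are weakly equivalent ($\simeq$) if they are connected by a finite zigzag of natural transformations all of whose components are homotopy equivalences. Functors $\mathcal F,\mathcal G\colon\mathbb N^{\mathrm{op}}\times[0,\infty)\to\mathbf{Top}$ are $\delta$-homotopy interleaved if there are $\delta$-interleaved functors $\mathcal F'\simeq\mathcal F$, $\mathcal G'\simeq\mathcal G$ into $\mathbf{Top}$; then $\mathcal G$ is called a $\delta$-approximation to $\mathcal F$. It is simplicial if $\mathcal G$ takes values in $\mathbf{Simp}$. Size: Fix a field $\mathbb K$. A persistence module over a poset $P$ is a functor $M\colon P\to\mathbf{Vec}_{\mathbb K}$. For $p\in P$ let $\mathbb K^{\langle p\rangle}$ be the module equal to $\mathbb K$ at all $x\ge p$ and $0$ elsewhere, with identity structure maps between the copies of $\mathbb K$; free modules are those isomorphic to direct sums of such modules. $M$ is finitely presented if it is the cokernel of a morphism between finitely generated free modules. If $P$ is a finite product of totally ordered sets, a finitely presented $M$ has a minimal free resolution $F_\bullet$ (one isomorphic to a direct summand of every free resolution), unique up to isomorphism, with each $F_i$ finitely generated; $\beta_i(M)$ is the cardinality of a minimal generating set of $F_i$. For $\mathcal G\colon P\to\mathbf{Simp}$, $C_j\mathcal G$ is the module $p\mapsto C_j(\mathcal G_p;\mathbb K)$ of simplicial $j$-chains; $\mathcal G$ is finitely presented if every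 $C_j\mathcal G$ is, and its size is then $\beta_1(C_0\mathcal G)+\sum_{j\ge0}\beta_0(C_j\mathcal G)$. The $k$-skeleton of $\mathcal G$ is the functor $p\mapsto k$-skeleton of $\mathcal G_p$. *)

(* Defs.v *)
From HB Require Import structures.
From Stdlib Require Import Relation_Operators.
From mathcomp Require Import all_boot all_order all_algebra all_fingroup.
From mathcomp Require Import all_classical all_reals all_analysis.

Set Implicit Arguments.
Unset Strict Implicit.
Unset Printing Implicit Defensive.

Import Order.TTheory GRing.Theory Num.Theory.
Import numFieldNormedType.Exports.

Local Open Scope ring_scope.

Record category := Category {
  obj :> Type;
  hom : obj -> obj -> Type;
  idc : forall x, hom x x;
  compc : forall x y z, hom y z -> hom x y -> hom x z;
  compc1 : forall x y (f : hom x y), compc f (idc x) = f;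
  comp1c : forall x y (f : hom x y), compc (idc y) f = f;
  compcA : forall w x y z (h : hom y z) (g : hom x y) (f : hom w x),
    compc h (compc g f) = compc (compc h g) f }.

Arguments hom {c} x y.
Arguments idc {c} x.
Arguments compc {c x y z} g f.

Record functor (C D : category) := Functor {
  fobj :> C -> D;
  fmap : forall x y : C, hom x y -> hom (fobj x) (fobj y);
  fmap1 : forall x : C, fmap (idc x) = idc (fobj x);
  fmapM : forall (x y z : C) (g : hom y z) (f : hom x y),
    fmap (compc g f) = compc (fmap g) (fmap f) }.

Arguments fmap {C D} F [x y] f : rename.

Section FunctorComp.
Context {C D E : category} (G : functor D E) (F : functor C D).

Let comp_obj (x : C) : E := G (F x).
Let comp_map (x y : C) (f : hom x y) : hom (comp_obj x) (comp_obj y) :=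
  fmap G (fmap F f).

Fact functor_comp1 x : comp_map (idc x) = idc (comp_obj x).
Proof. by rewrite /comp_map !fmap1. Qed.

Fact functor_compM x y z (g : hom y z) (f : hom x y) :
  comp_map (compc g f) = compc (comp_map g) (comp_map f).
Proof. by rewrite /comp_map !fmapM. Qed.

Definition functor_comp : functor C E := Functor functor_comp1 functor_compM.
End FunctorComp.

Infix "\oF" := functor_comp (at level 50, left associativity).

Record nat_trans (C D : category) (F G : functor C D) := NatTrans {
  component :> forall x : C, hom (F x) (G x);
  naturality : forall (x y : C) (f : hom x y),
    compc (component y) (fmap F f) = compc (fmap G f) (component x) }.

Definition nat_iso (C D : category) (F G : functor C D) : Prop :=
  exists (a : nat_trans F G) (b : nat_trans G F),
    forall x, compc (b x) (a x) = idc (F x) /\ compc (a x) (b x) = idc (G x).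

Section Thin.
Context (T : Type) (le : T -> T -> Prop).
Hypothesis (le_refl : forall x, le x x).
Hypothesis (le_trans : forall y x z, le x y -> le y z -> le x z).

Definition thin_category : category :=
  @Category T le le_refl (fun x y z yz xy => le_trans xy yz)
    (fun _ _ _ => Prop_irrelevance _ _) (fun _ _ _ => Prop_irrelevance _ _)
    (fun _ _ _ _ _ _ _ => Prop_irrelevance _ _).
End Thin.

Definition poset_category {d : Order.disp_t} (P : porderType d) : category :=
  @thin_category P (fun x y => (x <= y)%O) (@lexx d P) (@le_trans d P).

Definition cts_id (X : topologicalType) : continuousType X X := idfun.

Definition cts_comp (X Y Z : topologicalType)
  (g : continuousType Y Z) (f : continuousType X Y) : continuousType X Z :=
  g \o f.

Fact cts_comp1 (X Y : topologicalType) (f : continuousType X Y) : cts_comp f (cts_id X) = f.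
Proof. exact/continuousEP. Qed.

Fact cts_1comp (X Y : topologicalType) (f : continuousType X Y) : cts_comp (cts_id Y) f = f.
Proof. exact/continuousEP. Qed.

Fact cts_compA (W X Y Z : topologicalType) (h : continuousType Y Z)
  (g : continuousType X Y) (f : continuousType W X) :
  cts_comp h (cts_comp g f) = cts_comp (cts_comp h g) f.
Proof. exact/continuousEP. Qed.

Definition Top : category := Category cts_comp1 cts_1comp cts_compA.

Definition homotopic (R : realType) (X Y : topologicalType) (f g : X -> Y) :=
  exists H : X * R -> Y,
    [/\ {within setT `*` `[0, 1], continuous H}%classic,
        forall x, H (x, 0) = f x & forall x, H (x, 1) = g x].

Definition homotopy_equivalence (R : realType) (X Y : topologicalType)
    (f : continuousType X Y) :=
  exists g : continuousType Y X,
    homotopic R (g \o f) idfun /\ homotopic R (f \o g) idfun.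

Definition objectwise_equivalence (R : realType) (C : category)
    (F G : functor C Top) :=
  exists a : nat_trans F G, forall x, homotopy_equivalence R (a x).

Definition weakly_equivalent (R : realType) (C : category)
    (F G : functor C Top) :=
  clos_refl_sym_trans (functor C Top) (@objectwise_equivalence R C) F G.

Record complex := Complex {
  vertex : finType;
  simplices : {set {set vertex}};
  simplex_neq0 : finset.set0 \notin simplices;
  simplex_vertex : forall v, [set v]%SET \in simplices;
  simplex_sub : forall s t : {set vertex},
    t \subset s -> t != finset.set0 -> s \in simplices -> t \in simplices }.

Record simplicial_map (W W' : complex) := SimplicialMap {
  vmap :> vertex W -> vertex W';
  vmap_simplex : forall s, s \in simplices W ->
    (vmap @: s)%SET \in simplices W' }.

Fact smap_eq W W' (f g : simplicial_map W W') : f =1 g -> f = g.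
Proof.
case: f g => [f fP] [g gP] /= /funext fg; move: fP gP; rewrite fg => fP gP.
by rewrite (Prop_irrelevance fP gP).
Qed.

Fact smap_id_subproof W s : s \in simplices W -> (id @: s)%SET \in simplices W.
Proof. by rewrite imset_id. Qed.

Definition smap_id W : simplicial_map W W :=
  SimplicialMap (@smap_id_subproof W).

Fact smap_comp_subproof W W' W'' (g : simplicial_map W' W'')
    (f : simplicial_map W W') s :
  s \in simplices W -> ((g \o f) @: s)%SET \in simplices W''.
Proof. by rewrite imset_comp => sW; do 2 apply: vmap_simplex. Qed.

Definition smap_comp W W' W'' (g : simplicial_map W' W'')
    (f : simplicial_map W W') : simplicial_map W W'' :=
  SimplicialMap (smap_comp_subproof g f).

Fact smap_comp1 W W' (f : simplicial_map W W') : smap_comp f (smap_id W) = f.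
Proof. exact: smap_eq. Qed.

Fact smap_1comp W W' (f : simplicial_map W W') : smap_comp (smap_id W') f = f.
Proof. exact: smap_eq. Qed.

Fact smap_compA W X Y Z (h : simplicial_map Y Z) (g : simplicial_map X Y)
  (f : simplicial_map W X) :
  smap_comp h (smap_comp g f) = smap_comp (smap_comp h g) f.
Proof. exact: smap_eq. Qed.

Definition Simp : category := Category smap_comp1 smap_1comp smap_compA.

Definition barycentric (R : realType) (W : complex) :
    set {ptws vertex W -> R} :=
  [set t | [/\ forall v, 0 <= t v, \sum_v t v = 1 &
    [set v | t v != 0]%SET \in simplices W]]%classic.

Definition realization (R : realType) (W : complex) : topologicalType :=
  set_type (@barycentric R W).

Section RealizationMap.
Context (R : realType).

Definition pushforward (V V' : finType) (f : V -> V') (t : {ptws V -> R}) :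
    {ptws V' -> R} :=
  fun w => \sum_(v | f v == w) t v.

Fact realization_map_subproof W W' (f : simplicial_map W W')
    (t : realization R W) : pushforward f (set_val t) \in @barycentric R W'.
Proof.
rewrite inE; have [t0 t1 tW] := set_mem (valP t); split.
- by move=> w; apply: sumr_ge0 => v _; exact: t0.
- by rewrite -[RHS]t1 (partition_big f xpredT)//=.
- rewrite [X in X \in _](_ : _ = (f @: [set v | set_val t v != 0])%SET).
    exact: vmap_simplex.
  apply/setP => w; rewrite inE; apply/idP/imsetP => [|[v + ->]].
    apply: contraNP => tw; rewrite /pushforward big1// => v /eqP fv.
    by apply/eqP; apply: contra_notT tw => tv; exists v; rewrite ?inE.
  rewrite inE => tv; rewrite psumr_neq0 => [|v0 _]; last exact: t0.
  apply/hasP; exists v.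
    by rewrite mem_index_enum.
  by rewrite eqxx lt_def tv t0.
Qed.

Definition realization_fun W W' (f : simplicial_map W W')
    (t : realization R W) : realization R W' :=
  SigSub (realization_map_subproof f t).

Fact realization_fun_continuous W W' (f : simplicial_map W W') :
  continuous (realization_fun f).
Proof.
apply: continuous_comp_initial => t.
apply/cvg_sup; first exact/fmap_filter/nbhs_filter.
move=> w U.
rewrite /= nbhsE => -[B [[C oC <-] Ct] CU].
suff: continuous (fun u : realization R W =>
    \sum_(v | f v == w) (set_val u : {ptws vertex W -> R}) v).
  move=> /(_ t C) /(_ (open_nbhs_nbhs (conj oC Ct))).
  by rewrite -nbhsE; apply: (@filterS _ (nbhs t)) => u Cu; exact: CU.
apply: continuous_big => [|v _ u]; first exact: add_continuous.
apply: (@continuous_comp _ {ptws vertex W -> R} _ set_val (fun x => x v)).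
  exact: initial_continuous.
exact: (@proj_continuous (vertex W) (fun=> R) v).
Qed.

Definition realization_map W W' (f : simplicial_map W W') :
    continuousType (realization R W) (realization R W') :=
  mkcts (@realization_fun_continuous W W' f).

Fact realization_map1 W : realization_map (smap_id W) = cts_id (realization R W).
Proof.
apply/continuousEP => t; apply/val_inj/funext => w /=.
rewrite /pushforward (big_pred1 w)// => v; exact: eqxx.
Qed.

Fact realization_mapM W W' W'' (g : simplicial_map W' W'')
    (f : simplicial_map W W') :
  realization_map (smap_comp g f) =
  cts_comp (realization_map g) (realization_map f).
Proof.
apply/continuousEP => t; apply/val_inj/funext => w /=.
rewrite /pushforward (partition_big f (fun v => g v == w))//=.
apply: eq_bigr => v /eqP gv; apply: eq_bigl => u.
by apply/andP/idP => [[]//|/eqP fu]; rewrite fu gv !eqxx.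
Qed.

Definition Realization : functor Simp Top :=
  @Functor Simp Top (realization R) realization_map realization_map1
    realization_mapM.
End RealizationMap.

Section Skeleton.
Context (k : nat).

Section Object.
Context (W : complex).

Let skel_simplices := [set s in simplices W | (#|s| <= k.+1)%N]%SET.

Fact skel_neq0 : finset.set0 \notin skel_simplices.
Proof. by rewrite inE (negbTE (simplex_neq0 W)). Qed.

Fact skel_vertex v : [set v]%SET \in skel_simplices.
Proof. by rewrite inE simplex_vertex cards1. Qed.

Fact skel_sub (s t : {set vertex W}) :
  t \subset s -> t != finset.set0 -> s \in skel_simplices ->
  t \in skel_simplices.
Proof.
move=> ts t0; rewrite !inE => /andP[sW sk]; rewrite (simplex_sub ts)//=.
exact: leq_trans (subset_leq_card ts) sk.
Qed.

Definition skel : complex := Complex skel_neq0 skel_vertex skel_sub.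
End Object.

Fact skel_map_subproof W W' (f : simplicial_map W W') s :
  s \in simplices (skel W) -> (f @: s)%SET \in simplices (skel W').
Proof.
rewrite !inE => /andP[sW sk]; rewrite vmap_simplex//=.
exact: leq_trans (leq_imset_card _ _) sk.
Qed.

Definition skel_map W W' (f : simplicial_map W W') :
  simplicial_map (skel W) (skel W') := SimplicialMap (skel_map_subproof f).

Fact skel_map1 W : skel_map (smap_id W) = smap_id (skel W).
Proof. exact: smap_eq. Qed.

Fact skel_mapM W W' W'' (g : simplicial_map W' W'') (f : simplicial_map W W') :
  skel_map (smap_comp g f) = smap_comp (skel_map g) (skel_map f).
Proof. exact: smap_eq. Qed.

Definition Skel : functor Simp Simp :=
  @Functor Simp Simp skel skel_map skel_map1 skel_mapM.
End Skeleton.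

Section Vec.
Context (K : fieldType).

Fact linear_eq (U V : lmodType K) (f g : {linear U -> V}) : f =1 g -> f = g.
Proof.
case: f g => f [[fA] [fZ]] [g [[gA] [gZ]]] /= /funext fg.
move: fA fZ gA gZ; rewrite fg => fA fZ gA gZ.
by rewrite (Prop_irrelevance fA gA) (Prop_irrelevance fZ gZ).
Qed.

Definition lin_id (U : lmodType K) : {linear U -> U} := idfun.

Definition lin_comp (U V W : lmodType K) (g : {linear V -> W})
  (f : {linear U -> V}) : {linear U -> W} := g \o f.

Fact lin_comp1 (U V : lmodType K) (f : {linear U -> V}) :
  lin_comp f (lin_id U) = f.
Proof. exact: linear_eq. Qed.

Fact lin_1comp (U V : lmodType K) (f : {linear U -> V}) :
  lin_comp (lin_id V) f = f.
Proof. exact: linear_eq. Qed.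

Fact lin_compA (U V W X : lmodType K) (h : {linear W -> X})
    (g : {linear V -> W}) (f : {linear U -> V}) :
  lin_comp h (lin_comp g f) = lin_comp (lin_comp h g) f.
Proof. exact: linear_eq. Qed.

Definition Vec : category := Category lin_comp1 lin_1comp lin_compA.
End Vec.

Section Modules.
Context (K : fieldType) (d : Order.disp_t) (P : porderType d).

Definition pmodule := functor (poset_category P) (Vec K).

Implicit Types (M F : pmodule) (p x y : P).

Definition transition M x y (le_xy : (x <= y)%O) : {linear M x -> M y} :=
  @fmap (poset_category P) (Vec K) M x y le_xy.

Definition pmap M M' (f : nat_trans M M') x : {linear M x -> M' x} := f x.

(** [free_module g] is the direct sum over [i] of the modules K^<g i>: an
    element at [x] is a finitely supported family of coefficients whose
    [i]-th coefficient is forced to vanish unless [g i <= x]. *)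
Section Free.
Context (I : Type) (g : I -> P).

Definition free_pred x : {pred I -> K^o} := fun c =>
  `[< finite_set [set i | c i != 0]%classic /\
      forall i, c i != 0 -> (g i <= x)%O >].

Fact free_pred_submod x : submod_closed (free_pred x).
Proof.
split=> [|a u v /asboolP[fu gu] /asboolP[fv gv]]; apply/asboolP; split.
- rewrite (_ : [set i | _]%classic = classical_sets.set0)//.
  by apply/seteqP; split=> i //=; rewrite eqxx.
- by move=> i /=; rewrite eqxx.
- have /sub_finite_set : ([set i | (a *: u + v) i != 0] `<=`
      [set i | u i != 0] `|` [set i | v i != 0])%classic.
    move=> i /=; have [ui0|] := eqVneq (u i) 0; last by left.
    have [vi0|] := eqVneq (v i) 0; last by right.
    by rewrite (_ : (a *: u + v) i = a *: u i + v i)// ui0 vi0 scaler0 addr0 eqxx.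
  by apply; rewrite finite_setU.
- move=> i; have [ui0|/gu//] := eqVneq (u i) 0.
  have [vi0|/gv//] := eqVneq (v i) 0.
  by rewrite (_ : (a *: u + v) i = a *: u i + v i)// ui0 vi0 scaler0 addr0 eqxx.
Qed.

HB.instance Definition _ x :=
  GRing.isSubmodClosed.Build K (I -> K^o) (free_pred x) (free_pred_submod x).

Record free_at x := FreeAt {
  coef :> I -> K^o;
  coefP : coef \in free_pred x }.

HB.instance Definition _ x := [isSub for @coef x].
HB.instance Definition _ x := [Choice of free_at x by <:].
HB.instance Definition _ x := [SubChoice_isSubLmodule of free_at x by <:].

Fact free_incl_subproof x y (le_xy : (x <= y)%O) (c : free_at x) :
  coef c \in free_pred y.
Proof.
have /asboolP[cf cx] := coefP c; apply/asboolP; split=> // i /cx gi.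
exact: le_trans le_xy.
Qed.

Definition free_incl x y (le_xy : (x <= y)%O) (c : free_at x) : free_at y :=
  FreeAt (free_incl_subproof le_xy c).

Fact free_incl_linear x y (le_xy : (x <= y)%O) : linear (free_incl le_xy).
Proof. by move=> a u v; apply: val_inj. Qed.

HB.instance Definition _ x y (le_xy : (x <= y)%O) :=
  GRing.isLinear.Build K (free_at x) (free_at y) _ (free_incl le_xy)
    (free_incl_linear le_xy).

Definition free_map x y (le_xy : (x <= y)%O) :
  {linear free_at x -> free_at y} := free_incl le_xy.

Fact free_map1 x : free_map (lexx x) = lin_id (free_at x).
Proof. by apply: linear_eq => c; apply: val_inj. Qed.

Fact free_mapM x y z (le_yz : (y <= z)%O) (le_xy : (x <= y)%O) :
  free_map (le_trans le_xy le_yz) = lin_comp (free_map le_yz) (free_map le_xy).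
Proof. by apply: linear_eq => c; apply: val_inj. Qed.

Definition free_module : pmodule :=
  @Functor (poset_category P) (Vec K) free_at free_map free_map1 free_mapM.
End Free.

Definition is_free M : Prop :=
  exists (I : Type) (g : I -> P), nat_iso M (free_module g).

Definition elements M : Type := {x : P & M x}.

Definition submodule M (N : forall x, set (M x)) : Prop :=
  [/\ forall x, N x 0,
      forall x a (u v : M x), N x u -> N x v -> N x (a *: u + v) &
      forall x y (le_xy : (x <= y)%O) u, N x u -> N y (transition M le_xy u)].

Definition generates M (S : set (elements M)) : Prop :=
  forall N : (forall x, set (M x)), submodule N ->
    (forall x u, S (existT _ x u) -> N x u) -> forall x u, N x u.

Definition minimal_generating_set M (S : set (elements M)) : Prop :=
  generates S /\
  forall T : set (elements M), (T `<=` S)%classic -> generates T -> T = S.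

Definition finitely_generated M : Prop :=
  exists S : set (elements M), finite_set S /\ generates S.

Definition exact_seq M M' M'' (f : nat_trans M M') (g : nat_trans M' M'') : Prop :=
  forall x (u : M' x), pmap g x u = 0 <-> exists v, pmap f x v = u.

Definition is_cokernel M M' M'' (f : nat_trans M M') (g : nat_trans M' M'') :=
  exact_seq f g /\ forall x (u : M'' x), exists v, pmap g x v = u.

Definition finitely_presented M : Prop :=
  exists (F1 F0 : pmodule) (f : nat_trans F1 F0) (e : nat_trans F0 M),
    [/\ is_free F1 /\ finitely_generated F1,
        is_free F0 /\ finitely_generated F0 & is_cokernel f e].

Record chain_complex := ChainComplex {
  term :> nat -> pmodule;
  differential : forall i, nat_trans (term i.+1) (term i);
  differentialK : forall i x u,
    pmap (differential i) x (pmap (differential i.+1) x u) = 0 }.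

Definition chain_map (C D : chain_complex)
    (f : forall i, nat_trans (C i) (D i)) : Prop :=
  forall i x (u : C i.+1 x),
    pmap (f i) x (pmap (differential C i) x u) =
    pmap (differential D i) x (pmap (f i.+1) x u).

(** Up to isomorphism: [D] is isomorphic to the direct sum of [C] and some [E]. *)
Definition direct_summand (C D : chain_complex) : Prop :=
  exists (E : chain_complex) (s : forall i, nat_trans (C i) (D i))
      (t : forall i, nat_trans (E i) (D i)),
    [/\ chain_map s, chain_map t &
      forall i x,
        bijective (fun u : C i x * E i x => pmap (s i) x u.1 + pmap (t i) x u.2)].

Definition free_resolution M (C : chain_complex) : Prop :=
  [/\ forall i, is_free (C i),
      forall i, exact_seq (differential C i.+1) (differential C i) &
      exists e : nat_trans (C 0%N) M, is_cokernel (differential C 0) e].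

Definition minimal_free_resolution M (C : chain_complex) : Prop :=
  free_resolution M C /\ forall D, free_resolution M D -> direct_summand C D.

(** Betti numbers are a relation, so that no value is assigned to modules
    without a minimal free resolution. *)
Definition betti M (i n : nat) : Prop :=
  exists C, minimal_free_resolution M C /\
    exists S : set (elements (C i)), minimal_generating_set S /\ (S #= `I_n)%card.
End Modules.

(** A j-chain is a function on ordered j-simplices that changes sign with the
    orientation; it is extended by 0 to all (j+1)-tuples of vertices. *)
Section Chains.
Context (K : fieldType) (j : nat).

Definition otuple (V : finType) := {ffun 'I_j.+1 -> V}.

Definition chain_pred (W : complex) :
    {pred {ffun otuple (vertex W) -> K^o}} := fun c =>
  [forall v, (c v != 0) ==>
     injectiveb v && ([set v i | i in 'I_j.+1]%SET \in simplices W)] &&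
  [forall v : otuple (vertex W), forall s : 'S_j.+1,
     c [ffun i => v (s i)] == (-1) ^+ odd_perm s * c v].

Arguments chain_pred W : clear implicits.

Fact chain_predP W (c : {ffun otuple (vertex W) -> K^o}) : reflect
  ((forall v, c v != 0 ->
     injectiveb v /\ [set v i | i in 'I_j.+1]%SET \in simplices W) /\
   forall (v : otuple (vertex W)) (s : 'S_j.+1),
     c [ffun i => v (s i)] = (-1) ^+ odd_perm s * c v) (c \in chain_pred W).
Proof.
apply: (iffP andP) => -[cW cs]; split.
- by move=> v /(implyP (forallP cW v))/andP[].
- by move=> v s; apply/eqP/(forallP (forallP cs v)).
- by apply/forallP => v; apply/implyP => /cW[-> ->].
- by apply/forallP => v; apply/forallP => s; apply/eqP.
Qed.

Fact chain_pred_submod W : submod_closed (chain_pred W).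
Proof.
split=> [|a u v /chain_predP[uW us] /chain_predP[vW vs]]; apply/chain_predP.
  by split=> [v|v s]; rewrite !ffunE ?eqxx ?mulr0.
split=> [x|x s].
  have [ux0|/uW//] := eqVneq (u x) 0.
  have [vx0|/vW//] := eqVneq (v x) 0.
  by rewrite !ffunE ux0 vx0 scaler0 addr0 eqxx.
by rewrite !ffunE us vs mulrDr; congr (_ + _); rewrite /GRing.scale/= mulrCA.
Qed.

HB.instance Definition _ W :=
  GRing.isSubmodClosed.Build K _ (chain_pred W) (chain_pred_submod W).

Record chain (W : complex) := Chain {
  chain_coef :> {ffun otuple (vertex W) -> K^o};
  chain_coefP : chain_coef \in chain_pred W }.

HB.instance Definition _ W := [isSub for @chain_coef W].
HB.instance Definition _ W := [Choice of chain W by <:].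
HB.instance Definition _ W := [SubChoice_isSubLmodule of chain W by <:].

(** Ordered simplices with degenerate image are sent to 0. *)
Definition chain_push (V V' : finType) (f : V -> V')
    (c : {ffun otuple V -> K^o}) : {ffun otuple V' -> K^o} :=
  [ffun w : otuple V' => if injectiveb w
    then \sum_(v : otuple V | [ffun i => f (v i)] == w) c v else 0].

Fact chain_push_subproof W W' (f : simplicial_map W W') (c : chain W) :
  chain_push f c \in chain_pred W'.
Proof.
have /chain_predP[cW cs] := chain_coefP c; apply/chain_predP; split=> [w|w s].
  rewrite ffunE; case: ifP => [winj H|]; last by rewrite eqxx.
  split=> //; have [/existsP[v /andP[/eqP<- cv]]|] :=
    boolP [exists v : otuple (vertex W),
      ([ffun i => f (v i)] == w) && (chain_coef c v != 0)].
    have [_ /(vmap_simplex f)] := cW v cv; rewrite -imset_comp.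
    rewrite (_ : imset (f \o v) _ = [set [ffun i => f (v i)] i | i in 'I_j.+1]%SET)//.
    by apply: eq_imset => i; rewrite ffunE.
  rewrite negb_exists => /forallP c0; move: H; rewrite big1 ?eqxx// => v fv.
  by apply/eqP; have := c0 v; rewrite fv/= negbK.
rewrite !ffunE.
have -> : injectiveb [ffun i => w (s i)] = injectiveb w.
  apply/injectiveP/injectiveP => winj x y.
    move=> wxy; have := winj ((s^-1)%g x) ((s^-1)%g y).
    by rewrite !ffunE !permKV => /(_ wxy)/perm_inj.
  by rewrite !ffunE => /winj/perm_inj.
case: ifP => _; last by rewrite mulr0.
rewrite mulr_sumr.
rewrite (reindex (fun v : otuple (vertex W) => [ffun i => v (s i)]))/=; last first.
  exists (fun v : otuple (vertex W) => [ffun i => v ((s^-1)%g i)]) => v _;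
    by apply/ffunP => i; rewrite !ffunE ?permK ?permKV.
apply: eq_big => [v|v _]; last exact: cs.
apply/eqP/eqP => [/ffunP fv|/ffunP fv]; apply/ffunP => i.
  by have := fv ((s^-1)%g i); rewrite !ffunE permKV.
by have := fv (s i); rewrite !ffunE.
Qed.

Definition chain_fun W W' (f : simplicial_map W W') (c : chain W) : chain W' :=
  Chain (chain_push_subproof f c).

Fact chain_fun_linear W W' (f : simplicial_map W W') : linear (chain_fun f).
Proof.
move=> a u v; apply/val_inj/ffunP => w; rewrite !ffunE /=.
case: ifP => _; last by rewrite scaler0 addr0.
rewrite scaler_sumr -big_split/=; apply: eq_bigr => x _.
by rewrite !ffunE.
Qed.

HB.instance Definition _ W W' (f : simplicial_map W W') :=
  GRing.isLinear.Build K (chain W) (chain W') _ (chain_fun f)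
    (chain_fun_linear f).

Definition chain_lin W W' (f : simplicial_map W W') :
  {linear chain W -> chain W'} := chain_fun f.

Fact chain_lin1 W : chain_lin (smap_id W) = lin_id (chain W).
Proof.
apply: linear_eq => c; apply/val_inj/ffunP => w; rewrite ffunE /=.
have /chain_predP[cW _] := chain_coefP c.
have [winj|] := boolP (injectiveb w).
  rewrite (big_pred1 w)// => v; apply/eqP/eqP => [<-|->];
    by apply/ffunP => i; rewrite ffunE.
by apply: contraNeq; rewrite eq_sym => /cW[].
Qed.

Fact chain_linM W W' W'' (g : simplicial_map W' W'') (f : simplicial_map W W') :
  chain_lin (smap_comp g f) = lin_comp (chain_lin g) (chain_lin f).
Proof.
apply: linear_eq => c; apply/val_inj/ffunP => w; rewrite !ffunE /=.
case: ifP => // /injectiveP winj.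
rewrite (partition_big (fun v : otuple (vertex W) =>
    [ffun i => f (v i)] : otuple (vertex W'))
  (fun u : otuple (vertex W') => [ffun i => g (u i)] == w))/=; last first.
  by move=> v /eqP<-; apply/eqP/ffunP => i; rewrite !ffunE.
apply: eq_bigr => u /eqP gu; rewrite ffunE ifT; last first.
  apply/injectiveP => x y uxy; apply: winj.
  by rewrite -gu !ffunE uxy.
apply: eq_bigl => v; apply/andP/idP => [[]//|/eqP fv].
by rewrite fv eqxx; split=> //; apply/eqP; rewrite -gu -fv; apply/ffunP => i;
  rewrite !ffunE.
Qed.

Definition Chains : functor Simp (Vec K) :=
  @Functor Simp (Vec K) chain chain_lin chain_lin1 chain_linM.
End Chains.

Section Size.
Context (K : fieldType) (d : Order.disp_t) (P : porderType d).

Definition simplicial_functor := functor (poset_category P) Simp.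

Implicit Type G : simplicial_functor.

Definition chain_module G (j : nat) : pmodule K P := Chains K j \oF G.

Definition finitely_presented_functor G : Prop :=
  forall j, finitely_presented (chain_module G j).

(** The sum over all [j] is finite: C_0 is finitely generated, which bounds the
    dimension of every [G p]. *)
Definition has_size G (n : nat) : Prop :=
  finitely_presented_functor G /\
  exists (b1 : nat) (b0 : nat -> nat) (N : nat),
    [/\ betti (chain_module G 0) 1 b1,
        forall j, betti (chain_module G j) 0 (b0 j),
        forall j, (N <= j)%N -> b0 j = 0%N &
        n = (b1 + \sum_(j < N) b0 j)%N].
End Size.

Record posnat := PosNat { nat_of_posnat :> nat; posnat_gt0 : (0 < nat_of_posnat)%N }.

HB.instance Definition _ := [isSub for nat_of_posnat].
HB.instance Definition _ := [Choice of posnat by <:].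
HB.instance Definition _ := [SubChoice_isSubOrder of posnat by <: with Order.default_display].

Definition bigrade (R : realType) := (posnat^d *p {nonneg R})%type.

Fact bigrade_le (R : realType) (p q : bigrade R) :
  (p <= q)%O = ((q.1 : posnat) <= (p.1 : posnat))%N && (p.2%:num <= q.2%:num).
Proof. by []. Qed.

#[short(type="finMetricType")]
HB.structure Definition FinMetric (R : numDomainType) :=
  { T of Finite T & Metric R T }.

Section Rips.
Context (R : realType) (X : finMetricType R) (r : {nonneg R}).

Let rips_simplices : {set {set X}} :=
  [set s : {set X} | (s != finset.set0) &&
    [forall x in s, forall y in s, mdist x y <= 2 * r%:num]]%SET.

Fact rips_neq0 : finset.set0 \notin rips_simplices.
Proof. by rewrite inE eqxx. Qed.

Fact rips_vertex (x : X) : [set x]%SET \in rips_simplices.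
Proof.
rewrite inE -card_gt0 cards1/=; apply/forall_inP => y /set1P->.
by apply/forall_inP => z /set1P->; rewrite mdistxx.
Qed.

Fact rips_sub (s t : {set X}) : t \subset s -> t != finset.set0 ->
  s \in rips_simplices -> t \in rips_simplices.
Proof.
move=> /fintype.subsetP ts t0; rewrite !inE t0 => /andP[_ /forall_inP sr].
apply/forall_inP => x /ts /sr /forall_inP sx; apply/forall_inP => y /ts; exact: sx.
Qed.

Definition rips : complex := Complex rips_neq0 rips_vertex rips_sub.
End Rips.

(** [subdivision W k] is S(W)_k. Its vertices are the singleton flags, i.e. the
    simplices of [W] of dimension at least k - 1 (at least k elements);
    [subdivision_flagsP] checks that its simplices are the flags whose minimum
    has dimension at least k - 1. *)
Section Subdivision.
Context (W : complex) (k : nat).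

Definition flag_vertex : finType :=
  {s : {set vertex W} | (s \in simplices W) && (k <= #|s|)%N}.

Let flags : {set {set flag_vertex}} :=
  [set F : {set flag_vertex} | (F != finset.set0) &&
    [forall s in F, forall t in F,
      (val s \subset val t) || (val t \subset val s)]]%SET.

Fact flags_neq0 : finset.set0 \notin flags.
Proof. by rewrite inE eqxx. Qed.

Fact flags_vertex (s : flag_vertex) : [set s]%SET \in flags.
Proof.
rewrite inE -card_gt0 cards1/=; apply/forall_inP => t /set1P->.
by apply/forall_inP => u /set1P->; rewrite subxx.
Qed.

Fact flags_sub (F G : {set flag_vertex}) : G \subset F -> G != finset.set0 ->
  F \in flags -> G \in flags.
Proof.
move=> /fintype.subsetP GF G0; rewrite !inE G0 => /andP[_ /forall_inP Fc].
apply/forall_inP => s /GF /Fc /forall_inP sF; apply/forall_inP => t /GF.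
exact: sF.
Qed.

Definition subdivision : complex := Complex flags_neq0 flags_vertex flags_sub.

Fact subdivision_flagsP (F : {set {set vertex W}}) :
  (exists2 G, G \in simplices subdivision & F = (val @: G)%SET) <->
  [/\ F != finset.set0, forall s, s \in F -> s \in simplices W,
      forall s t, s \in F -> t \in F -> (s \subset t) || (t \subset s) &
      forall s, s \in F -> (forall t, t \in F -> s \subset t) -> (k <= #|s|)%N].
Proof.
split=> [[G + ->]|[F0 FW Fc Fmin]].
  rewrite inE => /andP[G0 /forall_inP Gc]; split.
  - by rewrite imset_eq0.
  - by move=> _ /imsetP[s _ ->]; have /andP[] := valP s.
  - move=> _ _ /imsetP[s sG ->] /imsetP[t tG ->].
    by move/forall_inP: (Gc s sG); apply.
  - by move=> _ /imsetP[s _ ->] _; have /andP[] := valP s.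
have Fk s : s \in F -> (k <= #|s|)%N.
  move=> sF; pose m := [arg min_(t < s in F) #|t|]%N.
  have [mF mmin] : m \in F /\ forall t, t \in F -> (#|m| <= #|t|)%N.
    by rewrite /m; case: arg_minnP.
  apply: leq_trans (mmin s sF); apply: Fmin => // t tF.
  have /orP[//|tm] := Fc m t mF tF.
  suff -> : t = m by [].
  by apply/eqP; rewrite eqEcard tm mmin.
have FE : F = (val @: [set s : flag_vertex | val s \in F])%SET.
  apply/setP => s; apply/idP/imsetP => [sF|[t + ->]]; last by rewrite inE.
  have sP : (s \in simplices W) && (k <= #|s|)%N by rewrite FW// Fk.
  by exists (Sub s sP); rewrite ?inE SubK.
exists [set s : flag_vertex | val s \in F]%SET => //.
rewrite inE -(imset_eq0 val) -FE F0 /=.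
apply/forall_inP => s; rewrite inE => sF.
by apply/forall_inP => t; rewrite inE => tF; exact: Fc.
Qed.
End Subdivision.

Section SubdivisionRips.
Context (R : realType) (X : finMetricType R).

Definition SR_obj (p : bigrade R) : complex := subdivision (rips X p.2) p.1.

Fact SR_incl_subproof (p q : bigrade R) (le_pq : (p <= q)%O)
    (s : vertex (SR_obj p)) :
  (val s \in simplices (rips X q.2)) && (q.1 <= #|val s|)%N.
Proof.
move: le_pq; rewrite bigrade_le => /andP[qp1 pq2].
have := valP s; rewrite !inE => /andP[/andP[-> /forall_inP sr] sp] /=.
rewrite (leq_trans qp1 sp) andbT.
apply/forall_inP => x /sr /forall_inP sx; apply/forall_inP => y /sx xy.
by apply: le_trans xy _; rewrite ler_pM2l.
Qed.

Definition SR_incl (p q : bigrade R) (le_pq : (p <= q)%O)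
    (s : vertex (SR_obj p)) : vertex (SR_obj q) :=
  Sub (val s) (SR_incl_subproof le_pq s).

Fact SR_map_subproof (p q : bigrade R) (le_pq : (p <= q)%O) F :
  F \in simplices (SR_obj p) -> (SR_incl le_pq @: F)%SET \in simplices (SR_obj q).
Proof.
rewrite !inE => /andP[F0 /forall_inP Fc]; rewrite imset_eq0 F0/=.
apply/forall_inP => _ /imsetP[s sF ->]; apply/forall_inP => _ /imsetP[t tF ->].
by move/forall_inP: (Fc s sF); apply.
Qed.

Definition SR_map (p q : bigrade R) (le_pq : (p <= q)%O) :
  simplicial_map (SR_obj p) (SR_obj q) := SimplicialMap (SR_map_subproof le_pq).

Fact SR_map1 (p : bigrade R) : SR_map (lexx p) = smap_id (SR_obj p).
Proof. by apply: smap_eq => s; apply: val_inj. Qed.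

Fact SR_mapM (p q u : bigrade R) (le_qu : (q <= u)%O) (le_pq : (p <= q)%O) :
  SR_map (le_trans le_pq le_qu) = smap_comp (SR_map le_qu) (SR_map le_pq).
Proof. by apply: smap_eq => s; apply: val_inj. Qed.

Definition SR : simplicial_functor (bigrade R) :=
  @Functor (poset_category (bigrade R)) Simp SR_obj SR_map SR_map1 SR_mapM.
End SubdivisionRips.

Section Interleaving.
Context (R : realType) (delta : R) (delta_ge1 : 1 <= delta).

Fact rescale_subproof (r : {nonneg R}) : 0 <= r%:num * delta.
Proof. by rewrite mulr_ge0// (le_trans ler01). Qed.

Definition rescale (p : bigrade R) : bigrade R := (p.1, NngNum (rescale_subproof p.2)).

(** The objects (p, false) and (p, true) stand for (p, 0) and (p, 1). *)
Definition interleaving_le (x y : bigrade R * bool) : Prop :=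
  (rescale x.1 <= y.1)%O \/ x.2 = y.2 /\ (x.1 <= y.1)%O.

Fact interleaving_refl x : interleaving_le x x.
Proof. by right. Qed.

Fact le_rescale p : (p <= rescale p)%O.
Proof. by rewrite bigrade_le leqnn ler_peMr. Qed.

Fact rescale_le p q : (p <= q)%O -> (rescale p <= rescale q)%O.
Proof.
rewrite !bigrade_le => /andP[-> pq] /=; rewrite ler_pM2r//.
exact: lt_le_trans ltr01 _.
Qed.

Fact interleaving_trans y x z :
  interleaving_le x y -> interleaving_le y z -> interleaving_le x z.
Proof.
case=> [xy|[exy xy]] [yz|[eyz yz]].
- by left; apply: le_trans xy (le_trans (le_rescale _) yz).
- by left; apply: le_trans xy yz.
- by left; apply: le_trans (rescale_le xy) yz.
- by right; split; [rewrite exy | apply: le_trans xy yz].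
Qed.

Definition interleaving_category : category :=
  thin_category interleaving_refl interleaving_trans.

Section Embedding.
Context (i : bool).

Fact E_map p q (le_pq : (p <= q)%O) : interleaving_le (p, i) (q, i).
Proof. by right. Qed.

Definition E_embedding : functor (poset_category (bigrade R)) interleaving_category :=
  @Functor (poset_category (bigrade R)) interleaving_category (fun p => (p, i))
    E_map (fun _ => @Prop_irrelevance (interleaving_le _ _) _ _)
    (fun _ _ _ _ _ => @Prop_irrelevance (interleaving_le _ _) _ _).
End Embedding.

Definition interleaved (C : category)
    (F F' : functor (poset_category (bigrade R)) C) : Prop :=
  exists Z : functor interleaving_category C,
    Z \oF E_embedding false = F /\ Z \oF E_embedding true = F'.

Definition homotopy_interleaved
    (F G : functor (poset_category (bigrade R)) Top) : Prop :=
  exists F' G' : functor (poset_category (bigrade R)) Top,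
    [/\ weakly_equivalent R F' F, weakly_equivalent R G' G &
        interleaved F' G'].

Definition is_approximation (F G : simplicial_functor (bigrade R)) : Prop :=
  homotopy_interleaved (Realization R \oF F) (Realization R \oF G).
End Interleaving.

Fact sqrt2_ge1 (R : realType) : 1 <= Num.sqrt 2 :> R.
Proof. by rewrite -[leLHS]sqrtr1 ler_wsqrtr// ler1n. Qed.

(* Main.v *)
From HB Require Import structures.
From Stdlib Require Import Relation_Operators.
Require Import Defs.
From mathcomp Require Import all_boot all_order all_algebra all_fingroup.
From mathcomp Require Import finmap all_classical all_reals all_analysis.
From mathcomp Require Import lra zify.

(** Upper bound. Write [B x] for the closed ball of radius [sqrt 2 * r] about
    [x]. A simplex of the Rips complex at scale [r] lies in the ball of radius
    [2 * r] about any of its points, and a subset of [B x] has diameter at most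
    [2 * sqrt 2 * r]. So the sets that lie in some ball [B x] form a filtration
    whose subdivision is [sqrt 2]-interleaved with subdivision-Rips, through
    inclusions alone. At a fixed index this subdivision is covered by one
    contractible piece for each ball with at least [k] points, which suggests
    the nerve: the model [nerve_model] has as simplices the nonempty sets [t]
    of centres whose balls have at least [k] points in common.

    The usual nerve map depends on choices that do not commute with the
    structure maps, so the equivalence goes through a third order complex: that
    of the pairs [(s, t)] where [s] has at least [k] points and lies in all the
    balls centred in [t]. Both projections are strictly natural, and each is an
    equivalence, with the section given by the Galois connection between sets
    of points and sets of centres; the two poset maps involved are comparable,
    hence homotopic ([homotopic_monotone]). The second projection ends in the
    barycentric subdivision of the nerve, and sending each simplex to its
    barycenter removes the subdivision, again naturally along inclusions
    ([barycenter_equivalence]).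

    For the size, fix a set [s] of [j + 1] centres. The indices [(k, r)] where
    [s] is a simplex form the region under the graph of the function that
    counts the points within the common reach of [s]. It has at most [|X|] steps,
    so the chains of dimension [j] are a direct sum of at most [|X|^(j + 1)]
    staircases with at most [|X|] steps each. The free module on the steps,
    with one relation for every two consecutive steps, resolves such a module
    in length one. The differential takes a generator to generators of
    strictly smaller degrees, and this makes the resolution minimal
    ([short_resolution_minimal]): lifting the identity to any other resolution
    and back gives a unipotent endomorphism, so the resolution splits off.

    Lower bound. Take [n + 1] couples, with distance [2] inside a couple and
    [1] otherwise. For [1/2 <= r < 1] the Rips complex has [2^(n + 1)] simplices
    with [n + 1] points, one for each choice of one member per couple, and none
    larger. In the subdivision at [k = n + 1] they are isolated points,
    constantly so for all these [r]. If [delta^2 < 2], an approximation at scale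
    [delta / 2] sits between the scales [1/2] and [delta^2 / 2 < 1], so its
    complex there has at least [2^(n + 1)] components. It then has as many
    vertices, and a module with a value of that dimension needs as many
    generators. *)

Set Implicit Arguments.
Unset Strict Implicit.
Unset Printing Implicit Defensive.

Import Order.TTheory GRing.Theory Num.Theory.
Import numFieldNormedType.Exports.

Local Open Scope ring_scope.

(** * Maps into geometric realizations and their homotopies *)

Section Realizations.
Context (R : realType).
Implicit Types (W : complex) (Y : topologicalType).

Definition support W (t : realization R W) : {set vertex W} :=
  [set v | set_val t v != 0]%SET.

Lemma coord_ge0 W (t : realization R W) v : 0 <= set_val t v.
Proof. by have [+ _ _] := set_mem (valP t); exact. Qed.

Lemma coord_sum W (t : realization R W) : \sum_v set_val t v = 1.
Proof. by have [] := set_mem (valP t). Qed.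

Lemma support_simplex W (t : realization R W) : support t \in simplices W.
Proof. by have [] := set_mem (valP t). Qed.

Lemma coord_gt0 W (t : realization R W) v : (0 < set_val t v) = (v \in support t).
Proof. by rewrite inE lt_def coord_ge0 andbT. Qed.

Lemma barycentric_sub W (t : vertex W -> R) (s : {set vertex W}) :
  (forall v, 0 <= t v) -> \sum_v t v = 1 -> s \in simplices W ->
  (forall v, t v != 0 -> v \in s) -> (t : {ptws vertex W -> R}) \in @barycentric R W.
Proof.
move=> t0 t1 sW ts; rewrite inE; split=> //.
apply: (simplex_sub _ _ sW).
  by apply/fintype.subsetP => v; rewrite inE => /ts.
apply/negP => /eqP/setP t0'; move: t1; rewrite big1 => [/esym/eqP|v _].
  by rewrite oner_eq0.
by apply/eqP; have := t0' v; rewrite !inE => /negbFE.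
Qed.

Definition bary_point W (t : vertex W -> R)
  (h : (t : {ptws vertex W -> R}) \in @barycentric R W) : realization R W :=
  SigSub h.

(** The product topology is the initial one, so continuity is tested on
    barycentric coordinates. *)
Lemma continuous_into Y W (f : Y -> realization R W) :
  (forall v, continuous (fun y => set_val (f y) v : R)) -> continuous f.
Proof.
move=> fc; apply: continuous_comp_initial => t.
apply/cvg_sup.
move=> w U.
rewrite /= nbhsE => -[B [[C oC <-] Ct] CU].
have := fc w t C (open_nbhs_nbhs (conj oC Ct)).
by rewrite -nbhsE; apply: (@filterS _ (nbhs t)) => u Cu; exact: CU.
Qed.

Lemma continuous_coord W v : continuous (fun t : realization R W => set_val t v : R).
Proof.
move=> t; apply: (@continuous_comp _ {ptws vertex W -> R} _ set_val (fun x => x v)).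
  exact: initial_continuous.
exact: (@proj_continuous (vertex W) (fun=> R) v).
Qed.

Lemma continuous_coord_comp Y W (f : Y -> realization R W) v :
  continuous f -> continuous (fun y => set_val (f y) v : R).
Proof.
move=> fc y; apply: (@continuous_comp _ _ _ f (fun t => set_val t v : R)).
  exact: fc.
exact: continuous_coord.
Qed.

Lemma continuous_const Y (a : R) : continuous (fun _ : Y => a).
Proof. by move=> y; exact: cvg_cst. Qed.

Lemma continuous_mulr Y (f g : Y -> R) :
  continuous f -> continuous g -> continuous (fun y => f y * g y).
Proof. by move=> fc gc y; apply: cvgM; [exact: fc | exact: gc]. Qed.

Lemma continuous_subr Y (f g : Y -> R) :
  continuous f -> continuous g -> continuous (fun y => f y - g y).
Proof. by move=> fc gc y; apply: cvgB; [exact: fc | exact: gc]. Qed.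

Lemma continuous_invr Y (f : Y -> R) :
  (forall y, f y != 0) -> continuous f -> continuous (fun y => (f y)^-1).
Proof. by move=> f0 fc y; apply: cvgV; [exact: f0 | exact: fc]. Qed.

Lemma continuous_sum Y (I : finType) (P : pred I) (f : I -> Y -> R) :
  (forall i, P i -> continuous (f i)) -> continuous (fun y => \sum_(i | P i) f i y).
Proof.
by move=> fc; apply: continuous_big => //; exact: add_continuous.
Qed.

Lemma continuous_prod Y (I : finType) (P : pred I) (f : I -> Y -> R) :
  (forall i, P i -> continuous (f i)) -> continuous (fun y => \prod_(i | P i) f i y).
Proof.
by move=> fc; apply: continuous_big => //; exact: mul_continuous.
Qed.

Lemma le_sum_sub (I : finType) (P Q : pred I) (F : I -> R) :
  (forall i, 0 <= F i) -> (forall i, P i -> Q i) ->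
  \sum_(i | P i) F i <= \sum_(i | Q i) F i.
Proof.
move=> F0 PQ; rewrite big_mkcond [leRHS]big_mkcond/=; apply: ler_sum => i _.
by case: ifP => [/PQ ->//|_]; case: ifP.
Qed.

Lemma sum_fibers (I J : finType) (f : I -> J) (F : I -> R) :
  \sum_j \sum_(i | f i == j) F i = \sum_i F i.
Proof. by rewrite [RHS](partition_big f xpredT). Qed.

(** Precomposing with this retraction turns formulas valid for times in the
    unit interval into maps that are continuous on all of [X * R]. *)
Definition clamp (u : R) : R := Num.max 0 (Num.min 1 u).

Lemma clamp_itv u : 0 <= clamp u <= 1.
Proof. by rewrite /clamp le_max lexx /= ge_max ler01 ge_min lexx. Qed.

Lemma clamp0 : clamp 0 = 0. Proof. by rewrite /clamp (min_r ler01) maxxx. Qed.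
Lemma clamp1 : clamp 1 = 1. Proof. by rewrite /clamp minxx (max_r ler01). Qed.

Lemma continuous_maxr Y (f g : Y -> R) :
  continuous f -> continuous g -> continuous (fun y => Num.max (f y) (g y)).
Proof. exact: max_fun_continuous. Qed.

Lemma continuous_minr Y (f g : Y -> R) :
  continuous f -> continuous g -> continuous (fun y => Num.min (f y) (g y)).
Proof. exact: min_fun_continuous. Qed.

Lemma continuous_clamp : continuous clamp.
Proof.
apply: continuous_maxr; first by move=> ?; exact: cvg_cst.
by apply: continuous_minr; [move=> ?; exact: cvg_cst | move=> ?; exact: cvg_id].
Qed.

Lemma homotopic_clamp (X Y : topologicalType) (f g : X -> Y) (H : X * R -> Y) :
  continuous H -> (forall x, H (x, 0) = f x) -> (forall x, H (x, 1) = g x) ->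
  homotopic R f g.
Proof.
by move=> Hc H0 H1; exists H; split=> //; exact: continuous_subspaceT.
Qed.

Lemma homotopic_refl (X Y : topologicalType) (f : X -> Y) :
  continuous f -> homotopic R f f.
Proof.
move=> fc; apply: (@homotopic_clamp _ _ _ _ (fun p => f p.1)) => // p.
apply: (@continuous_comp _ _ _ fst f); [exact: cvg_fst | exact: fc].
Qed.

Lemma continuous_fst_comp (X Y Z : topologicalType) (f : X -> Z) :
  continuous f -> continuous (fun p : X * Y => f p.1).
Proof.
move=> fc p; apply: (@continuous_comp _ _ _ fst f); [exact: cvg_fst | exact: fc].
Qed.

Lemma continuous_snd_comp (X Y Z : topologicalType) (f : Y -> Z) :
  continuous f -> continuous (fun p : X * Y => f p.2).
Proof.
move=> fc p; apply: (@continuous_comp _ _ _ snd f); [exact: cvg_snd | exact: fc].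
Qed.

Lemma homotopic_global (X Y : topologicalType) (f g : X -> Y) (H : X * R -> Y) :
  continuous H -> (forall x, H (x, 0) = f x) -> (forall x, H (x, 1) = g x) ->
  homotopic R f g /\ homotopic R g f.
Proof.
move=> Hc H0 H1; split; first exact: homotopic_clamp Hc H0 H1.
have sc : continuous (fun u : R => 1 - u).
  by apply: continuous_subr => u; [exact: cvg_cst | exact: cvg_id].
apply: (@homotopic_clamp _ _ _ _ (fun p => H (p.1, 1 - p.2))) => [p|x|x] /=.
- have Hc' : continuous (fun p : X * R => H (p.1, p.2)).
    by rewrite (_ : (fun p => _) = H)//; apply/funext => -[].
  apply: (cvg_comp2 (f := fst) (g := fun p => 1 - p.2) (h := fun x u => H (x, u)) _ _
    (Hc' (p.1, 1 - p.2))).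
    exact: cvg_fst.
  exact: (@continuous_snd_comp X R R _ sc p).
- by rewrite subr0.
- by rewrite subrr.
Qed.

(** Two points whose supports lie in a common simplex are joined by a segment
    in it, and the segments depend continuously on the endpoints. *)
Lemma homotopic_linear Y W (f g : Y -> realization R W) :
  continuous f -> continuous g ->
  (forall y, support (f y) :|: support (g y) \in simplices W) -> homotopic R f g.
Proof.
move=> fc gc fg.
pose h (p : Y * R) v : R :=
  (1 - clamp p.2) * set_val (f p.1) v + clamp p.2 * set_val (g p.1) v.
have hW p : (h p : {ptws vertex W -> R}) \in @barycentric R W.
  have /andP[c0 c1] := clamp_itv p.2.
  apply: (@barycentric_sub _ _ (support (f p.1) :|: support (g p.1))) => // [v||v].
  - by rewrite addr_ge0// mulr_ge0 ?coord_ge0 ?subr_ge0.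
  - by rewrite big_split/= -!mulr_sumr !coord_sum !mulr1 subrK.
  - rewrite !inE; apply: contraNT; rewrite negb_or !negbK => /andP[/eqP fv /eqP gv].
    by rewrite /h fv gv !mulr0 addr0.
apply: (@homotopic_clamp _ _ _ _ (fun p => bary_point (hW p))).
- apply: continuous_into => v.
  have cc : continuous (fun p : Y * R => clamp p.2).
    by apply: continuous_snd_comp; exact: continuous_clamp.
  move=> p; apply: cvgD; apply: cvgM.
  + by apply: cvgB; [exact: cvg_cst | exact: cc].
  + apply: (@continuous_fst_comp _ _ _ (fun y => set_val (f y) v : R)).
    exact: continuous_coord_comp.
  + exact: cc.
  + apply: (@continuous_fst_comp _ _ _ (fun y => set_val (g y) v : R)).
    exact: continuous_coord_comp.
- move=> y; apply/val_inj/funext => v /=.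
  by rewrite /h /= clamp0 mul0r addr0 subr0 mul1r.
- move=> y; apply/val_inj/funext => v /=.
  by rewrite /h /= clamp1 subrr mul0r add0r mul1r.
Qed.

Definition is_chain (V : finType) (le : rel V) (F : {set V}) :=
  (F != finset.set0) && [forall s in F, forall t in F, le s t || le t s].

Lemma is_chainP (V : finType) (le : rel V) (F : {set V}) :
  reflect (F != finset.set0 /\ forall s t, s \in F -> t \in F -> le s t || le t s)
    (is_chain le F).
Proof.
apply: (iffP andP) => -[F0 Fc]; split=> //.
  by move=> s t sF tF; move/forall_inP: Fc => /(_ s sF)/forall_inP; apply.
by apply/forall_inP => s sF; apply/forall_inP => t tF; exact: Fc.
Qed.

(** The maps [f] and [g] need not be contiguous, since [g x] and [f y] are
    incomparable in general for [x] below [y]. The homotopy therefore moves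
    the mass of a point from [f] to [g] from the top of its flag downwards: at
    time [u] the topmost part of total mass [u] has been moved. All mass moved
    so far then sits at elements above those whose mass has not been moved,
    and the support stays a chain. *)
Lemma homotopic_monotone W W' (le : rel (vertex W)) (le' : rel (vertex W'))
    (f g : simplicial_map W W') :
  (forall F, F \in simplices W -> is_chain le F) ->
  (forall F, is_chain le' F -> F \in simplices W') ->
  transitive le -> antisymmetric le -> transitive le' ->
  {homo f : x y / le x y >-> le' x y} -> {homo g : x y / le x y >-> le' x y} ->
  (forall x, le' (f x) (g x)) ->
  homotopic R (@realization_map R _ _ f) (realization_map R g) /\
  homotopic R (@realization_map R _ _ g) (realization_map R f).
Proof.
move=> Wc W'c letr leas letr' fle gle fg.
pose lt x y := le x y && (x != y).
(* the part of the mass at [x] already moved: what the time leaves after the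
   mass strictly above [x] *)
pose w (p : realization R W * R) x : R :=
  Num.max 0 (Num.min (set_val p.1 x) (clamp p.2 - \sum_(y | lt x y) set_val p.1 y)).
have w0 p x : 0 <= w p x by rewrite le_max lexx.
have wt p x : w p x <= set_val p.1 x.
  by rewrite ge_max coord_ge0 ge_min lexx.
pose h p z : R := \sum_(x | g x == z) w p x + \sum_(x | f x == z) (set_val p.1 x - w p x).
have hpos p z : h p z != 0 -> exists2 x, x \in support p.1 &
    (g x = z /\ 0 < w p x) \/ (f x = z /\ w p x < set_val p.1 x).
  move=> hz; have [g0|] := eqVneq (\sum_(x | g x == z) w p x) 0; last first.
    rewrite psumr_neq0// => /hasP[x _ /andP[/eqP gx wx]].
    by exists x; [rewrite -coord_gt0 (lt_le_trans wx) | left].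
  move: hz; rewrite /h g0 add0r psumr_neq0 => [|x _]; last by rewrite subr_ge0.
  move=> /hasP[x _ /andP[/eqP fx]]; rewrite subr_gt0 => wx.
  by exists x; [rewrite -coord_gt0 (le_lt_trans (w0 p x)) | right].
have hW p : (h p : {ptws vertex W' -> R}) \in @barycentric R W'.
  have h0 z : 0 <= h p z.
    by rewrite addr_ge0// sumr_ge0// => x _; rewrite subr_ge0.
  have h1 : \sum_z h p z = 1.
    rewrite big_split/= !sum_fibers -big_split/= -[RHS](coord_sum p.1).
    by apply: eq_bigr => x _; rewrite addrC subrK.
  apply: (@barycentric_sub _ _ [set z | h p z != 0]%SET) => //; last first.
    by move=> z; rewrite inE.
  apply/W'c/is_chainP; split.
    apply/negP => /eqP/setP z0; move: h1; rewrite big1 => [/esym/eqP|z _].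
      by rewrite oner_eq0.
    by apply/eqP; have := z0 z; rewrite !inE => /negbFE.
  have /Wc/is_chainP[_ tc] := support_simplex p.1.
  (* mass already moved by [g] sits above mass still carried by [f] *)
  have key x y : x \in support p.1 -> y \in support p.1 -> 0 < w p x ->
      w p y < set_val p.1 y -> le' (f y) (g x).
    move=> xs ys wx wy; case/orP: (tc _ _ ys xs) => [yx|xy].
      exact: letr' (fle _ _ yx) (fg x).
    have [<-//|nxy] := eqVneq x y.
    exfalso; move: wx wy; rewrite /w lt_max ltxx /= lt_min => /andP[_ wx].
    rewrite gt_max => /andP[_]; rewrite gt_min ltxx /=; apply/negP; rewrite -leNgt.
    rewrite lerBrDr; apply: le_trans (ltW (_ : _ < clamp p.2)); last first.
      by move: wx; rewrite subr_gt0; exact.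
    apply: (le_trans _ (le_sum_sub (P := fun z => (z == y) || lt y z) (coord_ge0 _) _)).
      by rewrite [leRHS](bigD1 y) ?eqxx//= lerD2l; apply: le_sum_sub => [z|z ltz];
        [exact: coord_ge0 | rewrite ltz orbT /=; case/andP: ltz; rewrite eq_sym].
    move=> z /orP[/eqP ->|/andP[yz yz']]; first by rewrite /lt xy nxy.
    rewrite /lt (letr _ _ _ xy yz); apply: contraNneq nxy => xz.
    by rewrite xz in xy *; rewrite (leas y z) ?yz.
  move=> z z'; rewrite !inE => /hpos[x xs xz] /hpos[x' xs' xz'].
  case: xz => [] [<- wx]; case: xz' => [] [<- wx'].
  - by case/orP: (tc _ _ xs xs') => /gle ->; rewrite ?orbT.
  - by rewrite (key x x') ?orbT.
  - by rewrite (key x' x).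
  - by case/orP: (tc _ _ xs xs') => /fle ->; rewrite ?orbT.
apply: (@homotopic_global _ _ _ _ (fun p => bary_point (hW p))).
- have cc x : continuous (fun p : realization R W * R => set_val p.1 x : R).
    by apply: (@continuous_fst_comp _ _ _ (fun t : realization R W => set_val t x : R));
      exact: continuous_coord.
  have wc x : continuous (fun p => w p x).
    apply: continuous_maxr; first by move=> ?; exact: cvg_cst.
    apply: continuous_minr => // p; apply: cvgB.
      by apply: continuous_snd_comp; exact: continuous_clamp.
    exact: continuous_sum.
  apply: continuous_into => z p; apply: cvgD; apply: continuous_sum => x _ //.
  by move=> q; apply: cvgB; [exact: cc | exact: wc].
- move=> t; apply/val_inj/funext => z /=.
  have wE x : w (t, 0) x = 0.
    rewrite /w /= clamp0 sub0r; apply/max_idPl; rewrite ge_min oppr_le0 sumr_ge0 ?orbT// => y _.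
    exact: coord_ge0.
  rewrite /h big1 => [|x _]; last by rewrite wE.
  by rewrite add0r; apply: eq_bigr => x _; rewrite wE subr0.
- move=> t; apply/val_inj/funext => z /=.
  have wE x : w (t, 1) x = set_val t x.
    rewrite /w /= clamp1 min_l ?max_r ?coord_ge0// lerBrDr -(coord_sum t).
    rewrite [leRHS](bigD1 x)//= lerD2l; apply: le_sum_sub => y; first exact: coord_ge0.
    by case/andP; rewrite eq_sym.
  rewrite /h [X in _ + X]big1 => [|x _]; last by rewrite wE subrr.
  by rewrite addr0; apply: eq_bigr => x _; rewrite wE.
Qed.

End Realizations.

(** * Barycentric subdivision *)

Section Barycenters.
Context (R : realType) (W V : complex) (l : vertex V -> {set vertex W}).
Hypothesis linj : injective l.
Hypothesis lW : forall v, l v \in simplices W.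
Hypothesis lsurj : forall s, s \in simplices W -> exists v, l v = s.
Hypothesis Vchain : forall F, F \in simplices V = is_chain (relpre l (fun s t => s \subset t)) F.

Let l_gt0 v : 0 < #|l v|%:R :> R.
Proof.
rewrite ltr0n card_gt0; apply: contraTneq (lW v) => ->; exact: simplex_neq0.
Qed.

Definition barycenter (s : realization R V) (x : vertex W) : R :=
  \sum_(v | x \in l v) set_val s v / #|l v|%:R.

Let barycenter_ge0 s x : 0 <= barycenter s x.
Proof. by apply: sumr_ge0 => v _; rewrite divr_ge0 ?coord_ge0. Qed.

(** The support of a point is a flag, and every barycenter in it is spread
    over the largest simplex of that flag. *)
Fact barycenter_in s : (barycenter s : {ptws vertex W -> R}) \in @barycentric R W.
Proof.
have /[!Vchain]/is_chainP[/set0Pn[v0 v0s] sc] := support_simplex s.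
pose top := [arg max_(v > v0 in support s) #|l v|]%N.
have [tops topP] : top \in support s /\ forall v, v \in support s -> l v \subset l top.
  rewrite /top; case: arg_maxnP => //= v vs vmax; split=> // u us.
  have /orP[//|/= vu] := sc _ _ us vs.
  by rewrite (eqP (_ : l v == l u)) // eqEcard vu vmax.
apply: (barycentric_sub (barycenter_ge0 s) _ (lW top)) => [|x].
  rewrite /barycenter; under eq_bigr do rewrite big_mkcond/=.
  rewrite exchange_big/= -[RHS](coord_sum s); apply: eq_bigr => v _.
  rewrite -big_mkcond/= sumr_const -[LHS]mulr_natr -mulrA mulVf ?mulr1//.
  by rewrite gt_eqF.
rewrite psumr_neq0 => [|v _]; last by rewrite divr_ge0 ?coord_ge0.
move=> /hasP[v _ /andP[xv]]; rewrite pmulr_lgt0 ?invr_gt0// coord_gt0 => vs.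
exact: fintype.subsetP (topP v vs) _ xv.
Qed.

Definition barycenter_fun s : realization R W := bary_point (barycenter_in s).

Lemma continuous_barycenter : continuous barycenter_fun.
Proof.
apply: continuous_into => x; apply: continuous_sum => v _.
by apply: continuous_mulr; [exact: continuous_coord | exact: continuous_const].
Qed.

Definition barycenter_map : continuousType (realization R V) (realization R W) :=
  mkcts continuous_barycenter.

(** A continuous test for [A] being a superlevel set of [t] at a positive
    level: the first product asks for positive values on [A], the second for
    larger values inside [A] than outside. *)
Definition gap (t : realization R W) (A : {set vertex W}) : R :=
  (\prod_(x in A) set_val t x) *
  \prod_(x in A) \prod_(y in ~: A) Num.max 0 (set_val t x - set_val t y).

Let max0_ge0 (a : R) : 0 <= Num.max 0 a. Proof. by rewrite le_max lexx. Qed.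

Lemma gap_ge0 t A : 0 <= gap t A.
Proof.
rewrite mulr_ge0 ?prodr_ge0// => x _; first exact: coord_ge0.
by apply: prodr_ge0.
Qed.

Lemma gapP (t : realization R W) (A : {set vertex W}) : reflect (
  {in A, forall x, 0 < set_val t x} /\
  forall x y, x \in A -> y \notin A -> set_val t y < set_val t x) (gap t A != 0).
Proof.
have pos (a : R) : (0 < Num.max 0 a) = (0 < a) by rewrite lt_max ltxx.
apply: (iffP idP) => [|[tA tAC]].
  rewrite mulf_eq0 negb_or => /andP[/prodf_neq0 tA /prodf_neq0 tAC].
  split=> [x /tA|x y /tAC/prodf_neq0 + yA]; first by rewrite lt_def coord_ge0 andbT.
  by move=> /(_ y); rewrite inE => /(_ yA); rewrite -subr_gt0 -pos lt_def max0_ge0 andbT.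
rewrite /gap; apply: mulf_neq0; apply/prodf_neq0 => x xA; first by rewrite gt_eqF ?tA.
by apply/prodf_neq0 => y; rewrite inE => yA; rewrite gt_eqF// pos subr_gt0 tAC.
Qed.

(** The set of the points of maximal weight is a superlevel set. *)
Lemma gap_superlevel t : exists v, gap t (l v) != 0.
Proof.
have /set0Pn[v0 _] : support t != finset.set0.
  by apply: contraTneq (support_simplex t) => ->; exact: simplex_neq0.
pose x0 := [arg max_(x > v0) set_val t x]%O.
have x0P x : set_val t x <= set_val t x0 by rewrite /x0; case: arg_maxP => // i _; exact.
have x0pos : 0 < set_val t x0.
  rewrite lt_neqAle coord_ge0 andbT eq_sym; apply/eqP => x00.
  have := coord_sum t; rewrite big1 => [/esym/eqP|x _]; first by rewrite oner_eq0.
  by apply/eqP; rewrite eq_le coord_ge0 andbT -x00.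
pose A := [set x | set_val t x == set_val t x0]%SET.
have [v lv] : exists v, l v = A.
  apply: lsurj; apply: (simplex_sub _ _ (support_simplex t)).
    by apply/fintype.subsetP => x; rewrite inE -coord_gt0 => /eqP ->.
  by apply/set0Pn; exists x0; rewrite inE.
exists v; rewrite lv; apply/gapP; split=> [x|x y]; rewrite !inE => /eqP -> //.
by rewrite lt_neqAle x0P andbT.
Qed.

Definition gap_sum t : R := \sum_v gap t (l v).

Lemma gap_sum_gt0 t : 0 < gap_sum t.
Proof.
have [v tv] := gap_superlevel t.
rewrite /gap_sum (bigD1 v)//= ltr_wpDr ?sumr_ge0// => [u _|]; first exact: gap_ge0.
by rewrite lt_def tv gap_ge0.
Qed.

(** The superlevel sets of [t] at positive levels form a flag, so the
    normalized gaps are barycentric coordinates in the subdivision. This is a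
    homotopy inverse of [barycenter_fun]; the weights differ from those of the
    inverse homeomorphism, but the linear homotopies only depend on supports. *)
Definition superlevel (t : realization R W) (v : vertex V) : R :=
  gap t (l v) / gap_sum t.

Fact superlevel_in t : (superlevel t : {ptws vertex V -> R}) \in @barycentric R V.
Proof.
have s0 := gap_sum_gt0 t.
have nz v : superlevel t v != 0 -> gap t (l v) != 0.
  by apply: contra_neq => vt; rewrite /superlevel vt mul0r.
apply: (@barycentric_sub _ _ _ [set v | superlevel t v != 0]%SET) => //.
- by move=> v; rewrite divr_ge0 ?gap_ge0// ltW.
- by rewrite -mulr_suml divff// gt_eqF.
- rewrite Vchain; apply/is_chainP; split.
    have [v tv] := gap_superlevel t; apply/set0Pn; exists v.
    by rewrite inE mulf_neq0// invr_eq0 gt_eqF.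
  move=> v u; rewrite !inE => /nz/gapP[_ tv] /nz/gapP[_ tu].
  apply/orP; have [|/subsetPn[x xv xu]] := boolP (l v \subset l u); first by left.
  right; apply/fintype.subsetP => y yu; apply/negPn/negP => yv.
  have := tv x y xv yv; have := tu y x yu xu.
  by move=> /ltW; rewrite leNgt => /negP.
- by move=> v; rewrite inE.
Qed.

Definition superlevel_fun t : realization R V := bary_point (superlevel_in t).

Lemma continuous_superlevel : continuous superlevel_fun.
Proof.
have gc A : continuous (fun t => gap t A).
  apply: continuous_mulr; apply: continuous_prod => x _; first exact: continuous_coord.
  apply: continuous_prod => y _; apply: continuous_maxr; first exact: continuous_const.
  by apply: continuous_subr; exact: continuous_coord.
apply: continuous_into => v; apply: continuous_mulr; first exact: gc.
apply: continuous_invr => [t|]; first by rewrite gt_eqF// gap_sum_gt0.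
exact: continuous_sum.
Qed.

Definition superlevel_map : continuousType (realization R W) (realization R V) :=
  mkcts continuous_superlevel.

Lemma barycenter_superlevel_support t :
  support (barycenter_fun (superlevel_fun t)) \subset support t.
Proof.
apply/fintype.subsetP => x; rewrite inE /= psumr_neq0 => [|v _]; last first.
  by rewrite divr_ge0 ?(coord_ge0 (superlevel_fun t)).
move=> /hasP[v _ /andP[xv]]; rewrite pmulr_lgt0 ?invr_gt0// => sv.
have {}sv : 0 < superlevel t v by [].
have : gap t (l v) != 0.
  by apply: contraTneq sv => vt; rewrite /superlevel vt mul0r ltxx.
by case/gapP => /(_ x xv); rewrite coord_gt0.
Qed.

(** In the combination of barycenters over a flag the weights grow along the
    flag towards its smaller members, so every superlevel set is a member of
    the flag. *)
Lemma superlevel_barycenter_support s :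
  support (superlevel_fun (barycenter_fun s)) \subset support s.
Proof.
apply/fintype.subsetP => u; rewrite inE => su.
have {}su : superlevel (barycenter_fun s) u != 0 by [].
have /gapP[upos ugap] : gap (barycenter_fun s) (l u) != 0.
  by apply: contraNneq su => ut; rewrite /superlevel ut mul0r.
have /[!Vchain]/is_chainP[_ sc] := support_simplex s.
have /set0Pn[y0 y0u] : l u != finset.set0.
  by apply: contraTneq (lW u) => ->; exact: simplex_neq0.
pose y := [arg min_(x < y0 in l u) barycenter s x]%O.
have [yu ymin] : y \in l u /\ forall x, x \in l u -> barycenter s y <= barycenter s x.
  by rewrite /y; case: arg_minP.
have [v0 v0P] : exists v, (v \in support s) && (y \in l v).
  have := upos y yu; rewrite /= lt_def psumr_neq0 => [|v _]; last first.
    by rewrite divr_ge0 ?coord_ge0.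
  case/andP => /hasP[v _ /andP[yv]]; rewrite pmulr_lgt0 ?invr_gt0// coord_gt0 => vs _.
  by exists v; rewrite vs.
(* the smallest simplex of the flag that contains the lowest point [y] of [l u] *)
pose v := [arg min_(v < v0 | (v \in support s) && (y \in l v)) #|l v|]%N.
have [vs yv vmin] : [/\ v \in support s, y \in l v &
    forall w, w \in support s -> y \in l w -> l v \subset l w].
  rewrite /v; case: arg_minnP => //= w /andP[ws yw] wmin; split=> // w' ws' yw'.
  have /orP[//|/= vu] := sc _ _ ws ws'.
  by rewrite (eqP (_ : l w' == l w)) // eqEcard vu wmin// ws'.
suff -> : u = v by [].
apply/linj/setP => x; apply/idP/idP => [xu|xv]; last first.
  apply/negPn/negP => xu; have : barycenter s x < barycenter s y := ugap y x yu xu.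
  apply/negP; rewrite -leNgt /barycenter big_mkcond [leRHS]big_mkcond/=.
  apply: ler_sum => w _; have sw0 := coord_ge0 s w.
  case: ifP => yw; last by case: ifP => // _; rewrite divr_ge0.
  case: ifP => // xw; have [->|ws] := eqVneq (set_val s w) 0; first by rewrite mul0r.
  by move: xw; rewrite (fintype.subsetP (vmin w _ yw))// inE.
apply/negPn/negP => xv; have := ymin x xu; apply/negP; rewrite -ltNge.
rewrite /barycenter [ltRHS](bigD1 v)//= -[ltLHS]add0r ltr_leD//.
  by rewrite divr_gt0// coord_gt0.
rewrite big_mkcond [leRHS]big_mkcond/=.
apply: ler_sum => w _; have sw0 := coord_ge0 s w.
case: ifP => xw; last by case: ifP => // _; rewrite divr_ge0.
case: ifP => // yw; have [->|ws] := eqVneq (set_val s w) 0; first by rewrite mul0r.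
have ws' : w \in support s by rewrite inE.
have wv : w != v by apply: contraNneq xv => <-.
have /orP[/= wv'|/= vw] := sc _ _ ws' vs.
  by move: xv; rewrite (fintype.subsetP wv').
by move: yw; rewrite (fintype.subsetP vw)// wv.
Qed.

Lemma barycenter_equivalence : homotopy_equivalence R barycenter_map.
Proof.
exists superlevel_map; split; apply: homotopic_linear.
- move=> s; apply: (@continuous_comp _ _ _ barycenter_fun superlevel_fun).
    exact: continuous_barycenter.
  exact: continuous_superlevel.
- by move=> s; exact: cvg_id.
- move=> s; rewrite /= (finset.setUidPr _) ?support_simplex//.
  exact: superlevel_barycenter_support.
- move=> s; apply: (@continuous_comp _ _ _ superlevel_fun barycenter_fun).
    exact: continuous_superlevel.
  exact: continuous_barycenter.
- by move=> s; exact: cvg_id.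
- move=> s; rewrite /= (finset.setUidPr _) ?support_simplex//.
  exact: barycenter_superlevel_support.
Qed.
End Barycenters.

(** Barycenters are preserved only by maps that are injective on vertices,
    since otherwise the cardinality of a simplex changes. *)
Lemma barycenter_natural (R : realType) (W V W' V' : complex)
    (l : vertex V -> {set vertex W}) (l' : vertex V' -> {set vertex W'})
    (fV : simplicial_map V V') (fW : simplicial_map W W') :
  injective fW -> (forall v, l' (fV v) = (fW @: l v)%SET) ->
  forall (s : realization R V) x,
    barycenter l' (realization_fun fV s) x = Defs.pushforward fW (barycenter l s) x.
Proof.
move=> fWinj lf s x; rewrite /barycenter /Defs.pushforward /=.
transitivity (\sum_(v | x \in l' (fV v)) set_val s v / #|l v|%:R).
  rewrite [RHS](partition_big fV (fun v' => x \in l' v'))//=.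
  apply: eq_bigr => v' xv'; rewrite mulr_suml; apply: eq_big => v.
    by apply/eqP/andP => [fv|[_ /eqP//]]; rewrite fv eqxx.
  by move=> /eqP fv; rewrite -fv lf card_imset.
under [RHS]eq_bigr do rewrite big_mkcond/=.
rewrite [RHS]exchange_big/= big_mkcond/=; apply: eq_bigr => v _.
rewrite lf; case: imsetP => [[y yv ->]|nx].
  rewrite (big_pred1 y) ?yv// => z; apply/eqP/eqP => [/fWinj|->]//.
by rewrite big1// => y /eqP fy; case: ifP => // yv; case: nx; exists y.
Qed.

(** * Filtrations of complexes by families of subsets *)

Section Families.
Context (T : finType).

(** A family records a simplicial complex inside a fixed ambient vertex set.
    The vertices of the complex may be fewer than the elements of [T], so that
    complexes that grow with an index can share [T]. *)
Record family := Family {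
  members :> {set {set T}};
  family_neq0 : finset.set0 \notin members;
  family_sub : forall s t : {set T},
    t \subset s -> t != finset.set0 -> s \in members -> t \in members }.

Section Spanned.
Context (D : family).

Definition spanned_vertex : finType := {x : T | [set x]%SET \in (D : {set {set T}})}.

Let spanned_simplices :=
  [set s : {set spanned_vertex} | (val @: s)%SET \in (D : {set {set T}})]%SET.

Fact spanned_neq0 : finset.set0 \notin spanned_simplices.
Proof. by rewrite inE imset0 family_neq0. Qed.

Fact spanned_vertexP v : [set v]%SET \in spanned_simplices.
Proof. by rewrite inE imset_set1 (valP v). Qed.

Fact spanned_sub (s t : {set spanned_vertex}) :
  t \subset s -> t != finset.set0 -> s \in spanned_simplices -> t \in spanned_simplices.
Proof.
rewrite !inE => ts t0; apply: family_sub; first exact: imsetS.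
by rewrite imset_eq0.
Qed.

Definition spanned : complex := Complex spanned_neq0 spanned_vertexP spanned_sub.

Lemma spannedP (s : {set vertex spanned}) :
  (s \in simplices spanned) = ((val @: s)%SET \in (D : {set {set T}})).
Proof. by rewrite inE. Qed.

Section IntoSpanned.
Context (W : complex) (g : vertex W -> T).
Hypothesis gD : forall s, s \in simplices W -> (g @: s)%SET \in (D : {set {set T}}).

Fact into_vertex_subproof v : [set g v]%SET \in (D : {set {set T}}).
Proof. by rewrite -imset_set1; apply: gD; exact: simplex_vertex. Qed.

Definition into_vertex v : vertex spanned := Sub (g v) (into_vertex_subproof v).

Fact into_simplex s : s \in simplices W -> (into_vertex @: s)%SET \in simplices spanned.
Proof. by move=> sW; rewrite spannedP -imset_comp; exact: gD. Qed.

Definition into_spanned : simplicial_map W spanned := SimplicialMap into_simplex.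
End IntoSpanned.
End Spanned.
End Families.

Section Filtrations.
Context (C : category) (T : finType) (D : C -> family T).
Hypothesis Dmono : forall x y : C, Defs.hom x y -> (D x : {set {set T}}) \subset D y.

Fact filtration_subproof x y (f : Defs.hom x y) (s : {set vertex (spanned (D x))}) :
  s \in simplices (spanned (D x)) -> (val @: s)%SET \in (D y : {set {set T}}).
Proof. by rewrite spannedP; apply/fintype.subsetP; exact: Dmono f. Qed.

Definition filtration_map x y (f : Defs.hom x y) :=
  into_spanned (filtration_subproof f).

Fact filtration_map1 x : filtration_map (idc x) = smap_id _.
Proof. by apply: smap_eq => v; apply: val_inj. Qed.

Fact filtration_mapM x y z (g : Defs.hom y z) (f : Defs.hom x y) :
  filtration_map (compc g f) = smap_comp (filtration_map g) (filtration_map f).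
Proof. by apply: smap_eq => v; apply: val_inj. Qed.

Definition filtration : functor C Simp :=
  @Functor C Simp (fun x => spanned (D x)) filtration_map filtration_map1 filtration_mapM.

Section IntoFiltration.
Context (F : functor C Simp) (g : forall c, vertex (F c) -> T).
Hypothesis gD : forall c s, s \in simplices (F c) -> (@g c @: s)%SET \in (D c : {set {set T}}).
Hypothesis gnat : forall c c' (f : Defs.hom c c') v,
  g ((Defs.fmap F f : simplicial_map _ _) v) = g v.

Fact into_filtration_natural c c' (f : Defs.hom c c') :
  @compc Simp _ _ _ (into_spanned (@gD c')) (Defs.fmap F f) =
  @compc Simp _ _ _ (Defs.fmap filtration f) (into_spanned (@gD c)).
Proof. by apply: smap_eq => v; apply: val_inj; rewrite /= gnat. Qed.

(** A map into a filtration is given by labels in the ambient set; since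
    structure maps keep labels, naturality is preservation of labels. *)
Definition into_filtration : nat_trans F filtration :=
  @NatTrans C Simp F filtration (fun c => into_spanned (@gD c)) into_filtration_natural.
End IntoFiltration.
End Filtrations.

Section OrderComplexes.
Context (T : finType) (le : rel T) (P : {set T}).
Hypothesis lexx : reflexive le.

Let chains := [set F : {set T} | is_chain le F && (F \subset P)]%SET.

Fact chains_neq0 : finset.set0 \notin chains.
Proof. by rewrite inE /is_chain eqxx. Qed.

Fact chains_sub (s t : {set T}) : t \subset s -> t != finset.set0 ->
  s \in chains -> t \in chains.
Proof.
rewrite !inE => ts t0 /andP[/is_chainP[_ sc] sP].
rewrite (fintype.subset_trans ts sP) andbT; apply/is_chainP; split=> // x y xt yt.
by apply: sc; apply: (fintype.subsetP ts).
Qed.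

Definition order_family : family T := Family chains_neq0 chains_sub.

Lemma order_familyP F : (F \in (order_family : {set {set T}})) = is_chain le F && (F \subset P).
Proof. by rewrite inE. Qed.

Lemma order_vertexP x : ([set x]%SET \in (order_family : {set {set T}})) = (x \in P).
Proof.
rewrite order_familyP finset.sub1set andb_idl// => _; apply/is_chainP; split.
  by apply/set0Pn; exists x; rewrite inE.
by move=> s t /set1P -> /set1P ->; rewrite lexx.
Qed.

Lemma order_vertex_in (v : vertex (spanned order_family)) : val v \in P.
Proof. by rewrite -order_vertexP (valP v). Qed.

Lemma order_simplexE (F : {set vertex (spanned order_family)}) :
  (F \in simplices (spanned order_family)) = is_chain (relpre val le) F.
Proof.
rewrite spannedP order_familyP; apply/andP/is_chainP => [[/is_chainP[F0 Fc] _]|[F0 Fc]].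
  split=> [|s t sF tF]; first by rewrite -(imset_eq0 val).
  by apply: Fc; exact: imset_f.
split; last by apply/fintype.subsetP => _ /imsetP[v _ ->]; exact: order_vertex_in.
apply/is_chainP; split; first by rewrite imset_eq0.
by move=> _ _ /imsetP[s sF ->] /imsetP[t tF ->]; exact: Fc.
Qed.
End OrderComplexes.

Lemma imset_chain (V V' : finType) (le : rel V) (le' : rel V') (f : V -> V')
    (F : {set V}) :
  (forall x y, x \in F -> y \in F -> le x y -> le' (f x) (f y) || le' (f y) (f x)) ->
  is_chain le F -> is_chain le' (f @: F)%SET.
Proof.
move=> fle /is_chainP[F0 Fc]; apply/is_chainP; split; first by rewrite imset_eq0.
move=> _ _ /imsetP[s sF ->] /imsetP[t tF ->].
by case/orP: (Fc s t sF tF) => /fle; [|rewrite orbC]; apply.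
Qed.

Section Equivalences.
Context (R : realType).

Lemma realization_equivalence W W' (f : simplicial_map W W') (g : simplicial_map W' W) :
  homotopic R (realization_map R (smap_comp g f)) (realization_map R (smap_id W)) ->
  homotopic R (realization_map R (smap_comp f g)) (realization_map R (smap_id W')) ->
  homotopy_equivalence R (realization_map R f).
Proof.
rewrite !realization_mapM !realization_map1 => gf fg.
by exists (realization_map R g).
Qed.

(** A simplicial section leaves only one of the two homotopies to be found. *)
Lemma realization_section_equivalence W W' (f : simplicial_map W W') (g : simplicial_map W' W) :
  homotopic R (realization_map R (smap_comp g f)) (realization_map R (smap_id W)) ->
  cancel g f -> homotopy_equivalence R (realization_map R f).
Proof.
move=> gf fg; apply: (realization_equivalence gf).
rewrite (_ : smap_comp f g = smap_id _); last exact: smap_eq.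
by apply: homotopic_refl; exact: realization_fun_continuous.
Qed.

Lemma realization_iso_equivalence W W' (f : simplicial_map W W') (g : simplicial_map W' W) :
  cancel f g -> cancel g f -> homotopy_equivalence R (realization_map R f).
Proof.
move=> gf; apply: realization_section_equivalence.
rewrite (_ : smap_comp g f = smap_id _); last exact: smap_eq.
by apply: homotopic_refl; exact: realization_fun_continuous.
Qed.

Lemma objectwise_of_simplicial (C : category) (F G : functor C Simp) (a : nat_trans F G) :
  (forall c, homotopy_equivalence R (realization_map R (a c))) ->
  objectwise_equivalence R (Realization R \oF F) (Realization R \oF G).
Proof.
move=> ac.
have nat c c' (f : Defs.hom c c') :
    @compc Top _ _ _ (realization_map R (a c')) (Defs.fmap (Realization R \oF F) f) =
    @compc Top _ _ _ (Defs.fmap (Realization R \oF G) f) (realization_map R (a c)).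
  by rewrite /= -!realization_mapM; congr realization_map; exact: (naturality a).
by exists (@NatTrans C Top (Realization R \oF F) (Realization R \oF G)
  (fun c => realization_map R (a c)) nat).
Qed.

(** Only the maps matter, the functor laws being propositions. *)
Lemma functor_eq (C D : category) (o : C -> D)
    (m m' : forall x y : C, Defs.hom x y -> Defs.hom (o x) (o y)) m1 m1' mM mM' :
  (forall x y f, m x y f = m' x y f) ->
  @Functor C D o m m1 mM = @Functor C D o m' m1' mM'.
Proof.
move=> mm; have {}mm : m = m'.
  by apply: functional_extensionality_dep => x; apply: functional_extensionality_dep => y;
    apply: functional_extensionality_dep.
by case: _ / mm in m1' mM' *; congr Functor; exact: Prop_irrelevance.
Qed.

Lemma functor_compA (A B C D : category) (H : functor C D) (G : functor B C) (F : functor A B) :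
  H \oF (G \oF F) = (H \oF G) \oF F.
Proof. exact: functor_eq. Qed.
End Equivalences.

(** * The nerve of the balls approximates subdivision-Rips *)

Section NerveModel.
Context (R : realType) (X : finMetricType R).
Implicit Types (p q : bigrade R) (s t : {set X}).

Let r2 : R := Num.sqrt 2.
Let r2_ge0 : 0 <= r2. Proof. exact: sqrtr_ge0. Qed.
Let r2_sqr : r2 * r2 = 2. Proof. by rewrite -expr2 sqr_sqrtr. Qed.

Definition in_ball (r : {nonneg R}) (x y : X) := mdist x y <= Num.sqrt 2 * r%:num.

Definition ball_meet r t := [set y | [forall x in t, in_ball r x y]]%SET.
Definition ball_centers r s := [set x | [forall y in s, in_ball r x y]]%SET.

(** Both sides say that every point of [s] is close to every point of [t]. *)
Lemma ball_galois r s t : (s \subset ball_meet r t) = (t \subset ball_centers r s).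
Proof.
apply/fintype.subsetP/fintype.subsetP => st x xt; rewrite inE; apply/forall_inP => y ys.
  by have := st y ys; rewrite inE => /forall_inP; apply.
by have := st y ys; rewrite inE => /forall_inP; apply.
Qed.

Lemma ball_meetS r s t : s \subset t -> ball_meet r t \subset ball_meet r s.
Proof.
move=> st; rewrite ball_galois; apply: fintype.subset_trans st _.
by rewrite -ball_galois.
Qed.

Lemma ball_centersS r s t : s \subset t -> ball_centers r t \subset ball_centers r s.
Proof.
move=> st; rewrite -ball_galois; apply: fintype.subset_trans st _.
by rewrite ball_galois.
Qed.

Lemma ball_meet_mono (r r' : {nonneg R}) t :
  r%:num <= r'%:num -> ball_meet r t \subset ball_meet r' t.
Proof.
move=> rr'; apply/fintype.subsetP => y; rewrite !inE => /forall_inP yt.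
apply/forall_inP => x /yt; rewrite /in_ball => xy; apply: le_trans xy _.
exact: ler_wpM2l.
Qed.

Lemma bigradeP p q :
  (p <= q)%O -> (nat_of_posnat q.1 <= nat_of_posnat p.1)%N /\ p.2%:num <= q.2%:num.
Proof. by rewrite bigrade_le => /andP[]. Qed.

Definition nerve_set p := [set t | (t != finset.set0) && (p.1 <= #|ball_meet p.2 t|)%N]%SET.

Fact nerve_neq0 p : finset.set0 \notin nerve_set p.
Proof. by rewrite inE eqxx. Qed.

Fact nerve_sub p s t : t \subset s -> t != finset.set0 -> s \in nerve_set p -> t \in nerve_set p.
Proof.
rewrite !inE => ts -> /andP[_ sp] /=.
exact: leq_trans sp (subset_leq_card (ball_meetS _ ts)).
Qed.

Definition nerve_family p := Family (@nerve_neq0 p) (@nerve_sub p).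

Lemma nerve_set_mono p q : (p <= q)%O -> nerve_set p \subset nerve_set q.
Proof.
move=> /bigradeP[qp1 pq2]; apply/fintype.subsetP => t; rewrite !inE => /andP[-> tp] /=.
exact: leq_trans qp1 (leq_trans tp (subset_leq_card (ball_meet_mono _ pq2))).
Qed.

Definition nerve_model : simplicial_functor (bigrade R) :=
  @filtration (poset_category (bigrade R)) X nerve_family nerve_set_mono.

Definition rips_set p := [set s | (s \in simplices (rips X p.2)) && (p.1 <= #|s|)%N]%SET.
Definition ball_set p :=
  [set s | (ball_centers p.2 s != finset.set0) && (p.1 <= #|s|)%N]%SET.
Definition pair_set p := [set u : {set X} * {set X} |
  [&& (p.1 <= #|u.1|)%N, u.2 != finset.set0 & u.1 \subset ball_meet p.2 u.2]]%SET.

Definition sub_rel : rel {set X} := fun s t => s \subset t.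
Let sub_refl : reflexive sub_rel. Proof. by move=> s; rewrite /sub_rel. Qed.
(** Inclusion is reversed in the second component because larger sets of
    points have fewer common centres: this makes [s |-> (s, ball_centers r s)]
    monotone. *)
Definition pair_rel : rel ({set X} * {set X}) := fun u v => (u.1 \subset v.1) && (v.2 \subset u.2).
Let pair_refl : reflexive pair_rel. Proof. by move=> s; rewrite /pair_rel !subxx. Qed.

Definition flags (P : {set {set X}}) := order_family sub_rel P.
Definition pair_flags (P : {set {set X} * {set X}}) := order_family pair_rel P.

Lemma order_family_mono (T : finType) (le : rel T) (P Q : {set T}) :
  P \subset Q -> (order_family le P : {set {set T}}) \subset order_family le Q.
Proof.
move=> PQ; apply/fintype.subsetP => F; rewrite !order_familyP => /andP[-> FP] /=.
exact: fintype.subset_trans FP PQ.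
Qed.

(** Any point of a simplex is the centre of a ball that contains it, of radius
    [2 * r = sqrt 2 * (sqrt 2 * r)]. *)
Lemma rips_ball p q : (rescale (sqrt2_ge1 R) p <= q)%O -> rips_set p \subset ball_set q.
Proof.
move=> /bigradeP[/= qp1 pq2]; apply/fintype.subsetP => s; rewrite !inE.
move=> /andP[/andP[/set0Pn[x xs] /forall_inP sr] sp]; rewrite (leq_trans qp1 sp) andbT.
apply/set0Pn; exists x; rewrite inE; apply/forall_inP => y ys.
have /forall_inP/(_ y ys) xy := sr x xs; rewrite /in_ball (le_trans xy)//.
rewrite (_ : 2 * p.2%:num = r2 * (p.2%:num * r2)); first exact: ler_wpM2l.
by rewrite mulrCA r2_sqr mulrC.
Qed.

(** By the triangle inequality through the centre, two points of the ball are
    at distance at most [2 * (sqrt 2 * r)]. *)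
Lemma ball_rips p q : (rescale (sqrt2_ge1 R) p <= q)%O -> ball_set p \subset rips_set q.
Proof.
move=> /bigradeP[/= qp1 pq2]; apply/fintype.subsetP => s; rewrite !inE.
move=> /andP[/set0Pn[z] + sp]; rewrite inE => /forall_inP zs.
rewrite (leq_trans qp1 sp) andbT; apply/andP; split.
  by rewrite -card_gt0 (leq_trans _ sp)// posnat_gt0.
apply/forall_inP => x xs; apply/forall_inP => y ys.
apply: le_trans (metric_triangle x z y) _; rewrite mulr2n mulrDl !mul1r.
have rq : Num.sqrt 2 * p.2%:num <= q.2%:num by rewrite mulrC.
rewrite metric_sym; apply: lerD; exact: le_trans (zs _ _) rq.
Qed.

Lemma rips_set_mono p q : (p <= q)%O -> rips_set p \subset rips_set q.
Proof.
move=> /bigradeP[qp1 pq2]; apply/fintype.subsetP => s; rewrite !inE.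
move=> /andP[/andP[-> /forall_inP sr] sp]; rewrite (leq_trans qp1 sp) andbT /=.
apply/forall_inP => x xs; apply/forall_inP => y ys.
by apply: le_trans (forall_inP (sr x xs) y ys) _; rewrite ler_pM2l.
Qed.

Lemma ball_set_mono p q : (p <= q)%O -> ball_set p \subset ball_set q.
Proof.
move=> /bigradeP[qp1 pq2]; apply/fintype.subsetP => s; rewrite !inE.
move=> /andP[/set0Pn[x xs] sp]; rewrite (leq_trans qp1 sp) andbT.
apply/set0Pn; exists x; move: xs; rewrite -!finset.sub1set -!ball_galois => xs.
exact: fintype.subset_trans xs (ball_meet_mono _ pq2).
Qed.

Lemma pair_set_mono p q : (p <= q)%O -> pair_set p \subset pair_set q.
Proof.
move=> /bigradeP[qp1 pq2]; apply/fintype.subsetP => -[s t]; rewrite !inE /=.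
move=> /and3P[sp -> st]; rewrite (leq_trans qp1 sp) /=.
exact: fintype.subset_trans st (ball_meet_mono _ pq2).
Qed.

(** The two filtrations placed on the two copies of the index set; one functor
    on the interleaving category then has both as restrictions. *)
Definition interleaving_set (x : bigrade R * bool) := if x.2 then ball_set x.1 else rips_set x.1.

Lemma interleaving_set_mono x y :
  interleaving_le (sqrt2_ge1 R) x y -> interleaving_set x \subset interleaving_set y.
Proof.
case: x y => [p b] [q c] [/= pq|[/= -> pq]]; last first.
  by case: c; rewrite /interleaving_set /= (rips_set_mono, ball_set_mono).
have pq' := le_trans (le_rescale (sqrt2_ge1 R) p) pq.
case: b; case: c; rewrite /interleaving_set /=.
- exact: ball_set_mono.
- exact: ball_rips.
- exact: rips_ball.
- exact: rips_set_mono.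
Qed.

Let cat := poset_category (bigrade R).

Definition interleaving_filtration : functor (interleaving_category (sqrt2_ge1 R)) Simp :=
  @filtration (interleaving_category (sqrt2_ge1 R)) {set X}
    (fun x => flags (interleaving_set x))
    (fun x y xy => order_family_mono _ (interleaving_set_mono xy)).

Definition rips_flags : functor cat Simp :=
  @filtration cat {set X} (fun p => flags (rips_set p))
    (fun p q pq => order_family_mono _ (rips_set_mono pq)).
Definition ball_flags : functor cat Simp :=
  @filtration cat {set X} (fun p => flags (ball_set p))
    (fun p q pq => order_family_mono _ (ball_set_mono pq)).
Definition pair_filtration : functor cat Simp :=
  @filtration cat _ (fun p => pair_flags (pair_set p))
    (fun p q pq => order_family_mono _ (pair_set_mono pq)).
Definition nerve_flags : functor cat Simp :=
  @filtration cat {set X} (fun p => flags (nerve_set p))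
    (fun p q pq => order_family_mono _ (nerve_set_mono pq)).

Lemma interleaving_false :
  interleaving_filtration \oF E_embedding (sqrt2_ge1 R) false = rips_flags.
Proof. by apply: functor_eq => p q pq; apply: smap_eq => v; apply: val_inj. Qed.

Lemma interleaving_true :
  interleaving_filtration \oF E_embedding (sqrt2_ge1 R) true = ball_flags.
Proof. by apply: functor_eq => p q pq; apply: smap_eq => v; apply: val_inj. Qed.

Let cmpC (T : finType) (le : rel T) x y : le x y -> le x y || le y x.
Proof. by move->. Qed.

Lemma SR_rips_flags :
  objectwise_equivalence R (Realization R \oF SR X) (Realization R \oF rips_flags).
Proof.
pose g p (v : vertex (SR X p)) : {set X} := val v.
have gD p F : F \in simplices (SR X p) ->
    (g p @: F)%SET \in (flags (rips_set p) : {set {set {set X}}}).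
  move=> Fp; rewrite order_familyP; apply/andP; split.
    move: Fp; rewrite inE => Fp.
    by apply: (@imset_chain _ _ (relpre val sub_rel) _ _ F _ Fp) => x y _ _; exact: cmpC.
  by apply/fintype.subsetP => _ /imsetP[v _ ->]; rewrite inE (valP v).
have gn p q (pq : @Defs.hom cat p q) v : g q ((Defs.fmap (SR X) pq : simplicial_map _ _) v) = g p v.
  by [].
apply: (@objectwise_of_simplicial R cat _ _ (@into_filtration cat _ _ _ _ g gD gn)) => p.
have kP (v : vertex (spanned (flags (rips_set p)))) :
    (val v \in simplices (rips X p.2)) && (p.1 <= #|val v|)%N.
  by have := order_vertex_in sub_refl v; rewrite inE.
pose k (v : vertex (spanned (flags (rips_set p)))) : vertex (SR X p) := Sub (val v) (kP v).
have kS F : F \in simplices (spanned (flags (rips_set p))) -> (k @: F)%SET \in simplices (SR X p).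
  rewrite order_simplexE // inE => Fc.
  by apply: (@imset_chain _ _ _ (relpre val sub_rel) k F _ Fc) => x y _ _; exact: cmpC.
apply: (@realization_iso_equivalence R _ _ _ (SimplicialMap kS)) => v; exact: val_inj.
Qed.

Lemma subset_meet_centers r s : s \subset ball_meet r (ball_centers r s).
Proof. by rewrite ball_galois. Qed.

Lemma pair_le_trans : transitive pair_rel.
Proof.
move=> v u w /andP[uv vu] /andP[vw wv]; rewrite /pair_rel.
by rewrite (fintype.subset_trans uv vw) (fintype.subset_trans wv vu).
Qed.

Lemma pair_le_anti : antisymmetric pair_rel.
Proof.
move=> [a b] [c d] /andP[/andP[/= ac db] /andP[ca bd]].
by congr (_, _); apply/eqP; rewrite finset.eqEsubset ?ac ?bd.
Qed.

Lemma pair_rel_vertex p :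
  [/\ transitive (relpre (val : vertex (spanned (pair_flags (pair_set p))) -> _) pair_rel)
  & antisymmetric (relpre (val : vertex (spanned (pair_flags (pair_set p))) -> _) pair_rel)].
Proof.
split; first by move=> ? ? ?; exact: pair_le_trans.
by move=> u v /pair_le_anti /val_inj.
Qed.

(** The section [s |-> (s, ball_centers r s)] composed with the projection
    lies below the identity, as [t] is contained in the set of all common
    centres of [s]. *)
Lemma pair_ball_flags :
  objectwise_equivalence R (Realization R \oF pair_filtration) (Realization R \oF ball_flags).
Proof.
pose g p (v : vertex (pair_filtration p)) : {set X} := (val v).1.
have gD p F : F \in simplices (pair_filtration p) ->
    (g p @: F)%SET \in (flags (ball_set p) : {set {set {set X}}}).
  rewrite order_simplexE => // Fp; rewrite order_familyP; apply/andP; split.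
    by apply: imset_chain Fp => x y _ _ /andP[xy _]; rewrite /sub_rel xy.
  apply/fintype.subsetP => _ /imsetP[v _ ->]; have := order_vertex_in pair_refl v.
  rewrite !inE => /and3P[-> /set0Pn[x xv] vb]; rewrite andbT; apply/set0Pn; exists x.
  by move: vb; rewrite ball_galois => /fintype.subsetP; apply.
have gn p q (pq : @Defs.hom cat p q) v :
    g q ((Defs.fmap pair_filtration pq : simplicial_map _ _) v) = g p v by [].
apply: (@objectwise_of_simplicial R cat _ _ (@into_filtration cat _ _ _ _ g gD gn)) => p.
pose k (v : vertex (ball_flags p)) : {set X} * {set X} := (val v, ball_centers p.2 (val v)).
have kS F : F \in simplices (ball_flags p) ->
    (k @: F)%SET \in (pair_flags (pair_set p) : {set {set {set X} * {set X}}}).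
  rewrite order_simplexE => // Fc; rewrite order_familyP; apply/andP; split.
    apply: imset_chain Fc => x y _ _ xy; apply: cmpC.
    by rewrite /pair_rel /= ball_centersS ?andbT.
  apply/fintype.subsetP => _ /imsetP[v _ ->]; have := order_vertex_in sub_refl v.
  by rewrite !inE /= => /andP[-> ->]; exact: subset_meet_centers.
apply: (@realization_section_equivalence R _ _ _ (into_spanned kS)); last first.
  by move=> v; exact: val_inj.
have [ptr pas] := pair_rel_vertex p.
apply: (proj1 (@homotopic_monotone R (pair_filtration p) (pair_filtration p) (relpre val pair_rel)
  (relpre val pair_rel) (smap_comp (into_spanned kS) (into_spanned (gD p))) (smap_id _)
  _ _ _ _ _ _ _ _)) => //.
- by move=> F; rewrite order_simplexE.
- by move=> F; rewrite order_simplexE.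
- by move=> u v /andP[uv vu]; rewrite /pair_rel /= /g ball_centersS ?andbT.
- move=> v; rewrite /pair_rel /= subxx /=; have := order_vertex_in pair_refl v.
  by rewrite inE => /and3P[_ _]; rewrite ball_galois.
Qed.

(** The section [t |-> (ball_meet r t, t)] composed with the projection lies
    above the identity, as [s] is contained in the meet of the balls centred
    in [t]. *)
Lemma pair_nerve_flags :
  objectwise_equivalence R (Realization R \oF pair_filtration) (Realization R \oF nerve_flags).
Proof.
pose g p (v : vertex (pair_filtration p)) : {set X} := (val v).2.
have gD p F : F \in simplices (pair_filtration p) ->
    (g p @: F)%SET \in (flags (nerve_set p) : {set {set {set X}}}).
  rewrite order_simplexE => // Fp; rewrite order_familyP; apply/andP; split.
    by apply: imset_chain Fp => x y _ _ /andP[_ xy]; rewrite /sub_rel xy orbT.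
  apply/fintype.subsetP => _ /imsetP[v _ ->]; have := order_vertex_in pair_refl v.
  by rewrite !inE => /and3P[vp -> vb]; exact: leq_trans vp (subset_leq_card vb).
have gn p q (pq : @Defs.hom cat p q) v :
    g q ((Defs.fmap pair_filtration pq : simplicial_map _ _) v) = g p v by [].
apply: (@objectwise_of_simplicial R cat _ _ (@into_filtration cat _ _ _ _ g gD gn)) => p.
pose k (v : vertex (nerve_flags p)) : {set X} * {set X} := (ball_meet p.2 (val v), val v).
have kS F : F \in simplices (nerve_flags p) ->
    (k @: F)%SET \in (pair_flags (pair_set p) : {set {set {set X} * {set X}}}).
  rewrite order_simplexE => // Fc; rewrite order_familyP; apply/andP; split.
    apply: imset_chain Fc => x y _ _ xy; rewrite orbC; apply: cmpC.
    by rewrite /pair_rel /= ball_meetS.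
  apply/fintype.subsetP => _ /imsetP[v _ ->]; have := order_vertex_in sub_refl v.
  by rewrite !inE /= => /andP[-> ->] /=.
apply: (@realization_section_equivalence R _ _ _ (into_spanned kS)); last first.
  by move=> v; exact: val_inj.
have [ptr pas] := pair_rel_vertex p.
apply: (proj2 (@homotopic_monotone R (pair_filtration p) (pair_filtration p) (relpre val pair_rel)
  (relpre val pair_rel) (smap_id _) (smap_comp (into_spanned kS) (into_spanned (gD p)))
  _ _ _ _ _ _ _ _)) => //.
- by move=> F; rewrite order_simplexE.
- by move=> F; rewrite order_simplexE.
- by move=> u v /andP[uv vu]; rewrite /pair_rel /= /g ball_meetS.
- move=> v; rewrite /pair_rel /= subxx andbT; have := order_vertex_in pair_refl v.
  by rewrite inE => /and3P[_ _].
Qed.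

(** The flags of nerve simplices form the barycentric subdivision of the
    nerve. *)
Lemma nerve_flags_nerve :
  objectwise_equivalence R (Realization R \oF nerve_flags) (Realization R \oF nerve_model).
Proof.
pose l p (v : vertex (nerve_flags p)) : {set vertex (nerve_model p)} :=
  [set x | val x \in val v]%SET.
have lE p v : (val @: l p v)%SET = val v :> {set X}.
  apply/setP => x; apply/imsetP/idP => [[y + ->]|xv]; first by rewrite inE.
  have vp := order_vertex_in sub_refl v.
  have xp : [set x]%SET \in (nerve_family p : {set {set X}}).
    apply: nerve_sub vp; first by rewrite finset.sub1set.
    by apply/set0Pn; exists x; rewrite inE.
  by exists (Sub x xp); rewrite ?inE SubK.
have linj p : injective (l p) by move=> u v uv; apply: val_inj; rewrite -!lE uv.
have lW p v : l p v \in simplices (nerve_model p).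
  by rewrite spannedP lE; exact: order_vertex_in sub_refl v.
have lsurj p (s : {set vertex (nerve_model p)}) :
    s \in simplices (nerve_model p) -> exists v, l p v = s.
  rewrite spannedP => sp.
  have sv : [set (val @: s)%SET]%SET \in (flags (nerve_set p) : {set {set {set X}}}).
    by rewrite order_vertexP.
  exists (Sub (val @: s)%SET sv : spanned_vertex (flags (nerve_set p))).
  by apply/setP => x; rewrite inE SubK mem_imset//; exact: val_inj.
have lc p (F : {set vertex (nerve_flags p)}) :
    (F \in simplices (nerve_flags p)) =
    @is_chain (vertex (nerve_flags p)) (fun u v => l p u \subset l p v) F.
  rewrite order_simplexE //.
  suff lS (u v : vertex (nerve_flags p)) : (l p u \subset l p v) = sub_rel (val u) (val v).
    by rewrite /is_chain; congr (_ && _); apply: eq_forallb_in => u _; apply: eq_forallb_in => v _;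
      rewrite /= !lS.
  rewrite /sub_rel -!lE; apply/idP/idP => [|/fintype.subsetP uv]; first exact: imsetS.
  apply/fintype.subsetP => x xu; have := uv (val x).
  by rewrite !mem_imset; [apply|exact: val_inj..].
pose b p := @barycenter_map R _ _ (l p) (lW p) (lc p).
have nat p q (pq : @Defs.hom cat p q) :
    @compc Top _ _ _ (b q) (Defs.fmap (Realization R \oF nerve_flags) pq) =
    @compc Top _ _ _ (Defs.fmap (Realization R \oF nerve_model) pq) (b p).
  apply/continuousEP => s; apply/val_inj/funext => x.
  apply: (@barycenter_natural R _ _ _ _ (l p) (l q)) => [y z yz|v].
    by apply: val_inj; exact: (congr1 val yz).
  apply: (imset_inj (@val_inj _ _ (vertex (nerve_model q)))).
  by rewrite lE -imset_comp; exact/esym/lE.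
exists (@NatTrans cat Top (Realization R \oF nerve_flags)
  (Realization R \oF nerve_model) b nat) => p.
exact: (@barycenter_equivalence R _ _ (l p) (@linj p) (@lW p) (@lsurj p) (@lc p)).
Qed.

Lemma nerve_model_approximation :
  is_approximation (sqrt2_ge1 R) (SR X) nerve_model.
Proof.
exists (Realization R \oF rips_flags), (Realization R \oF ball_flags); split.
- by apply: rst_sym; apply: rst_step; exact: SR_rips_flags.
- apply: (@rst_trans _ _ _ (Realization R \oF pair_filtration) _).
    by apply: rst_sym; apply: rst_step; exact: pair_ball_flags.
  apply: (@rst_trans _ _ _ (Realization R \oF nerve_flags) _).
    by apply: rst_step; exact: pair_nerve_flags.
  by apply: rst_step; exact: nerve_flags_nerve.
- exists (Realization R \oF interleaving_filtration).
  by rewrite -interleaving_false -interleaving_true !functor_compA.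
Qed.

End NerveModel.

(** * Clopen separation as a homotopy invariant *)

Section ClopenSeparation.
Context (R : realType).

(** Equality of quasi-components. It replaces path components, with which it
    shares invariance under homotopy, and clopen sets pull back along
    continuous maps without further work. *)
Definition joined (Y : topologicalType) (x y : Y) :=
  forall U : set Y, clopen U -> U x <-> U y.

Lemma joined_sym (Y : topologicalType) (x y : Y) : joined x y -> joined y x.
Proof. by move=> xy U Uc; have [] := xy U Uc. Qed.

Lemma joined_trans (Y : topologicalType) (y x z : Y) : joined x y -> joined y z -> joined x z.
Proof.
by move=> xy yz U Uc; split=> [/(xy U Uc).1/(yz U Uc).1|/(yz U Uc).2/(xy U Uc).2].
Qed.

Lemma joined_map (Y Z : topologicalType) (f : continuousType Y Z) (x y : Y) :
  joined x y -> joined (f x) (f y).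
Proof.
by move=> xy U Uc; apply: (xy (f @^-1` U)%classic); apply: preimage_clopen => //; exact: cts_fun.
Qed.

(** The unit interval is connected. *)
Lemma joined_path (Y : topologicalType) (g : R -> Y) :
  continuous g -> joined (g 0) (g 1).
Proof.
move=> gc U [Uo Uc].
have Bc := connected_continuous_connected (@segment_connected R 0 1) (continuous_subspaceT gc).
have g0 : (g @` `[0, 1]%classic)%classic (g 0).
  by exists 0 => //=; rewrite in_itv /= lexx ler01.
have g1 : (g @` `[0, 1]%classic)%classic (g 1).
  by exists 1 => //=; rewrite in_itv /= lexx ler01.
have key a b : (g @` `[0, 1]%classic)%classic a -> (g @` `[0, 1]%classic)%classic b -> U a -> U b.
  move=> ga gb Ua.
  have : ((g @` `[0, 1]) `&` U = (g @` `[0, 1]))%classic.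
    apply: Bc; first by exists a.
      by exists U.
    by exists U.
  by move=> E; move: gb; rewrite -E => -[].
by split; apply: key.
Qed.

Lemma joined_homotopic (Y Z : topologicalType) (f g : Y -> Z) x :
  homotopic R f g -> joined (f x) (g x).
Proof.
move=> [H [/subspace_continuousP Hc Hf Hg]]; rewrite -Hf -Hg.
have gc : continuous (fun u : R => H (x, clamp u)).
  move=> u P /= Pu.
  have xA (v : R) : (setT `*` `[0, 1])%classic (x, clamp v).
    by split=> //=; rewrite in_itv /= clamp_itv.
  have := Hc _ (xA u) P Pu; rewrite /fmap /= !nbhs_simpl /within /= => HP.
  case: HP => -[A B] /= [Ax Bu] AB.
  have clampB : nbhs u (fun v => B (clamp v)) := @continuous_clamp R u B Bu.
  apply: (@filterS R (nbhs (u : R)) (nbhs_filter (u : R)) _ _ _ clampB) => v Bv.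
  by apply: (AB (x, clamp v)); [split=> //; exact: nbhs_singleton | exact: xA].
by have := joined_path gc; rewrite /= clamp0 clamp1.
Qed.

(** The image of [F f] on quasi-components has at least as many elements as
    [I]. Unlike the number of components of one space, this is visible through
    interleavings. *)
Definition separates (C : category) (F : functor C Top) (c d : C) (f : Defs.hom c d) (I : Type) :=
  exists x : I -> F c, forall i j,
    joined ((Defs.fmap F f : continuousType _ _) (x i))
      ((Defs.fmap F f : continuousType _ _) (x j)) -> i = j.

(** Points are transported by the components of the transformation, or by
    homotopy inverses of those; naturality carries the separation along. *)
Lemma separates_objectwise (C : category) (F G : functor C Top) (c d : C)
    (f : Defs.hom c d) (I : Type) :
  objectwise_equivalence R F G -> separates F f I <-> separates G f I.
Proof.
move=> [a aeq]; have nat u : (Defs.fmap G f : continuousType _ _) ((a c : continuousType _ _) u) =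
    (a d : continuousType _ _) ((Defs.fmap F f : continuousType _ _) u).
  exact/esym/(congr1 (fun h : continuousType (F c) (G d) => h u) (naturality a f)).
split=> -[x xsep].
- exists (fun i => (a c : continuousType _ _) (x i)) => i j; rewrite !nat => ij.
  have [b [ba _]] := aeq d.
  have E k := @joined_homotopic _ _ _ _ ((Defs.fmap F f : continuousType _ _) (x k)) ba.
  apply: xsep; exact: joined_trans (joined_trans (joined_sym (E i)) (joined_map b ij)) (E j).
- have [b [_ ab]] := aeq c.
  exists (fun i => b (x i)) => i j ij0.
  have := joined_map (a d) ij0; rewrite -!nat => ij; apply: xsep.
  have E k : joined ((Defs.fmap G f : continuousType _ _) ((a c : continuousType _ _) (b (x k))))
     ((Defs.fmap G f : continuousType _ _) (x k)).
    by apply: joined_map; exact: (joined_homotopic _ ab).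
  exact: joined_trans (joined_trans (joined_sym (E i)) ij) (E j).
Qed.

Lemma separates_weak (C : category) (F G : functor C Top) (c d : C) (f : Defs.hom c d) (I : Type) :
  weakly_equivalent R F G -> separates F f I <-> separates G f I.
Proof.
elim=> [{}F {}G /separates_objectwise|//|{}F {}G _ FG|{}F H {}G _ FH _ HG]; first exact.
- by split=> [/FG.2|/FG.1].
- by split=> [/FH.1/HG.1|/HG.2/FH.2].
Qed.

(** Clopen sets pull back, so points that are separated after going to [d] are
    already separated in [c]. *)
Lemma separates_factor (C : category) (F : functor C Top) (b c d : C) (f : Defs.hom b c)
    (g : Defs.hom c d) (I : Type) :
  separates F (compc g f) I -> separates F (idc c) I.
Proof.
move=> [x xsep]; exists (fun i => (Defs.fmap F f : continuousType _ _) (x i)) => i j.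
rewrite fmap1 => ij; apply: xsep; rewrite fmapM.
exact: (joined_map (Defs.fmap F g) ij).
Qed.
End ClopenSeparation.

Section VertexPoints.
Context (R : realType).

Fact vertex_point_in (W : complex) (v : vertex W) :
  ((fun w => (w == v)%:R) : {ptws vertex W -> R}) \in @barycentric R W.
Proof.
apply: (barycentric_sub _ _ (simplex_vertex v)) => [w|| w].
- by rewrite ler0n.
- by rewrite (bigD1 v)//= eqxx big1 ?addr0// => w /negbTE ->.
- by rewrite inE; case: (w == v); rewrite // eqxx.
Qed.

Definition vertex_point (W : complex) (v : vertex W) : realization R W :=
  bary_point (vertex_point_in v).

Lemma support_vertex_point (W : complex) (v : vertex W) : support (vertex_point v) = [set v]%SET.
Proof.
apply/setP => w; rewrite !inE -[LHS]/((w == v)%:R != 0 :> R).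
by case: (w == v); rewrite ?oner_eq0 ?eqxx.
Qed.

(** A point is joined by a segment to each vertex of its support. *)
Lemma joined_vertex (W : complex) (t : realization R W) :
  exists v, joined t (vertex_point v).
Proof.
have /set0Pn[v vt] : support t != finset.set0.
  by apply: contraTneq (support_simplex t) => ->; exact: simplex_neq0.
exists v.
apply: (@joined_homotopic R R _ (fun=> t) (fun=> vertex_point v) 0).
apply: homotopic_linear => [? |? |_]; [exact: cvg_cst | exact: cvg_cst |].
by rewrite support_vertex_point (finset.setUidPl _) ?support_simplex// finset.sub1set.
Qed.

Lemma separates_card (C : category) (F : functor C Simp) (c : C) (I : finType) :
  separates (Realization R \oF F) (idc c) I -> (#|I| <= #|vertex (F c)|)%N.
Proof.
move=> [x xsep].
have /choice[v vP] := fun i => joined_vertex (x i).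
apply: (leq_card v) => i j vij; apply: xsep; rewrite fmap1.
by apply: joined_trans (vP i) _; rewrite vij; apply: joined_sym; exact: vP.
Qed.

Lemma vertex_point_map (W W' : complex) (f : simplicial_map W W') v :
  realization_map R f (vertex_point v) = vertex_point (f v).
Proof.
apply/val_inj/funext => w; rewrite -[LHS]/(\sum_(u | f u == w) ((u == v)%:R : R)).
rewrite -[RHS]/((w == f v)%:R : R) big_mkcond (bigD1 v)//= eqxx big1 => [|u /negbTE ->].
  by rewrite addr0 eq_sym; case: ifP.
by rewrite if_same.
Qed.

(** All coordinates of a complex of dimension zero are [0] or [1], so the
    half-space where the coordinate of [u] exceeds one half is clopen. *)
Lemma vertex_point_separated (W : complex) :
  (forall s, s \in simplices W -> #|s| = 1) ->
  forall u v : vertex W, joined (vertex_point u) (vertex_point v) -> u = v.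
Proof.
move=> W1 u v uv.
have c01 (t : realization R W) : set_val t u = 0 \/ set_val t u = 1.
  have /eqP/cards1P[w tw] := W1 _ (support_simplex t).
  have tE x : x != w -> set_val t x = 0.
    by move=> xw; apply/eqP; have : x \notin support t by [rewrite tw inE]; rewrite inE negbK.
  have [->|uw] := eqVneq u w; last by left; exact: tE.
  by right; rewrite -(coord_sum t) (bigD1 w)//= big1 ?addr0.
pose U := [set t : realization R W | 2^-1 < (set_val t u : R)]%classic.
have UE : U = [set t : realization R W | 2^-1 <= (set_val t u : R)]%classic.
  apply/seteqP; split=> t; rewrite /U /=; first exact: ltW.
  by case: (c01 t) => -> ?; lra.
have Uc : clopen U.
  split; last rewrite UE.
    apply: (open_comp _ (@open_gt R 2^-1)) => t _; exact: (@continuous_coord R W u t).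
  apply: (preimage_closed _ (@closed_ge R 2^-1)) => t _; exact: (@continuous_coord R W u t).
have h1 : (2^-1 : R) < 1 by lra.
have h0 : ~~ ((2^-1 : R) < 0) by rewrite -leNgt; lra.
have Uv w : U (vertex_point w) <-> u = w.
  have -> : U (vertex_point w) = (2^-1 < ((u == w)%:R : R)) by [].
  by case: eqP => [->|uw]; rewrite ?mulr1n ?mulr0n ?h1 ?(negbTE h0); split.
by apply/Uv/(uv U Uc)/Uv.
Qed.
End VertexPoints.

(** * Generators of chain modules and numbers of vertices *)

Section SizeBoundsVertices.
Context (K : fieldType) (d : Order.disp_t) (P : porderType d).
Implicit Type (M : pmodule K P).

Lemma card_enum (T : Type) (A : set T) n : (A #= `I_n)%card ->
  exists s : 'I_n -> T, forall x, A x <-> exists i, s i = x.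
Proof.
elim: n A => [|n IH] A /=.
  rewrite II0 card_eq0 => /eqP ->.
  by exists (fun i : 'I_0 => match notF (ltn_ord i) with end) => x; split=> // -[[]].
case/eq_cardSP => x Ax /IH[s sP].
exists (fun i => if unlift ord0 i is Some j then s j else x) => y; split=> [Ay|[i <-]].
  have [->|yx] := pselect (y = x); first by exists ord0; rewrite unlift_none.
  have /sP[j <-] : (A `\ x)%classic y by split.
  by exists (lift ord0 j); rewrite liftK.
case: (unlift ord0 i) => [j|//].
by have [] : (A `\ x)%classic (s j) by apply/sP; exists j.
Qed.

Lemma transitionM M (x y z : P) (xy : (x <= y)%O) (yz : (y <= z)%O) (xz : (x <= z)%O) (u : M x) :
  transition M yz (transition M xy u) = transition M xz u.
Proof.
rewrite (Prop_irrelevance xz (le_trans xy yz)).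
exact/esym/(congr1 (fun h : {linear M x -> M z} => h u)
  (@fmapM (poset_category P) (Vec K) M x y z yz xy)).
Qed.

Lemma transition1 M (x : P) (xx : (x <= x)%O) (u : M x) : transition M xx u = u.
Proof.
rewrite (Prop_irrelevance xx (lexx x)).
exact: (congr1 (fun h : {linear M x -> M x} => h u) (@fmap1 (poset_category P) (Vec K) M x)).
Qed.

(** The zero value outside the up-set of the degree of [s] lets sums over
    generators range over all of them. *)
Definition shifted M (s : elements M) (x : P) : M x :=
  if pselect ((projT1 s <= x)%O) is left le_sx then transition M le_sx (projT2 s) else 0.

(** The combinations of the generators of degree at most [x], taken at every
    [x], form a submodule that contains the generators. *)
Lemma generated_span M (S : set (elements M)) b : generates S -> (S #= `I_b)%card ->
  exists s : 'I_b -> elements M, forall x (u : M x),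
    exists c : 'I_b -> K, u = \sum_i c i *: shifted (s i) x.
Proof.
move=> Sgen /card_enum[s sP]; exists s.
pose N x : set (M x) := [set u | exists c : 'I_b -> K,
  (forall i, c i != 0 -> (projT1 (s i) <= x)%O) /\ u = \sum_i c i *: shifted (s i) x]%classic.
have Nsub : submodule N.
  split=> [x|x a u v [c [cx ->]] [e [ex ->]]|x y xy u [c [cx ->]]].
  - exists (fun=> 0); split=> [i|]; first by rewrite eqxx.
    by rewrite big1// => i _; rewrite scale0r.
  - exists (fun i => a * c i + e i); split=> [i|].
      by apply: contraNT => six; apply/eqP; have [/eqP-> /eqP->] : c i == 0 /\ e i == 0;
        [split; apply: contraNT six; [exact: cx|exact: ex] | rewrite mulr0 addr0].
    rewrite scaler_sumr -big_split/=; apply: eq_bigr => i _.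
    by rewrite scalerDl scalerA.
  - exists c; split=> [i /cx six|]; first exact: le_trans six xy.
    rewrite linear_sum; apply: eq_bigr => i _; rewrite linearZ/=.
    have [->|ci0] := eqVneq (c i) 0; first by rewrite !scale0r.
    congr (_ *: _); rewrite /shifted; have six := cx i ci0.
    case: pselect => // six'; case: pselect => [siy|[]]; last exact: le_trans six xy.
    exact: transitionM.
have Sin x u : S (existT _ x u) -> N x u.
  move=> /sP[i si]; exists (fun j => (j == i)%:R); split=> [j|].
    by have [->|] := eqVneq j i; rewrite ?eqxx// si.
  rewrite (bigD1 i)//= eqxx scale1r big1 ?addr0; last by move=> j /negbTE ->; rewrite scale0r.
  rewrite si /shifted /=; case: pselect => [xx|[]//].
  exact/esym/transition1.
by move=> x u; have [c [_ uE]] := Sgen N Nsub Sin x u; exists c.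
Qed.

Lemma betti0_span M b : betti M 0 b ->
  forall x, exists w : 'I_b -> M x, forall u, exists c : 'I_b -> K, u = \sum_i c i *: w i.
Proof.
move=> [C [[[_ _ [e [_ esurj]]] _] [S [[Sgen _] Sb]]]] x.
have [s sP] := generated_span Sgen Sb.
exists (fun i => Defs.pmap e x (shifted (s i) x)) => u; have [v <-] := esurj x u.
have [c ->] := sP x v; exists c; rewrite linear_sum; apply: eq_bigr => i _.
by rewrite linearZ.
Qed.

Section VertexChain.
Context (W : complex) (v : vertex W).

Fact vertex_chain_in :
  [ffun w : otuple 0 (vertex W) => (w ord0 == v)%:R : K^o] \in @chain_pred K 0 W.
Proof.
apply/chain_predP; split=> [w|w s]; rewrite !ffunE; last first.
  rewrite (_ : s = 1%g) ?odd_perm1 ?expr0 ?mul1r ?perm1//.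
  by apply/permP => i; apply/eqP; rewrite [s i]ord1 perm1 [i]ord1.
move=> _; split; first by apply/injectiveP => i j _; rewrite [i]ord1 [j]ord1.
rewrite (_ : [set _ | _ in _]%SET = [set w ord0]%SET) ?simplex_vertex//.
apply/setP => x; rewrite inE; apply/imsetP/eqP => [[i _ ->]|->]; first by rewrite [i]ord1.
by exists ord0.
Qed.

Definition vertex_chain : chain K 0 W := Chain vertex_chain_in.
End VertexChain.

(** The vertices are linearly independent chains spanned by [b] elements;
    their expansions factor an identity matrix through dimension [b]. *)
Lemma betti0_chain0 (G : simplicial_functor P) b x :
  betti (chain_module K G 0) 0 b -> (#|vertex (G x)| <= b)%N.
Proof.
move=> /betti0_span/(_ x)[w wspan].
have /choice[c cP] := fun v : vertex (G x) => wspan (vertex_chain v).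
pose n := #|vertex (G x)|.
pose A : 'M[K]_(n, b) := \matrix_(i, j) c (enum_val i) j.
pose B : 'M[K]_(b, n) := \matrix_(i, j)
  chain_coef (w i : chain K 0 (G x)) [ffun=> enum_val j].
have AB : A *m B = 1%:M.
  apply/matrixP => i j; rewrite !mxE; under eq_bigr do rewrite !mxE.
  have := congr1 (fun u : chain K 0 (G x) => chain_coef u [ffun=> enum_val j]) (cP (enum_val i)).
  rewrite /= !ffunE (inj_eq enum_val_inj) eq_sym => ->.
  have -> (I : finType) (F : I -> chain K 0 (G x)) :
      chain_coef (\sum_i F i) = \sum_i chain_coef (F i).
    by apply: (big_morph (@chain_coef K 0 (G x))) => //.
  by rewrite sum_ffunE; apply: eq_bigr => k _; rewrite ffunE.
apply: (@leq_trans (\rank (A *m B))); first by rewrite AB mxrank1.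
by rewrite (leq_trans (mxrankM_maxl _ _)) ?rank_leq_col.
Qed.

Lemma has_size_vertices (G : simplicial_functor P) n x :
  has_size K G n -> (#|vertex (G x)| <= n)%N.
Proof.
move=> [_ [b1 [b0 [N [_ b0P b0N ->]]]]].
apply: leq_trans (betti0_chain0 x (b0P 0%N)) _.
case: N b0N => [|N] b0N; first by rewrite b0N.
by rewrite big_ord_recl addnCA leq_addr.
Qed.
End SizeBoundsVertices.

(** * Metric spaces with exponentially many maximal simplices *)

Section PolynomialGrowth.
Context (R : realType).

Lemma exp_beats_linear (c d : nat) : exists m : nat, (c + m.+1 * d < 2 ^ m)%N.
Proof.
pose a := (c + 3 * d + 1)%N; exists (a + a)%N; rewrite expnD.
have a2 : (a < 2 ^ a)%N := ltn_expl _ (leqnn _).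
apply: leq_trans (leq_mul a2 a2); rewrite /a; nia.
Qed.

(** A polynomial is at most [2^c * x^d] for [x >= 1]; at [x = 2^(m + 1)] this
    is to be compared with [2^(2^m)], which leaves the linear comparison of
    exponents. *)
Lemma exp_beats_poly (q : {poly R}) : exists n : nat, q.[(n.+1 * 2)%:R] < (2 ^ n.+1)%:R.
Proof.
pose C := \sum_(i < size q) `|q`_i|.
have C0 : 0 <= C by apply: sumr_ge0 => i _; exact: normr_ge0.
pose c := Num.bound C.
have [m mP] := exp_beats_linear c (size q).
exists (2 ^ m).-1; rewrite prednK ?expn_gt0// -expnSr.
set x : R := (2 ^ m.+1)%:R.
have x1 : 1 <= x by rewrite ler1n expn_gt0.
have x0 : 0 <= x := le_trans ler01 x1.
have qx : q.[x] <= C * x ^+ size q.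
  rewrite horner_coef /C mulr_suml; apply: ler_sum => i _.
  apply: le_trans (ler_norm _) _; rewrite normrM; apply: ler_wpM2l => //.
  by rewrite ger0_norm ?exprn_ge0// ler_weXn2l// ltnW.
apply: le_lt_trans qx _; apply: le_lt_trans (_ : _ <= (2 ^ c)%:R * x ^+ size q) _.
  apply: ler_wpM2r; first exact: exprn_ge0.
  apply: le_trans (ltW (archi_boundP C0)) _; rewrite ler_nat ltnW//; exact: ltn_expl.
by rewrite -natrX -natrM ltr_nat -expnM -expnD ltn_exp2l.
Qed.
End PolynomialGrowth.

(** The couples are indexed by a subset type of [nat] rather than by an
    ordinal, which keeps the space in [Set]: the spaces are to be members of a
    set over all finite metric spaces, a large type. *)
Definition party (R : realType) (n : nat) : Set := ({i : nat | (i < n.+1)%N} * bool)%type.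

Section PartyMembers.
Context (R : realType) (n : nat).

Definition couple (x : party R n) : 'I_n.+1 := Ordinal (valP x.1).
Definition member (i : 'I_n.+1) (b : bool) : party R n := (Sub (val i) (ltn_ord i), b).

Lemma memberK x : member (couple x) x.2 = x.
Proof. by case: x => i b; rewrite /member; congr (_, _); exact: val_inj. Qed.

Lemma couple_member i b : couple (member i b) = i.
Proof. exact: val_inj. Qed.

Lemma party_pairK : cancel (fun x => (couple x, x.2)) (fun p : 'I_n.+1 * bool => member p.1 p.2).
Proof. exact: memberK. Qed.
End PartyMembers.

HB.instance Definition _ (R : realType) n := Finite.copy (party R n) (can_type (@party_pairK R n)).

Section PartyMetric.
Context (R : realType) (n : nat).
Implicit Types x y z : party R n.

Definition party_dist x y : R := if x == y then 0 else if couple x == couple y then 2 else 1.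

Fact party_distxx x : party_dist x x = 0.
Proof. by rewrite /party_dist eqxx. Qed.

Fact party_dist_eq0 x y : party_dist x y = 0 -> x = y.
Proof.
rewrite /party_dist; case: eqP => // _; case: ifP => _ /eqP; rewrite ?oner_eq0//.
by rewrite pnatr_eq0.
Qed.

Fact party_dist_sym x y : party_dist x y = party_dist y x.
Proof. by rewrite /party_dist eq_sym [couple x == _]eq_sym. Qed.

Fact party_dist_triangle y x z : party_dist x z <= party_dist x y + party_dist y z.
Proof.
rewrite /party_dist; have [->|xy] := eqVneq x y; first by rewrite add0r.
have [yz|yz] := eqVneq y z; first by rewrite addr0 -yz (negbTE xy).
by case: eqP => _; repeat case: ifP => _; lra.
Qed.

HB.instance Definition _ := isMetric.Build R (party R n) party_distxx party_dist_eq0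
  party_dist_sym party_dist_triangle.

Definition party_space : finMetricType R := party R n.

Lemma mdist_party (x y : party_space) : mdist x y = party_dist x y.
Proof. by []. Qed.

Lemma card_party : #|party_space| = (n.+1 * 2)%N.
Proof.
rewrite -[RHS](_ : #|{: 'I_n.+1 * bool}| = _); last by rewrite card_prod card_ord card_bool.
apply: (bij_eq_card (f := fun x : party_space => (couple x, x.2))).
exists (fun p => member R p.1 p.2); first exact: party_pairK.
by move=> [i b]; rewrite couple_member.
Qed.

Let N := PosNat (ltn0Sn n).

(** Below scale [1] a simplex contains at most one member of each couple. *)
Lemma party_simplex_card (r : {nonneg R}) (s : {set party_space}) :
  r%:num < 1 -> s \in simplices (rips party_space r) -> (#|s| <= n.+1)%N.
Proof.
move=> r1; rewrite inE => /andP[_ /forall_inP sr].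
rewrite -[leqRHS]card_ord -(card_in_imset (f := @couple R n)) ?max_card// => x y xs ys xy.
have /forall_inP/(_ y ys) := sr x xs; rewrite mdist_party /party_dist xy eqxx.
by case: eqP => // _; rewrite leNgt -ltr_pdivlMl// mulVf ?r1.
Qed.

Definition section_set (b : {ffun 'I_n.+1 -> bool}) : {set party_space} :=
  [set x : party_space | x.2 == b (couple x)]%SET.

Lemma section_set_inj : injective section_set.
Proof.
move=> b c /setP bc; apply/ffunP => i.
by have := bc (member R i (b i)); rewrite !inE couple_member eqxx => /esym/eqP.
Qed.

Lemma card_section_set b : #|section_set b| = n.+1.
Proof.
rewrite -[RHS]card_ord -(card_imset _ (f := fun i => member R i (b i) : party_space)); last first.
  by move=> i j /(congr1 (@couple R n)); rewrite !couple_member.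
apply: eq_card => x; rewrite inE; apply/eqP/imsetP => [xb|[i _ ->]]; last by rewrite couple_member.
by exists (couple x); rewrite // -xb memberK.
Qed.

Lemma section_set_rips (r : {nonneg R}) b : 1 <= 2 * r%:num ->
  section_set b \in simplices (rips party_space r).
Proof.
move=> r1; rewrite inE -card_gt0 card_section_set /=.
apply/forall_inP => x; rewrite inE => /eqP xb; apply/forall_inP => y; rewrite inE => /eqP yb.
rewrite mdist_party /party_dist; case: eqP => [_|xy]; first exact: le_trans ler01 r1.
by case: eqP => // xy1; case: xy; rewrite -(memberK x) -(memberK y) xb yb xy1.
Qed.

(** In the subdivision at [k = n + 1] no two simplices of this size are
    nested, so the complex is discrete. *)
Lemma party_SR_separates (p q : bigrade R) (pq : (p <= q)%O) :
  p.1 = N :> nat -> q.1 = N :> nat -> 1 <= 2 * p.2%:num -> q.2%:num < 1 ->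
  @separates (poset_category (bigrade R)) (Realization R \oF SR party_space) p q pq
    {ffun 'I_n.+1 -> bool}.
Proof.
move=> pN qN p1 q1.
have bP b : (section_set b \in simplices (rips party_space p.2)) && (p.1 <= #|section_set b|)%N.
  by apply/andP; split; [exact: section_set_rips | rewrite card_section_set pN leqnn].
pose v b : vertex (SR party_space p) := Sub (section_set b) (bP b).
exists (fun b => vertex_point R (v b)) => b c bc.
have nq : (n.+1 <= q.1)%N by rewrite qN leqnn.
have flags1 s : s \in simplices (SR party_space q) -> #|s| = 1%N.
  rewrite inE.
  move=> /(@is_chainP (vertex (SR party_space q)) (fun u v => val u \subset val v) s)[s0 sc].
  apply/eqP; rewrite eqn_leq card_gt0 s0 andbT.
  apply/card_le1P => x xs y; rewrite inE; apply/idP/eqP => [ys|->//].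
  have qcard (u : vertex (SR party_space q)) : #|val u| = n.+1.
    have /andP[ur uq] := valP u; apply/eqP; rewrite eqn_leq (party_simplex_card q1 ur).
    exact: leq_trans nq uq.
  by apply/val_inj/eqP; case/orP: (sc _ _ xs ys) => xy; [rewrite eq_sym|];
    rewrite eqEcard xy /= (qcard x) (qcard y).
move: bc; rewrite -[joined _ _]/(joined (realization_map R (SR_map _ pq) (vertex_point R (v b)))
  (realization_map R (SR_map _ pq) (vertex_point R (v c)))) !vertex_point_map.
move/(vertex_point_separated flags1)/(congr1 val); exact: section_set_inj.
Qed.

(** The structure map of subdivision-Rips from scale [1/2] to [delta^2 / 2]
    factors through the approximation at scale [delta / 2], which therefore
    has as many quasi-components as there are choices of members. *)
Lemma party_approximation_size (K : fieldType) (delta : R) (delta_ge1 : 1 <= delta)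
    (G : simplicial_functor (bigrade R)) (m : nat) :
  delta < Num.sqrt 2 -> is_approximation delta_ge1 (SR party_space) G ->
  has_size K G m -> (2 ^ n.+1 <= m)%N.
Proof.
move=> delta2 [F' [G' [FF GG [Z [ZF ZG]]]]] Gm.
have d0 : 0 <= delta := le_trans ler01 delta_ge1.
have dd2 : delta * delta < 2.
  have -> : 2 = Num.sqrt 2 * Num.sqrt 2 :> R by rewrite -expr2 sqr_sqrtr.
  exact: ltr_pM.
have h0 : 0 <= 2^-1 :> R by rewrite invr_ge0.
pose p : bigrade R := (N, NngNum h0).
pose c := rescale delta_ge1 p.
pose q := rescale delta_ge1 c.
have pq : (p <= q)%O := le_trans (le_rescale _ _) (le_rescale _ _).
have /(separates_weak _ _ FF) : @separates (poset_category (bigrade R))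
    (Realization R \oF SR party_space) p q pq {ffun 'I_n.+1 -> bool}.
  by apply: party_SR_separates => //=; [rewrite mulfV | lra].
rewrite -ZF => Zpq.
pose I := interleaving_category delta_ge1.
have pc : @interleaving_le R delta delta_ge1 (p, false) (c, true) by left.
have cq : @interleaving_le R delta delta_ge1 (c, true) (q, false) by left.
(* at [c] the functor [Z] takes the values of the approximating filtration *)
have Zc : separates Z (@idc I (c, true)) {ffun 'I_n.+1 -> bool}.
  apply: (@separates_factor I Z (p, false) (c, true) (q, false) pc cq).
  have -> : @compc I _ _ _ cq pc = E_map delta_ge1 false pq
    by exact: (@Prop_irrelevance (interleaving_le delta_ge1 (p, false) (q, false))).
  exact: Zpq.
have : separates G' (@idc (poset_category (bigrade R)) c) {ffun 'I_n.+1 -> bool}.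
  rewrite -ZG; have E : E_map delta_ge1 true (lexx c) = @idc I (c, true)
    by exact: (@Prop_irrelevance (interleaving_le delta_ge1 (c, true) (c, true))).
  by move: Zc; rewrite -E.
move=> /(separates_weak _ _ GG)/separates_card; rewrite card_ffun card_bool card_ord => Gc.
exact: leq_trans Gc (has_size_vertices _ Gm).
Qed.
End PartyMetric.

Definition party_family (R : realType) : set (finMetricType R) :=
  fun X => exists n, X = party_space R n.

(** The spaces have pairwise distinct cardinalities. *)
Lemma party_family_infinite (R : realType) : infinite_set (@party_family R).
Proof.
move=> [n /card_eqP[f]].
have inF m : party_space R m \in @party_family R by rewrite inE; exists m.
pose x m : set_type (@party_family R) := SigSub (inF m).
have fn m : (set_val (f (x m)) < n)%N by have := set_mem (valP (f (x m))).
have := @leq_card _ _ (fun i : 'I_n.+1 => Ordinal (fn i)); rewrite !card_ord ltnn.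
move=> H; suff /H : injective (fun i : 'I_n.+1 => Ordinal (fn i)) by [].
move=> i j /(congr1 val)/= /val_inj fij.
have /(congr1 set_val)/= : x i = x j by apply: (@inj _ _ _ f) fij; rewrite inE.
move/(congr1 (fun X : finMetricType R => #|X|)); rewrite !card_party => /eqP.
by rewrite eqn_pmul2r// eqSS => /eqP/val_inj.
Qed.

Lemma no_polynomial_approximation (R : realType) (K : fieldType) :
  exists XX : set (finMetricType R), infinite_set XX /\
     forall (delta : R) (delta_ge1 : 1 <= delta), delta < Num.sqrt 2 ->
       ~ exists q : {poly R}, forall X : finMetricType R, XX X ->
           exists (G : simplicial_functor (bigrade R)) (n : nat),
             [/\ is_approximation delta_ge1 (SR X) G, has_size K G n &
                 n%:R <= q.[#|X|%:R]].
Proof.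
exists (@party_family R); split; first exact: party_family_infinite.
move=> delta delta_ge1 delta2 [q qP]; have [n nP] := exp_beats_poly q.
have [//|G [m [Gapp Gm]]] := qP (party_space R n); first by exists n.
rewrite card_party => mq; move: (le_lt_trans mq nP); rewrite ltr_nat ltnNge.
by rewrite (party_approximation_size delta2 Gapp Gm).
Qed.

(** * Free modules over a poset *)

Section ModuleMaps.
Context (K : fieldType) (d : Order.disp_t) (P : porderType d).
Implicit Types (M A B C : pmodule K P).

Lemma transition_natural A B (f : nat_trans A B) (x y : P) (xy : (x <= y)%O) (u : A x) :
  Defs.pmap f y (transition A xy u) = transition B xy (Defs.pmap f x u).
Proof.
exact: (congr1 (fun h : {linear A x -> B y} => h u)
  (@naturality (poset_category P) (Vec K) A B f x y xy)).
Qed.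

Section MakeMap.
Context A B (f : forall x : P, {linear A x -> B x}).
Hypothesis fnat : forall (x y : P) (xy : (x <= y)%O) (u : A x),
  f y (transition A xy u) = transition B xy (f x u).

Fact module_map_natural (x y : poset_category P) (xy : Defs.hom x y) :
  @compc (Vec K) _ _ _ (f y) (Defs.fmap A xy) = @compc (Vec K) _ _ _ (Defs.fmap B xy) (f x).
Proof. by apply: linear_eq => u; exact: fnat. Qed.

Definition module_map : nat_trans A B :=
  @NatTrans (poset_category P) (Vec K) A B f module_map_natural.

End MakeMap.

Definition zero_map A B : nat_trans A B.
Proof.
apply: (@module_map A B (fun x => \0 : {linear A x -> B x})).
by move=> x y xy u; rewrite /= linear0.
Defined.

Definition comp_map A B C (g : nat_trans B C) (f : nat_trans A B) : nat_trans A C.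
Proof.
apply: (@module_map A C (fun x => Defs.pmap g x \o Defs.pmap f x : {linear A x -> C x})).
by move=> x y xy u; rewrite /= !transition_natural.
Defined.

Definition sub_map A B (f g : nat_trans A B) : nat_trans A B.
Proof.
apply: (@module_map A B (fun x => Defs.pmap f x \- Defs.pmap g x : {linear A x -> B x})).
by move=> x y xy u; rewrite /= !transition_natural linearB.
Defined.

Definition id_map A : nat_trans A A.
Proof. by apply: (@module_map A A (fun x => idfun : {linear A x -> A x})). Defined.

Lemma comp_mapE A B C (g : nat_trans B C) (f : nat_trans A B) x u :
  Defs.pmap (comp_map g f) x u = Defs.pmap g x (Defs.pmap f x u).
Proof. by []. Qed.
Lemma sub_mapE A B (f g : nat_trans A B) x u :
  Defs.pmap (sub_map f g) x u = Defs.pmap f x u - Defs.pmap g x u.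
Proof. by []. Qed.
Lemma id_mapE A x u : Defs.pmap (id_map A) x u = u. Proof. by []. Qed.
End ModuleMaps.

Section FreeModules.
Context (K : fieldType) (d : Order.disp_t) (P : porderType d).
Implicit Types (M A B C : pmodule K P).

Section Generators.
Context (I : choiceType) (g : I -> P).
Local Notation F := (free_module K g).

Lemma free_eq (x : P) (u v : free_at K g x) : coef u =1 coef v -> u = v.
Proof. by move=> uv; apply/val_inj/funext. Qed.

Lemma coefD (x : P) (u v : free_at K g x) i : (u + v) i = u i + v i.
Proof. by []. Qed.
Lemma coefZ (x : P) a (u : free_at K g x) i : (a *: u) i = a * u i.
Proof. by []. Qed.
Lemma coef0 (x : P) i : (0 : free_at K g x) i = 0.
Proof. by []. Qed.
Lemma coef_sum (x : P) (T : Type) (s : seq T) (G : T -> free_at K g x) i :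
  (\sum_(t <- s) G t) i = \sum_(t <- s) G t i.
Proof. by apply: (big_morph (fun u : free_at K g x => u i)). Qed.
Lemma coef_transition (x y : P) (xy : (x <= y)%O) (u : F x) i :
  (transition F xy u : free_at K g y) i = (u : free_at K g x) i.
Proof. by []. Qed.

Lemma coef_finite (x : P) (u : free_at K g x) : finite_set [set i | u i != 0]%classic.
Proof. by have /asboolP[] := coefP u. Qed.

Lemma coef_le (x : P) (u : free_at K g x) i : u i != 0 -> (g i <= x)%O.
Proof. by have /asboolP[_] := coefP u; apply. Qed.

Fact free_gen_in i : (fun j => (j == i)%:R : K^o) \in free_pred g (g i).
Proof.
apply/asboolP; split=> [|j]; last by have [->//|] := eqVneq j i; rewrite eqxx.
apply: (@sub_finite_set _ _ [set i]%classic); last exact: finite_set1.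
by move=> j /=; have [->//|] := eqVneq j i; rewrite eqxx.
Qed.

Definition free_gen i : free_at K g (g i) := FreeAt (free_gen_in i).

Definition free_supp (x : P) (u : free_at K g x) := fset_set [set i | u i != 0]%classic.

Lemma mem_free_supp (x : P) (u : free_at K g x) i : (i \in free_supp u) = (u i != 0).
Proof.
rewrite in_fset_set; last exact: coef_finite.
by apply/idP/idP; rewrite inE.
Qed.

Lemma free_expand (x : P) (u : free_at K g x) :
  u = \sum_(i <- free_supp u) u i *: shifted (M := F) (existT _ (g i) (free_gen i)) x.
Proof.
apply: free_eq => j; rewrite coef_sum.
have [uj0|uj] := eqVneq (u j) 0.
  rewrite uj0 big_seq big1// => i; rewrite mem_free_supp => ui.
  rewrite coefZ /shifted; case: pselect => [le_ix|_]; last by rewrite mulr0.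
  rewrite coef_transition /=; case: eqP => [ji|_]; last by rewrite mulr0.
  by move: ui; rewrite -ji uj0 eqxx.
rewrite (big_fsetD1 j) ?mem_free_supp// big_seq big1 ?addr0 => [|i].
  rewrite coefZ /shifted; case: pselect => [?|[]]; last exact: coef_le uj.
  by rewrite coef_transition /= eqxx mulr1 addr0.
rewrite !inE => /andP[ij _]; rewrite coefZ /shifted; case: pselect => [?|_]; last by rewrite mulr0.
by rewrite coef_transition /= eq_sym (negbTE ij) mulr0.
Qed.

Section Extend.
Context M (m : forall i, M (g i)).

Definition extend_fun (x : P) (u : F x) : M x :=
  \sum_(i <- free_supp u) (u : free_at K g x) i *: shifted (existT _ (g i) (m i)) x.

Lemma extend_funE (x : P) (u : F x) (S : {fset I}) : {subset free_supp u <= S} ->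
  extend_fun u = \sum_(i <- S) (u : free_at K g x) i *: shifted (existT _ (g i) (m i)) x.
Proof.
move=> uS; rewrite /extend_fun; apply: big_fset_incl; first exact/fsubsetP.
by move=> i _; rewrite mem_free_supp negbK => /eqP ->; rewrite scale0r.
Qed.

Fact extend_linear (x : P) : linear (@extend_fun x).
Proof.
move=> a u v.
have uS : {subset free_supp u <= (free_supp u `|` free_supp v)%fset}
  by move=> i; rewrite inE => ->.
have vS : {subset free_supp v <= (free_supp u `|` free_supp v)%fset}
  by move=> i; rewrite inE orbC => ->.
rewrite (extend_funE uS) (extend_funE vS) (@extend_funE _ _ (free_supp u `|` free_supp v)%fset).
  rewrite scaler_sumr -big_split/=; apply: eq_bigr => i _.
  by rewrite scalerA -scalerDl.
move=> i; rewrite inE !mem_free_supp; apply: contraNT.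
rewrite negb_or !negbK => /andP[/eqP ui /eqP vi].
by rewrite coefD coefZ ui vi mulr0 addr0.
Qed.

HB.instance Definition _ x :=
  GRing.isLinear.Build K (F x) (M x) _ (@extend_fun x) (@extend_linear x).

Lemma shifted_transition (s : elements M) (x y : P) (xy : (x <= y)%O) :
  (projT1 s <= x)%O -> transition M xy (shifted s x) = shifted s y.
Proof.
move=> sx; rewrite /shifted; case: pselect => // sx'; case: pselect => [sy|[]].
  exact: transitionM.
exact: le_trans sx xy.
Qed.

Definition extend : nat_trans F M.
Proof.
apply: (@module_map _ _ _ F M (fun x => @extend_fun x : {linear F x -> M x})).
move=> x y xy u /=; rewrite /extend_fun linear_sum; apply: eq_big_seq => i.
rewrite mem_free_supp => ui; rewrite linearZ/=; congr (_ *: _).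
by rewrite shifted_transition//; exact: (@coef_le x u i ui).
Defined.

Lemma extendE x u : Defs.pmap extend x u = extend_fun u. Proof. by []. Qed.

Lemma extend_gen i : Defs.pmap extend (g i) (free_gen i) = m i.
Proof.
rewrite extendE (@extend_funE _ _ [fset i]%fset) => [|j].
  rewrite big_seq_fset1 /= eqxx scale1r /shifted; case: pselect => [?|[]//]; exact: transition1.
by rewrite mem_free_supp inE /=; case: (j == i); rewrite ?eqxx.
Qed.
End Extend.

Lemma map_shifted M (f : nat_trans F M) (i : I) (x : P) :
  Defs.pmap f x (shifted (M := F) (existT _ (g i) (free_gen i)) x) =
  shifted (existT _ (g i) (Defs.pmap f (g i) (free_gen i))) x.
Proof.
rewrite /shifted; case: pselect => [?|_]; last by rewrite linear0.
exact: transition_natural.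
Qed.

Lemma map_expand M (f : nat_trans F M) (x : P) (u : F x) :
  Defs.pmap f x u = \sum_(i <- free_supp u) (u : free_at K g x) i *:
    shifted (existT _ (g i) (Defs.pmap f (g i) (free_gen i))) x.
Proof.
rewrite [in LHS](free_expand u) linear_sum; apply: eq_bigr => i _.
by rewrite linearZ/= map_shifted.
Qed.

Lemma free_map_eq M (f f' : nat_trans F M) :
  (forall i, Defs.pmap f (g i) (free_gen i) = Defs.pmap f' (g i) (free_gen i)) ->
  forall x u, Defs.pmap f x u = Defs.pmap f' x u.
Proof. by move=> ff' x u; rewrite !map_expand; apply: eq_bigr => i _; rewrite ff'. Qed.

(** Projectivity of free modules: lifts are chosen on generators. *)
Lemma free_module_lift A B (p : nat_trans A B) (q : nat_trans F B) :
  (forall x u, exists v, Defs.pmap p x v = Defs.pmap q x u) ->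
  exists q' : nat_trans F A, forall x u, Defs.pmap p x (Defs.pmap q' x u) = Defs.pmap q x u.
Proof.
move=> pq.
pose m i := projT1 (cid (pq (g i) (free_gen i))).
have mP i : Defs.pmap p (g i) (m i) = Defs.pmap q (g i) (free_gen i) :=
  projT2 (cid (pq (g i) (free_gen i))).
exists (extend m) => x u; rewrite -comp_mapE; apply: free_map_eq => i.
by rewrite comp_mapE extend_gen mP.
Qed.

Lemma free_gens_generate : generates (M := F)
  [set s | exists i, s = existT _ (g i) (free_gen i)]%classic.
Proof.
move=> N [N0 Nlin Ntr] Ngen x u; rewrite (free_expand u).
have : all (fun i => (g i <= x)%O) (finmap.enum_fset (free_supp u)).
  by apply/allP => i; rewrite mem_free_supp; exact: coef_le.
elim: (finmap.enum_fset (free_supp u)) => [|i s IH] /=; first by rewrite big_nil.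
case/andP => ix /IH {}IH; rewrite big_cons; apply: Nlin IH.
rewrite /shifted; case: pselect => // {}ix.
by apply: Ntr; apply: Ngen; exists i.
Qed.

(** Without the generator [i], the elements with vanishing coefficient at [i]
    form a proper submodule that contains all the others. *)
Lemma free_gens_minimal : minimal_generating_set (M := F)
  [set s | exists i, s = existT _ (g i) (free_gen i)]%classic.
Proof.
split; first exact: free_gens_generate.
move=> T Tsub Tgen; apply/seteqP; split=> // _ [i ->].
apply: contrapT => iT.
pose N (x : P) : set (F x) := [set u | (u : free_at K g x) i = 0]%classic.
have Nsub : submodule N.
  split=> [x|x a u v|x y xy u] //=; rewrite /N /=.
  move=> u0 v0; rewrite -[LHS]/(a * (u : free_at K g x) i + (v : free_at K g x) i).
  by rewrite u0 v0 mulr0 addr0.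
have NT x u : T (existT _ x u) -> N x u.
  move=> Txu; have [j ju] := Tsub _ Txu; move: Txu; rewrite ju => Tj.
  have ij : i != j by apply/eqP => ij; apply: iT; rewrite ij.
  have : (projT2 (existT (fun x => F x) x u) : free_at K g _) i = 0.
    by rewrite ju /= (negbTE ij).
  by [].
have := Tgen N Nsub NT (g i) (free_gen i); rewrite /N /= eqxx => /eqP.
by rewrite oner_eq0.
Qed.
End Generators.

(** The index type of [F] comes without decidable equality; the classical
    choice structure supplies it. *)
Lemma is_free_lift A B F (p : nat_trans A B) (q : nat_trans F B) :
  is_free F -> (forall x u, exists v, Defs.pmap p x v = Defs.pmap q x u) ->
  exists q' : nat_trans F A, forall x u, Defs.pmap p x (Defs.pmap q' x u) = Defs.pmap q x u.
Proof.
move=> [I [g [a [b ab]]]] pq.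
have [|q' q'P] := @free_module_lift {classic I} g A B p (comp_map q b).
  by move=> x u; rewrite comp_mapE; exact: pq.
exists (comp_map q' a) => x u; rewrite comp_mapE q'P comp_mapE.
have [ba _] := ab x.
by have /= := congr1 (fun h : {linear F x -> F x} => h u) ba; rewrite /Defs.pmap => ->.
Qed.
End FreeModules.

(** * Minimality of resolutions of length one *)

Section Kernels.
Context (K : fieldType) (d : Order.disp_t) (P : porderType d).
Context (A B : pmodule K P) (f : nat_trans A B).

Definition ker_pred (x : P) : {pred A x} := fun u => Defs.pmap f x u == 0.

Fact ker_submod x : submod_closed (@ker_pred x).
Proof.
split=> [|a u v]; rewrite /ker_pred !unfold_in ?linear0// => /eqP u0 /eqP v0.
by rewrite linearP u0 v0 scaler0 addr0.
Qed.

HB.instance Definition _ x := GRing.isSubmodClosed.Build K (A x) (@ker_pred x) (ker_submod x).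

Record ker_at (x : P) := KerAt { ker_val : A x; ker_valP : ker_val \in @ker_pred x }.

HB.instance Definition _ x := [isSub for @ker_val x].
HB.instance Definition _ x := [Choice of ker_at x by <:].
HB.instance Definition _ x := [SubChoice_isSubLmodule of ker_at x by <:].

Lemma ker_eq0 x (u : ker_at x) : Defs.pmap f x (ker_val u) = 0.
Proof. exact/eqP/(ker_valP u). Qed.

Fact ker_map_in x y (xy : (x <= y)%O) (u : ker_at x) : transition A xy (ker_val u) \in @ker_pred y.
Proof. by rewrite unfold_in transition_natural ker_eq0 linear0. Qed.

Definition ker_map x y (xy : (x <= y)%O) (u : ker_at x) : ker_at y := KerAt (ker_map_in xy u).

Fact ker_map_linear x y (xy : (x <= y)%O) : linear (ker_map xy).
Proof. by move=> a u v; apply: val_inj; exact: linearP. Qed.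

HB.instance Definition _ x y (xy : (x <= y)%O) :=
  GRing.isLinear.Build K (ker_at x) (ker_at y) _ (ker_map xy) (ker_map_linear xy).

Definition ker_lin x y (xy : (x <= y)%O) : {linear ker_at x -> ker_at y} := ker_map xy.

Fact ker_lin1 x : ker_lin (lexx x) = lin_id (ker_at x).
Proof. by apply: linear_eq => u; apply: val_inj; exact: transition1. Qed.

Fact ker_linM x y z (yz : (y <= z)%O) (xy : (x <= y)%O) :
  ker_lin (le_trans xy yz) = lin_comp (ker_lin yz) (ker_lin xy).
Proof. by apply: linear_eq => u; apply: val_inj; exact/esym/transitionM. Qed.

Definition ker_module : pmodule K P :=
  @Functor (poset_category P) (Vec K) ker_at (fun x y xy => ker_lin xy) ker_lin1
    (fun x y z yz xy => ker_linM yz xy).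

Fact ker_val_linear (x : P) : linear (@ker_val x). Proof. by []. Qed.
HB.instance Definition _ x :=
  GRing.isLinear.Build K (ker_at x) (A x) _ (@ker_val x) (@ker_val_linear x).

Definition ker_incl : nat_trans ker_module A.
Proof.
by apply: (@module_map _ _ _ ker_module A (fun x => @ker_val x : {linear ker_at x -> A x})).
Defined.

End Kernels.

Section KernelMaps.
Context (K : fieldType) (d : Order.disp_t) (P : porderType d).
Context (A B A' B' : pmodule K P) (f : nat_trans A B) (f' : nat_trans A' B') (h : nat_trans A A').
Hypothesis hf : forall x u, Defs.pmap f x u = 0 -> Defs.pmap f' x (Defs.pmap h x u) = 0.

Fact ker_lift_in (x : P) (u : ker_at f x) : Defs.pmap h x (ker_val u) \in @ker_pred _ _ _ _ _ f' x.
Proof. by rewrite unfold_in hf// ker_eq0. Qed.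

Definition ker_lift_fun (x : P) (u : ker_at f x) : ker_at f' x := KerAt (ker_lift_in u).

Fact ker_lift_linear x : linear (@ker_lift_fun x).
Proof. by move=> a u v; apply: val_inj; exact: linearP. Qed.

HB.instance Definition _ x :=
  GRing.isLinear.Build K (ker_at f x) (ker_at f' x) _ (@ker_lift_fun x) (@ker_lift_linear x).

Definition ker_lift : nat_trans (ker_module f) (ker_module f').
Proof.
apply: (@module_map _ _ _ (ker_module f) (ker_module f')
  (fun x => @ker_lift_fun x : {linear ker_at f x -> ker_at f' x})).
by move=> x y xy u; apply: val_inj; exact: transition_natural.
Defined.

End KernelMaps.

(** An endomorphism that strictly lowers degrees on supports is nilpotent, so
    adding the identity gives a bijection. Injectivity is seen at an element
    of the support of maximal rank, and surjectivity by induction on a bound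
    for the ranks in the support. *)
Section Triangular.
Context (K : fieldType) (d : Order.disp_t) (P : porderType d) (I : finType) (g : I -> P) (x : P).
Context (n : {linear free_at K g x -> free_at K g x}).
Hypothesis nlt : forall u i, n u i != 0 -> exists2 j, (u : free_at K g x) j != 0 & (g i < g j)%O.

Let rank i := #|[set j | (g j < g i)%O]|.

Let rank_lt i j : (g i < g j)%O -> (rank i < rank j)%N.
Proof.
move=> ij; apply: proper_card; apply/properP; split.
  by apply/fintype.subsetP => k; rewrite !inE => ki; exact: lt_trans ki ij.
by exists i; rewrite !inE ?ltxx.
Qed.

Lemma triangular_bijective : bijective (fun u => u + n u).
Proof.
have inj0 u : u + n u = 0 -> u = 0.
  move=> un0; apply: free_eq => i0; apply/eqP/negPn/negP => ui0.
  pose i := [arg max_(i > i0 | (u : free_at K g x) i != 0%R) rank i]%N.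
  have [ui imax] : u i != 0 /\ forall j, (u : free_at K g x) j != 0 -> (rank j <= rank i)%N.
    by rewrite /i; case: arg_maxnP.
  have [|j uj ij] := @nlt u i.
    apply: contraNneq ui => nui; have := congr1 (fun v : free_at K g x => v i) un0.
    by rewrite coefD nui addr0 coef0 => ->.
  by have := imax j uj; rewrite leqNgt rank_lt.
have surj k w : (forall i, (w : free_at K g x) i != 0 -> (rank i < k)%N) -> exists u, u + n u = w.
  elim: k w => [|k IH] w wk.
    exists 0; rewrite linear0 addr0; apply: free_eq => i; apply/esym/eqP/negPn/negP => /wk.
    by rewrite ltn0.
  have [|u' u'E] := IH (n w).
    by move=> i /nlt[j /wk jk /rank_lt ij]; exact: leq_trans ij jk.
  by exists (w - u'); rewrite linearB/= addrACA -opprD u'E addrK.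
have surj' w : exists u, u + n u = w.
  by apply: (surj (\max_i rank i).+1) => i _; rewrite ltnS leq_bigmax.
exists (fun w => projT1 (cid (surj' w))) => [u|w]; last exact: projT2 (cid (surj' w)).
have := projT2 (cid (surj' (u + n u))); set v := projT1 _ => vE.
apply/eqP; rewrite -subr_eq0; apply/eqP/inj0.
by rewrite linearB/= addrACA -opprD vE subrr.
Qed.
End Triangular.

(** By naturality the image is a combination of transported images of
    generators, and that of [i] lives in degree [g i]. *)
Lemma map_support (K : fieldType) (d : Order.disp_t) (P : porderType d) (I J : choiceType)
    (g : I -> P) (h : J -> P) (f : nat_trans (free_module K g) (free_module K h))
    (x : P) (u : free_at K g x) j :
  (Defs.pmap f x u : free_at K h x) j != 0 -> exists2 i, u i != 0 & (h j <= g i)%O.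
Proof.
move=> fuj.
pose G i : free_at K h x :=
  shifted (M := free_module K h) (existT _ (g i) (Defs.pmap f (g i) (free_gen K g i))) x.
have : has (fun i => ((u i : K) *: G i) j != 0) (finmap.enum_fset (free_supp u)).
  apply: contraNT fuj => /hasPn f0.
  have -> : Defs.pmap f x u = \sum_(i <- free_supp u) (u i : K) *: G i by exact: map_expand.
  rewrite (@coef_sum K _ _ _ h) big_seq big1// => i iu.
  by have := f0 i iu; rewrite negbK => /eqP.
move=> /hasP[i]; rewrite mem_free_supp => ui fj; exists i => //.
apply: (@coef_le K _ _ _ h (g i) (Defs.pmap f (g i) (free_gen K g i))).
move: fj; rewrite coefZ mulf_eq0 negb_or => /andP[_].
by rewrite /G /shifted; case: pselect => //= _; rewrite eqxx.
Qed.

(** The resolution [0 -> F1 -> F0 -> M -> 0] is minimal as soon as the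
    differential takes a generator to a combination of generators of strictly
    smaller degrees. *)
Section ShortResolution.
Context (K : fieldType) (d : Order.disp_t) (P : porderType d) (I J : finType).
Context (g : I -> P) (h : J -> P) (M : pmodule K P).
Local Notation F0 := (free_module K g).
Local Notation F1 := (free_module K h).
Context (df : nat_trans F1 F0) (e : nat_trans F0 M).
Hypothesis df_inj : forall x u, Defs.pmap df x u = 0 -> u = 0.
Hypothesis de : is_cokernel df e.
Hypothesis df_lt : forall x (u : free_at K h x) i, (Defs.pmap df x u : free_at K g x) i != 0 ->
  exists2 j, u j != 0 & (g i < h j)%O.

Definition no_generator (v : void) : P := match v with end.
Local Notation Fz := (free_module K no_generator).

Lemma no_generator0 (x : P) (u : free_at K no_generator x) : u = 0.
Proof. by apply: free_eq. Qed.

Definition short_term (i : nat) : pmodule K P := match i with 0 => F0 | 1 => F1 | _ => Fz end.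

Definition short_differential (i : nat) : nat_trans (short_term i.+1) (short_term i) :=
  match i with 0 => df | i.+1 => zero_map Fz (short_term i.+1) end.

Fact short_differentialK i x u :
  Defs.pmap (short_differential i) x (Defs.pmap (short_differential i.+1) x u) = 0.
Proof. by case: i u => [|i] u; rewrite /= ?linear0. Qed.

Definition short_complex : chain_complex K P := ChainComplex short_differentialK.

Lemma free_module_is_free (T : Type) (k : T -> P) : is_free (free_module K k).
Proof. by exists T, k, (id_map _), (id_map _) => x; split; apply: linear_eq. Qed.

Lemma short_free_resolution : free_resolution M short_complex.
Proof.
split; [|case=> [|i] x u; split|by exists e].
- by case=> [|[|i]]; exact: free_module_is_free.
- by move=> /df_inj ->; exists 0; rewrite linear0.
- by case=> v <-; exact: linear0.
- move=> _; exists 0; rewrite linear0; case: i u => [|i] u; exact/esym/no_generator0.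
- by case=> v <-; exact: linear0.
Qed.

(** Lifting the identity of [M] gives chain maps [f] to and [g] from any free
    resolution [D]. The composite [g f] differs from the identity by [df k] in
    degree [0] and by [k df] in degree [1], for a homotopy [k]. Both terms
    strictly lower degrees on supports because [df] does, so [g f] is
    bijective, and [D] is the direct sum of the image of [f] and the kernel of
    [g]. *)
Lemma short_resolution_minimal : minimal_free_resolution M short_complex.
Proof.
split; first exact: short_free_resolution.
move=> D [Dfree Dexact [eD [eDexact eDsurj]]]; have [eexact esurj] := de.
have dD0 : forall x u, Defs.pmap eD x (Defs.pmap (differential D 0) x u) = 0.
  by move=> x u; apply/eDexact; exists u.
have dC0 x u : Defs.pmap e x (Defs.pmap df x u) = 0 by apply/eexact; exists u.
have [f0 f0P] : exists f0 : nat_trans F0 (D 0%N), forall x u,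
    Defs.pmap eD x (Defs.pmap f0 x u) = Defs.pmap e x u.
  by apply: is_free_lift; [exact: free_module_is_free | move=> x u; exact: eDsurj].
have [f1 f1P] : exists f1 : nat_trans F1 (D 1%N), forall x u,
    Defs.pmap (differential D 0) x (Defs.pmap f1 x u) = Defs.pmap f0 x (Defs.pmap df x u).
  have := @is_free_lift K _ P (D 1%N) (D 0%N) F1 (differential D 0) (comp_map f0 df).
  apply; first exact: free_module_is_free.
  by move=> x u; apply/eDexact; rewrite comp_mapE f0P dC0.
have [g0 g0P] : exists g0 : nat_trans (D 0%N) F0, forall x u,
    Defs.pmap e x (Defs.pmap g0 x u) = Defs.pmap eD x u.
  by apply: is_free_lift => // x u; exact: esurj.
have [g1 g1P] : exists g1 : nat_trans (D 1%N) F1, forall x u,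
    Defs.pmap df x (Defs.pmap g1 x u) = Defs.pmap g0 x (Defs.pmap (differential D 0) x u).
  have := @is_free_lift K _ P F1 F0 (D 1%N) df (comp_map g0 (differential D 0)).
  apply=> // x u; apply/eexact; rewrite comp_mapE g0P; exact: dD0.
have [k kP] : exists k : nat_trans F0 F1, forall x u,
    Defs.pmap df x (Defs.pmap k x u) = Defs.pmap g0 x (Defs.pmap f0 x u) - u.
  have := @is_free_lift K _ P F1 F0 F0 df (sub_map (comp_map g0 f0) (id_map _)).
  apply=> [|x u]; first exact: free_module_is_free.
  by apply/eexact; rewrite sub_mapE comp_mapE id_mapE linearB/= g0P f0P subrr.
pose f i : nat_trans (short_complex i) (D i) :=
  match i with 0 => f0 | 1 => f1 | i.+2 => zero_map Fz (D i.+2) end.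
pose gg i : nat_trans (D i) (short_complex i) :=
  match i with 0 => g0 | 1 => g1 | i.+2 => zero_map (D i.+2) Fz end.
have fchain : chain_map f.
  case=> [|i] x u; first exact/esym/f1P.
  have -> : Defs.pmap (short_differential i.+1) x u = 0 by [].
  rewrite linear0; case: i u => [|i] u; last exact/esym/linear0.
  exact/esym/linear0.
have gchain : chain_map gg.
  case=> [|[|i]] x u; [exact/esym/g1P| |exact: no_generator0].
  by apply: df_inj; rewrite g1P differentialK; exact: linear0.
have gfbij i x : bijective (fun u => Defs.pmap (gg i) x (Defs.pmap (f i) x u)).
  case: i => [|[|i]].
  - pose n : {linear free_at K g x -> free_at K g x} := Defs.pmap (comp_map df k) x.
    have nE u : n u = Defs.pmap g0 x (Defs.pmap f0 x u) - u by exact: kP.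
    apply: (eq_bij (f := fun u => u + n u)); last by move=> u; rewrite nE addrC subrK.
    apply: triangular_bijective => u i /df_lt[j kj ij].
    by have [i' ui' ji'] := map_support kj; exists i' => //; exact: lt_le_trans ij ji'.
  - pose n : {linear free_at K h x -> free_at K h x} := Defs.pmap (comp_map k df) x.
    have nE u : n u = Defs.pmap g1 x (Defs.pmap f1 x u) - u.
      apply/eqP; rewrite -subr_eq0; apply/eqP/df_inj.
      have dn : Defs.pmap df x (n u) =
        Defs.pmap g0 x (Defs.pmap f0 x (Defs.pmap df x u)) - Defs.pmap df x u by exact: kP.
      rewrite linearB /= linearB /= dn g1P f1P.
      exact: subrr.
    apply: (eq_bij (f := fun u => u + n u)); last by move=> u; rewrite nE addrC subrK.
    apply: triangular_bijective => u j nuj.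
    have [i di ji] := @map_support K _ P I J g h k x (Defs.pmap df x u) j nuj.
    by have [j' uj' ij'] := df_lt di; exists j' => //; exact: le_lt_trans ji ij'.
  - by exists id => u; exact: etrans (@no_generator0 x _) (esym (@no_generator0 x _)).
pose Eterm i := ker_module (gg i).
have Ed_in i x u : Defs.pmap (gg i.+1) x u = 0 ->
    Defs.pmap (gg i) x (Defs.pmap (differential D i) x u) = 0.
  by move=> u0; rewrite gchain u0 linear0.
pose Ed i : nat_trans (Eterm i.+1) (Eterm i) := ker_lift (@Ed_in i).
have EdK i x u : Defs.pmap (Ed i) x (Defs.pmap (Ed i.+1) x u) = 0.
  by apply: val_inj; exact: differentialK.
exists (ChainComplex EdK), f, (fun i => ker_incl (gg i)); split=> //.
move=> i x; have [inv invK Kinv] := gfbij i x.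
pose G w := inv (Defs.pmap (gg i) x w).
have rest_in w : w - Defs.pmap (f i) x (G w) \in @ker_pred _ _ _ _ _ (gg i) x.
  by rewrite unfold_in linearB/= Kinv subrr.
exists (fun w => (G w, KerAt (rest_in w))) => [[u v]|w] /=; last by rewrite addrC subrK.
have Guv : G (Defs.pmap (f i) x u + Defs.pmap (ker_incl (gg i)) x v) = u.
  by rewrite /G linearD/= (ker_eq0 v) addr0 invK.
congr (_, _); first exact: Guv.
by apply: val_inj; rewrite /= Guv addrC addKr.
Qed.
End ShortResolution.

(** * Modules of staircases *)

Section ShortBetti.
Context (K : fieldType) (d : Order.disp_t) (P : porderType d) (I J : finType).
Context (g : I -> P) (h : J -> P) (M : pmodule K P).
Context (df : nat_trans (free_module K h) (free_module K g)) (e : nat_trans (free_module K g) M).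
Hypothesis df_inj : forall x u, Defs.pmap df x u = 0 -> u = 0.
Hypothesis de : is_cokernel df e.
Hypothesis df_lt : forall x (u : free_at K h x) i, (Defs.pmap df x u : free_at K g x) i != 0 ->
  exists2 j, u j != 0 & (g i < h j)%O.

Lemma free_gens_card (T : finType) (k : T -> P) :
  ([set s : elements (free_module K k) | exists i, s = existT _ (k i) (free_gen K k i)]%classic
    #= `I_#|T|)%card.
Proof.
pose f (i : 'I_#|T|) : elements (free_module K k) :=
  existT _ (k (enum_val i)) (free_gen K k (enum_val i)).
have finj : injective f.
  move=> i j fij; apply: enum_val_inj; apply/eqP; apply: contraT => ij.
  pose c (s : elements (free_module K k)) := (projT2 s : free_at K k (projT1 s)) (enum_val i).
  have := congr1 c fij; rewrite /c /= eqxx (negbTE ij) => /eqP.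
  by rewrite oner_eq0.
have -> : [set s : elements (free_module K k) |
      exists i, s = existT _ (k i) (free_gen K k i)]%classic
    = (f @` setT)%classic.
  apply/seteqP; split=> [_ [i ->]|_ [i _ <-]] /=; last by exists (enum_val i).
  by exists (enum_rank i); rewrite // /f enum_rankK.
apply: (card_eq_trans (inj_card_eq (in2W finj))).
have -> : `I_#|T| = ((fun i : 'I_#|T| => val i) @` setT)%classic.
  apply/seteqP; split=> [i /= iT|_ [i _ <-]] /=; last exact: ltn_ord.
  by exists (Ordinal iT).
by rewrite card_eq_sym; apply: inj_card_eq => i j _ _; exact: val_inj.
Qed.

Lemma free_module_generated (T : finType) (k : T -> P) : finitely_generated (free_module K k).
Proof.
exists [set s | exists i, s = existT _ (k i) (free_gen K k i)]%classic; split.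
  by exists #|T|; exact: free_gens_card.
exact: free_gens_generate.
Qed.

Lemma short_finitely_presented : finitely_presented M.
Proof.
exists (free_module K h), (free_module K g), df, e; split=> //; split.
- exact: free_module_is_free.
- exact: free_module_generated.
- exact: free_module_is_free.
- exact: free_module_generated.
Qed.

Lemma short_betti0 : betti M 0 #|I|.
Proof.
exists (short_complex df); split; first exact: short_resolution_minimal de df_lt.
exists [set s | exists i, s = existT _ (g i) (free_gen K g i)]%classic; split.
  exact: free_gens_minimal.
exact: free_gens_card.
Qed.

Lemma short_betti1 : betti M 1 #|J|.
Proof.
exists (short_complex df); split; first exact: short_resolution_minimal de df_lt.
exists [set s | exists i, s = existT _ (h i) (free_gen K h i)]%classic; split.
  exact: free_gens_minimal.
exact: free_gens_card.
Qed.
End ShortBetti.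

(** Each [s] carries a staircase: its steps [gam s a] are the minimal degrees
    where [s] is present, and its corners [rho s a] are joins of consecutive
    steps. The maps [pi x] identify [M x] with the functions supported on the
    elements present at [x]. *)
Section Staircases.
Context (K : fieldType) (d : Order.disp_t) (P : porderType d) (T : finType) (N : nat).
Context (len : T -> nat) (gam rho : T -> nat -> P) (M : pmodule K P).
Context (pi : forall x : P, {linear M x -> {ffun T -> K^o}}).
Hypothesis len_le : forall s, (len s <= N)%N.
Hypothesis gam_rho : forall s a, (a.+1 < len s)%N -> (gam s a < rho s a)%O.
Hypothesis gamS_rho : forall s a, (a.+1 < len s)%N -> (gam s a.+1 < rho s a)%O.
Hypothesis rho_between : forall s a b c x, (a <= c < b)%N -> (b < len s)%N ->
  (gam s a <= x)%O -> (gam s b <= x)%O -> (rho s c <= x)%O.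
Hypothesis pi_inj : forall x, injective (pi x).
Hypothesis pi_nat : forall x y (xy : (x <= y)%O) u, pi y (transition M xy u) = pi x u.
Hypothesis pi_image : forall x (c : {ffun T -> K^o}),
  (exists u, pi x u = c) <-> (forall s, c s != 0 -> exists2 a, (a < len s)%N & (gam s a <= x)%O).

Definition step : finType := {p : T * 'I_N | (p.2 < len p.1)%N}.
Definition corner : finType := {p : T * 'I_N | (p.2.+1 < len p.1)%N}.

Let gs (i : step) : P := gam (val i).1 (val i).2.
Let rs (j : corner) : P := rho (val j).1 (val j).2.

(** The coefficient at position [a] on the staircase of [s], zero off the
    index set. Writing it as a sum avoids transporting [a] into a dependent
    index type and makes linearity immediate. *)
Definition along (I : finType) (f : I -> T * 'I_N) (c : I -> K) (s : T) (a : nat) : K :=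
  \sum_(i | ((f i).1 == s) && ((f i).2 == a :> nat)) c i.

Let along_step c (i : step) : along val c (val i).1 (val i).2 = c i.
Proof.
rewrite /along (big_pred1 i)// => j /=; rewrite -(inj_eq val_inj) /= -pair_eqE.
Qed.

Let along_corner c (i : corner) : along val c (val i).1 (val i).2 = c i.
Proof.
rewrite /along (big_pred1 i)// => j /=; rewrite -(inj_eq val_inj) /= -pair_eqE.
Qed.

Let along_corner0 (c : corner -> K) s a : (len s <= a.+1)%N -> along val c s a = 0.
Proof.
move=> sa; rewrite /along big_pred0// => j; apply/negbTE/negP => /andP[/eqP js /eqP ja].
by have := valP j; rewrite /= ja js ltnNge sa.
Qed.

Lemma stepP s a : (a < len s)%N -> exists i : step, (val i).1 = s /\ (val i).2 = a :> nat.
Proof.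
move=> sa; have aN := leq_trans sa (len_le s).
have ip : ((s, Ordinal aN).2 < len (s, Ordinal aN).1)%N by [].
by exists (Sub (s, Ordinal aN) ip).
Qed.

Lemma cornerP s a : (a.+1 < len s)%N -> exists i : corner, (val i).1 = s /\ (val i).2 = a :> nat.
Proof.
move=> sa; have aN := leq_trans (ltnW sa) (len_le s).
have ip : ((s, Ordinal aN).2.+1 < len (s, Ordinal aN).1)%N by [].
by exists (Sub (s, Ordinal aN) ip).
Qed.

Lemma sum_steps (c : step -> K) s :
  \sum_(i : step | (val i).1 == s) c i = \sum_(a < len s) along val c s a.
Proof.
rewrite /along (exchange_big_dep (fun i : step => (val i).1 == s))/= => [|a i _ /andP[]//].
apply: eq_bigr => i /eqP is_; have il : ((val i).2 < len s)%N by rewrite -is_; exact: (valP i).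
by rewrite (big_pred1 (Ordinal il))// => a /=; rewrite is_ eqxx /= eq_sym.
Qed.

Definition before (c : corner -> K) s a : K := if a is b.+1 then along val c s b else 0.

(** The corner [a] goes to the step [a] minus the step [a + 1]; hence the
    coefficient at the step [a] is the one at the corner [a] minus the one at
    [a - 1]. *)
Definition corner_diff (c : corner -> K^o) (i : step) : K^o :=
  along val c (val i).1 (val i).2 - before c (val i).1 (val i).2.

Lemma along_neq0 (I : finType) (f : I -> T * 'I_N) (c : I -> K) s a : along f c s a != 0 ->
  exists i, [/\ c i != 0, (f i).1 = s & (f i).2 = a :> nat].
Proof.
move=> sa; have [i /andP[/andP[/eqP is_ /eqP ia] ci]|c0] :=
    pickP (fun i => ((f i).1 == s) && ((f i).2 == a :> nat) && (c i != 0)).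
  by exists i.
move: sa; rewrite /along big1 ?eqxx// => i ia.
by have := c0 i; rewrite ia => /negbFE/eqP.
Qed.

Lemma corner_diff_lt (c : corner -> K^o) i : corner_diff c i != 0 ->
  exists2 j, c j != 0 & (gs i < rs j)%O.
Proof.
rewrite /corner_diff => ci.
have [ca0|/along_neq0[j [cj js ja]]] :=
  eqVneq (along val c (val i).1 (val i).2) 0; last first.
  exists j => //; rewrite /gs /rs js ja; apply: gam_rho; rewrite -js -ja; exact: valP j.
move: ci; rewrite ca0 sub0r oppr_eq0 /before.
case E : (nat_of_ord (val i).2) => [|b]; first by rewrite eqxx.
move=> /along_neq0[j [cj js jb]].
exists j => //; rewrite /gs /rs js jb E; apply: gamS_rho; rewrite -js -jb; exact: valP j.
Qed.

Fact corner_diff_in (x : P) (c : free_at K rs x) : corner_diff c \in free_pred gs x.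
Proof.
apply/asboolP; split; first exact: finite_finset.
by move=> i /corner_diff_lt[j /coef_le jx ij]; exact: le_trans (ltW ij) jx.
Qed.

Definition corner_fun (x : P) (c : free_at K rs x) : free_at K gs x := FreeAt (corner_diff_in c).

Lemma along_linear (I : finType) (f : I -> T * 'I_N) a (u v : I -> K) s b :
  along f (fun i => a * u i + v i) s b = a * along f u s b + along f v s b.
Proof. by rewrite /along mulr_sumr -big_split. Qed.

Fact corner_fun_linear x : linear (@corner_fun x).
Proof.
move=> a u v; apply: free_eq => i; rewrite coefD coefZ /= /corner_diff.
rewrite (along_linear val a u v) /before; case: (nat_of_ord (val i).2) => [|b].
  by rewrite !subr0.
by rewrite (along_linear val a u v) opprD addrACA mulrBr.
Qed.

HB.instance Definition _ x :=
  GRing.isLinear.Build K (free_at K rs x) (free_at K gs x) _ (@corner_fun x) (@corner_fun_linear x).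

Definition corner_map : nat_trans (free_module K rs) (free_module K gs).
Proof.
apply: (@module_map _ _ _ (free_module K rs) (free_module K gs)
  (fun x => @corner_fun x : {linear free_at K rs x -> free_at K gs x})).
by move=> x y xy u; exact: free_eq.
Defined.

Lemma corner_mapE (x : P) (u : free_at K rs x) i :
  (Defs.pmap corner_map x u : free_at K gs x) i = corner_diff u i.
Proof. by []. Qed.

Definition step_sum (u : step -> K^o) : {ffun T -> K^o} :=
  [ffun s => \sum_(i : step | (val i).1 == s) u i].

Fact step_sum_in (x : P) (u : free_at K gs x) : exists v, pi x v = step_sum u.
Proof.
apply/pi_image => s; rewrite ffunE => us.
have [i /andP[/eqP is_ ui]|u0] := pickP (fun i : step => ((val i).1 == s) && (u i != 0)).
  exists (val i).2; first by rewrite -is_; exact: (valP i).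
  by have := coef_le ui; rewrite /gs is_.
move: us; rewrite big1 ?eqxx// => i is_.
by have := u0 i; rewrite is_ => /negbFE/eqP.
Qed.

Definition step_fun (x : P) (u : free_at K gs x) : M x := projT1 (cid (step_sum_in u)).

Lemma pi_step_fun (x : P) (u : free_at K gs x) : pi x (step_fun u) = step_sum u.
Proof. exact: projT2 (cid (step_sum_in u)). Qed.

Fact step_fun_linear x : linear (@step_fun x).
Proof.
move=> a u v; apply: pi_inj; rewrite linearP !pi_step_fun; apply/ffunP => s.
by rewrite !ffunE /= scaler_sumr -big_split.
Qed.

HB.instance Definition _ x :=
  GRing.isLinear.Build K (free_at K gs x) (M x) _ (@step_fun x) (@step_fun_linear x).

Definition step_map : nat_trans (free_module K gs) M.
Proof.
apply: (@module_map _ _ _ (free_module K gs) M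
  (fun x => @step_fun x : {linear free_at K gs x -> M x})).
by move=> x y xy u; apply: (@pi_inj y); rewrite pi_nat !pi_step_fun.
Defined.

Lemma pi_step_map (x : P) (u : free_at K gs x) : pi x (Defs.pmap step_map x u) = step_sum u.
Proof. exact: pi_step_fun. Qed.

(** The coefficients of a cycle vanish one after the other along the
    staircase. *)
Lemma corner_map_inj x u : Defs.pmap corner_map x u = 0 -> u = 0.
Proof.
move=> u0; apply: free_eq => j; rewrite -[LHS]along_corner coef0.
have : ((val j).2.+1 < len (val j).1)%N by exact: (valP j).
elim: (nat_of_ord (val j).2) => [|a IH] ja.
  have [i [is_ ia]] := stepP (ltnW ja).
  have := congr1 (fun v : free_at K gs x => v i) u0.
  by rewrite coef0 corner_mapE /corner_diff is_ ia subr0.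
have [i [is_ ia]] := stepP (ltnW ja).
have := congr1 (fun v : free_at K gs x => v i) u0.
by rewrite coef0 corner_mapE /corner_diff is_ ia /before IH ?subr0// ltnW.
Qed.

Lemma along_corner_diff (c : corner -> K) s a : (a < len s)%N ->
  along val (corner_diff c) s a = along val c s a - before c s a.
Proof. by move=> /stepP[i [<- <-]]; rewrite along_step. Qed.

Lemma sum_corner_diff (c : corner -> K) s : \sum_(i : step | (val i).1 == s) corner_diff c i = 0.
Proof.
rewrite sum_steps; under eq_bigr => a _ do rewrite along_corner_diff//.
case El : (len s) => [|l]; first by rewrite big_ord0.
have -> : \sum_(a < l.+1) (along val c s a - before c s a) = along val c s l.
  elim: l {El} => [|l IH]; first by rewrite big_ord_recl big_ord0 /= subr0 addr0.
  by rewrite big_ord_recr /= IH addrC subrK.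
by apply: along_corner0; rewrite El.
Qed.

(** A combination of steps with sum zero is the boundary of its partial sums.
    Where the partial sum at [a] is nonzero, there are steps present both up
    to [a] and beyond it, which makes the corner [a] present. *)
Lemma staircase_cokernel : is_cokernel corner_map step_map.
Proof.
split=> [x u|x v].
  split=> [u0|[c <-]]; last first.
    apply: (@pi_inj x); rewrite pi_step_map linear0; apply/ffunP => s.
    by rewrite !ffunE; exact: sum_corner_diff.
  have us s : \sum_(a < len s) along val (u : free_at K gs x) s a = 0.
    rewrite -sum_steps; have := congr1 (pi x) u0; rewrite pi_step_map linear0.
    by move/ffunP/(_ s); rewrite !ffunE.
  (* partial sums along the staircase *)
  pose c (j : corner) : K^o := \sum_(a < (val j).2.+1) along val (u : free_at K gs x) (val j).1 a.
  have cP : c \in free_pred rs x.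
    apply/asboolP; split; first exact: finite_finset.
    move=> j cj; set s := (val j).1; have jl : ((val j).2.+1 < len s)%N := valP j.
    have [a [aj ua]] : exists a : nat,
        (a <= (val j).2)%N /\ along val (u : free_at K gs x) s a != 0.
      have [a ua|u0'] := pickP (fun a : 'I_(val j).2.+1 => along val (u : free_at K gs x) s a != 0).
        by exists a; split=> //; rewrite -ltnS.
      by move: cj; rewrite /c big1 ?eqxx// => a _; have /negbFE/eqP := u0' a.
    have [b [jb ub]] : exists b : nat,
        ((val j).2 < b < len s)%N /\ along val (u : free_at K gs x) s b != 0.
      have [b /andP[jb ub]|u0'] := pickP (fun b : 'I_(len s) =>
          ((val j).2 < b)%N && (along val (u : free_at K gs x) s b != 0)).
        by exists b; rewrite jb ltn_ord.
      have cE : c j = \sum_(a < len s) along val (u : free_at K gs x) s a.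
        rewrite /c -/s (big_ord_widen (len s) _ (ltnW jl)) big_mkcond; apply: eq_bigr => b _.
        rewrite ltnS; case: leqP => // jb.
        by have := u0' b; rewrite jb => /negbFE/eqP.
      by move: cj; rewrite cE us eqxx.
    have [i [ui is_ ia]] := along_neq0 ua; have [i' [ui' is' ib]] := along_neq0 ub.
    have := coef_le ui; have := coef_le ui'; rewrite /gs is_ is' ia ib => gb ga.
    case/andP: jb => jb bl.
    by apply: (rho_between (a := a) (b := b)) => //; rewrite aj.
  exists (FreeAt cP); apply: free_eq => i; rewrite corner_mapE /corner_diff /=.
  set s := (val i).1.
  have cE b : (b.+1 < len s)%N ->
      along val c s b = \sum_(a < b.+1) along val (u : free_at K gs x) s a.
    by move=> /cornerP[j [<- <-]]; rewrite along_corner.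
  have befE b : (b < len s)%N -> before c s b = \sum_(a < b) along val (u : free_at K gs x) s a.
    by case: b => [|b] bl; [rewrite big_ord0 | rewrite /= cE].
  have il : ((val i).2 < len s)%N := valP i.
  rewrite befE// -[RHS]along_step -/s; have [il'|il'] := ltnP (val i).2.+1 (len s).
    by rewrite cE// big_ord_recr /= addrAC subrr add0r.
  rewrite along_corner0// sub0r; apply/eqP; rewrite eq_sym -addr_eq0 addrC; apply/eqP.
  rewrite -[RHS](us s); have -> : len s = (val i).2.+1 by apply/eqP; rewrite eqn_leq il' il.
  by rewrite big_ord_recr.
have /pi_image vP : exists w, pi x w = pi x v by exists v.
(* lift a value of [M x] by putting all of it on one step present at [x] *)
pose t (s : T) : option step := [pick i : step | ((val i).1 == s) && (gs i <= x)%O].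
pose u (i : step) : K^o := if t (val i).1 == Some i then pi x v (val i).1 else 0.
have uP : u \in free_pred gs x.
  apply/asboolP; split; first exact: finite_finset.
  move=> i; rewrite /u /t; case: pickP => [j /andP[_ jx]|_]; last by rewrite eqxx.
  have [[<-]//|_] := eqVneq (Some j) (Some i); by rewrite eqxx.
exists (FreeAt uP); apply: (@pi_inj x); rewrite pi_step_map; apply/ffunP => s; rewrite ffunE /=.
case E : (t s) => [i|].
  have is_ : (val i).1 = s by move: E; rewrite /t; case: pickP => // j /andP[/eqP js _] [<-].
  rewrite (bigD1 i) ?is_ ?eqxx//= big1 ?addr0 => [|j /andP[/eqP js ji]].
    by rewrite /u is_ E eqxx.
  by rewrite /u js E; case: eqP => // -[ij]; rewrite ij eqxx in ji.
rewrite big1 => [|j /eqP js]; last by rewrite /u js E.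
apply/esym/eqP/negPn/negP => /vP[a al ax].
have [i [is_ ia]] := stepP al.
by move: E; rewrite /t; case: pickP => // /(_ i); rewrite is_ eqxx /gs is_ ia ax.
Qed.

Lemma staircase_presented : finitely_presented M.
Proof. exact: short_finitely_presented staircase_cokernel. Qed.

Lemma staircase_betti0 : betti M 0 #|step|.
Proof.
apply: (short_betti0 corner_map_inj staircase_cokernel) => x u i; exact: corner_diff_lt.
Qed.

Lemma staircase_betti1 : betti M 1 #|corner|.
Proof.
apply: (short_betti1 corner_map_inj staircase_cokernel) => x u i; exact: corner_diff_lt.
Qed.
End Staircases.

(** * Coordinates on simplicial chains *)

Section ChainCoordinates.
Context (K : fieldType) (j : nat) (T : finType).

Section OneComplex.
Context (W : complex) (l : vertex W -> T).
Hypothesis linj : injective l.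
Implicit Types (v w : otuple j (vertex W)) (s : {set T}).

(** The simplex [v] enumerates [s] in the fixed order of [enum]; this picks
    one orientation of each simplex. *)
Definition lists v s : bool := [seq l (v i) | i <- enum 'I_j.+1] == enum s.

Definition precompose v (t : 'S_j.+1) : otuple j (vertex W) := [ffun i => v (t i)].

Definition label_set v : {set T} := [set l (v i) | i in 'I_j.+1]%SET.

Lemma lists_unique v w s : lists v s -> lists w s -> v = w.
Proof.
move=> /eqP vs /eqP ws; apply/ffunP => i; apply: linj.
have /eq_in_map :
    [seq l (v i) | i <- enum 'I_j.+1] = [seq l (w i) | i <- enum 'I_j.+1] by rewrite vs.
by apply; rewrite mem_enum.
Qed.

Lemma lists_set v s : lists v s -> label_set v = s.
Proof.
move=> /eqP vs; apply/setP => x; rewrite -(mem_enum s) -vs.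
by apply/imsetP/mapP => -[i _ ->]; exists i; rewrite ?mem_enum.
Qed.

Lemma lists_inj v s : lists v s -> injective v.
Proof.
move=> /eqP vs i i' vi.
suff /injectiveP lv : injectiveb (fun i => l (v i)) by apply: lv; rewrite vi.
by rewrite /injectiveb /dinjectiveb vs enum_uniq.
Qed.

Lemma lists_card v s : lists v s -> #|s| = j.+1.
Proof. by move=> /eqP vs; rewrite cardE -vs size_map size_enum_ord. Qed.

Lemma label_set_precompose v t : label_set (precompose v t) = label_set v.
Proof.
apply/setP => x; apply/imsetP/imsetP => -[i _ ->].
  by exists (t i); rewrite ?ffunE.
by exists ((t^-1)%g i); rewrite ?ffunE ?permKV.
Qed.

Lemma lists_precompose v : injective v -> exists t, lists (precompose v t) (label_set v).
Proof.
move=> vinj; pose tv := [tuple l (v i) | i < j.+1].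
have : perm_eq (enum (label_set v)) tv.
  apply: uniq_perm; first exact: enum_uniq.
    by rewrite map_inj_uniq ?enum_uniq// => a b /linj /vinj.
  move=> x; rewrite mem_enum; apply/imsetP/mapP => -[i _ ->]; exists i; rewrite ?mem_enum//.
case/tuple_permP => t tE; exists t; rewrite /lists tE; apply/eqP.
by apply: eq_map => i; rewrite ffunE tnth_mktuple.
Qed.

(** The labels embed all complexes of a filtration in one ambient set, so the
    values on standard orientations are coordinates independent of the index. *)
Definition label_coord (c : chain K j W) : {ffun {set T} -> K^o} :=
  [ffun s => \sum_(v | lists v s) chain_coef c v].

Fact label_coord_linear : linear label_coord.
Proof.
move=> a u v; apply/ffunP => s; rewrite !ffunE /= scaler_sumr -big_split.
by apply: eq_bigr => w _; rewrite !ffunE.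
Qed.

HB.instance Definition _ := GRing.isLinear.Build K (chain K j W) {ffun {set T} -> K^o} _
  label_coord label_coord_linear.

(** Every injective tuple is a permutation of the standard enumeration of its
    labels, and chains change by the sign. *)
Lemma label_coord_inj : injective label_coord.
Proof.
have key c : label_coord c = 0 -> c = 0.
  move=> c0; apply/val_inj/ffunP => v; rewrite ffunE; apply/eqP/negPn/negP => cv.
  have /chain_predP[cW cs] := chain_coefP c.
  have [/injectiveP vinj _] := cW v cv; have [t tv] := lists_precompose vinj.
  have := congr1 (fun b : {ffun {set T} -> K^o} => b (label_set v)) c0.
  rewrite !ffunE (bigD1 (precompose v t))//= big1 ?addr0 => [|w /andP[wv]]; last first.
    by rewrite (lists_unique wv tv) eqxx.
  by rewrite cs => /eqP; rewrite mulf_eq0 signr_eq0 /= (negbTE cv).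
move=> c c' cc'; apply/eqP; rewrite -subr_eq0; apply/eqP/key.
by rewrite linearB/= cc' subrr.
Qed.

(** Extends values on standard orientations to all tuples by the sign of the
    permutation that sorts them; at most one permutation does, and none if an
    entry is repeated. *)
Definition fill_coef (b : {ffun {set T} -> K^o}) : {ffun otuple j (vertex W) -> K^o} :=
  [ffun v => \sum_(t : 'S_j.+1 | lists (precompose v t) (label_set v))
     (-1) ^+ odd_perm t * b (label_set v)].

Lemma fill_coef_listed b v s : lists v s -> fill_coef b v = b s.
Proof.
move=> vs; rewrite ffunE (lists_set vs) (big_pred1 1%g) ?odd_perm1 ?mul1r// => t.
apply/idP/eqP => [tv|->]; last first.
  by rewrite (_ : precompose v 1%g = v)//; apply/ffunP => i; rewrite ffunE perm1.
apply/permP => i; rewrite perm1; apply: (lists_inj vs).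
by have /ffunP/(_ i) := lists_unique tv vs; rewrite ffunE.
Qed.

Lemma fill_coef_chain (b : {ffun {set T} -> K^o}) :
  (forall s, b s != 0 -> exists2 F, F \in simplices W & (l @: F)%SET = s) ->
  fill_coef b \in @chain_pred K j W.
Proof.
move=> bW; apply/chain_predP; split=> [v|v s]; last first.
  rewrite !ffunE label_set_precompose mulr_sumr [RHS](reindex_inj (mulIg s))/=.
  apply: eq_big => [t|t _].
    by congr lists; apply/ffunP => i; rewrite !ffunE permM.
  by rewrite [RHS]mulrA -signr_addb odd_permM addbC addbK.
rewrite ffunE => bv.
have [t tv|t0] := pickP (fun t : 'S_j.+1 => lists (precompose v t) (label_set v)); last first.
  by move: bv; rewrite big_pred0 ?eqxx.
have vinj : injective v.
  move=> i i' vi; have := lists_inj tv (x1 := (t^-1)%g i) (x2 := (t^-1)%g i').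
  by rewrite !ffunE !permKV => /(_ vi)/perm_inj.
split; first exact/injectiveP.
have /bW[F FW lF] : b (label_set v) != 0.
  by apply: contraNneq bv => ->; rewrite big1// => t' _; rewrite mulr0.
rewrite (_ : [set _ | _ in _]%SET = F)//; apply: (imset_inj linj).
by rewrite lF -imset_comp.
Qed.

Lemma label_coord_image (b : {ffun {set T} -> K^o}) :
  (exists c, label_coord c = b) <->
  (forall s, b s != 0 -> #|s| = j.+1 /\ exists2 F, F \in simplices W & (l @: F)%SET = s).
Proof.
split=> [[c <-] s|bW].
  rewrite ffunE => cs.
  have [v /andP[vs cv]|c0] := pickP (fun v => lists v s && (chain_coef c v != 0)); last first.
    by move: cs; rewrite big1 ?eqxx// => v vs; have := c0 v; rewrite vs => /negbFE/eqP.
  split; first exact: lists_card vs.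
  have /chain_predP[cW _] := chain_coefP c; have [_ vW] := cW v cv.
  by exists [set v i | i in 'I_j.+1]%SET => //; rewrite -imset_comp -(lists_set vs).
have bc := fill_coef_chain (fun s bs => proj2 (bW s bs)).
exists (Chain bc); apply/ffunP => s; rewrite ffunE /=.
have [bs0|bs] := eqVneq (b s) 0.
  by rewrite big1 ?bs0// => v vs; rewrite (fill_coef_listed _ vs).
have [v vs] : exists v, lists v s.
  have [cs [F FW lF]] := bW s bs.
  have [x0 _] : exists x, x \in s by apply/set0Pn; rewrite -card_gt0 cs.
  have /choice[u uP] : forall i : 'I_j.+1, exists u, l u = nth x0 (enum s) i.
    move=> i; have : nth x0 (enum s) i \in s by rewrite -mem_enum mem_nth// -cardE cs.
    by rewrite -lF => /imsetP[u _ ->]; exists u.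
  exists [ffun i => u i]; apply/eqP; apply: (@eq_from_nth _ x0).
    by rewrite size_map size_enum_ord -cardE cs.
  move=> i; rewrite size_map size_enum_ord => ij.
  by rewrite (nth_map ord0) ?size_enum_ord// ffunE uP nth_enum_ord.
rewrite (big_pred1 v) ?(fill_coef_listed _ vs)// => w.
by apply/idP/eqP => [ws|->//]; exact: lists_unique ws vs.
Qed.
End OneComplex.

Lemma label_coord_natural (W W' : complex) (l : vertex W -> T) (l' : vertex W' -> T)
    (f : simplicial_map W W') (c : chain K j W) :
  injective l' -> (forall v, l' (f v) = l v) ->
  label_coord l' (chain_lin K j f c) = label_coord l c.
Proof.
move=> linj' lf; apply/ffunP => s; rewrite !ffunE.
rewrite [RHS](partition_big
  (fun v : otuple j (vertex W) => [ffun i => f (v i)] : otuple j (vertex W'))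
  (fun w => lists l' w s))/=; last first.
  by move=> v /eqP vs; apply/eqP; rewrite -vs; apply: eq_map => i; rewrite ffunE.
apply: eq_bigr => w ws; rewrite ffunE ifT; last exact/injectiveP/(lists_inj ws).
apply: eq_bigl => v; rewrite andb_idl// => /eqP vw; move: ws; rewrite -vw /lists.
by under eq_map do rewrite ffunE lf.
Qed.
End ChainCoordinates.

(** * The size of the nerve filtration *)

Section NerveSize.
Context (R : realType) (K : fieldType) (X : finMetricType R) (k j : nat).
Implicit Types (s : {set X}) (p : bigrade R).

Let r2_gt0 : 0 < Num.sqrt 2 :> R. Proof. by rewrite sqrtr_gt0. Qed.

(** The distance from [y] to its farthest point in [s]: the balls centred in
    [s] all contain [y] once their radius attains it. *)
Definition reach s (y : X) : R := \big[Num.max/0]_(x in s) mdist x y.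

Lemma reach_ge0 s y : 0 <= reach s y.
Proof.
by rewrite /reach; elim/big_ind: _ => // [a b a0 b0|x _]; [rewrite le_max a0 | exact: mdist_ge0].
Qed.

Lemma ball_meet_reach (r : {nonneg R}) s y :
  (y \in ball_meet r s) = (reach s y <= Num.sqrt 2 * r%:num).
Proof.
rewrite inE /reach; apply/forall_inP/idP => [sy|sy x xs]; last first.
  by apply: le_trans sy; rewrite (bigD1 x)//= le_max lexx.
elim/big_ind: _ => [|a b a0 b0|x xs]; last exact: sy.
  by rewrite mulr_ge0// ltW.
by rewrite ge_max a0.
Qed.

Definition levels s : seq R := sort <=%R (undup [seq reach s y | y <- enum X]).

Definition level s (a : nat) : R := nth 0 (levels s) a.

Lemma levels_ltn s a b : (a < b)%N -> (b < size (levels s))%N -> level s a < level s b.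
Proof.
move=> ab bs; have : sorted <%R (levels s).
  by rewrite lt_sorted_uniq_le sort_uniq undup_uniq sort_le_sorted.
by move/lt_sorted_ltn_nth => ->//; rewrite inE ?(ltn_trans ab).
Qed.

Lemma mem_levels s y : reach s y \in levels s.
Proof. by rewrite mem_sort mem_undup map_f ?mem_enum. Qed.

Lemma size_levels s : (size (levels s) <= #|X|)%N.
Proof. by rewrite size_sort (leq_trans (size_undup _))// size_map cardE. Qed.

Lemma level_reach s a : (a < size (levels s))%N -> exists y, level s a = reach s y.
Proof.
move=> /(mem_nth 0); rewrite -/(level s a) mem_sort mem_undup => /mapP[y _ ->]; by exists y.
Qed.

Fact scale_ge0 s a : 0 <= level s a / Num.sqrt 2.
Proof.
apply: divr_ge0; last exact: sqrtr_ge0.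
have [/level_reach[y ->]|?] := ltnP a (size (levels s)); first exact: reach_ge0.
by rewrite /level nth_default.
Qed.

Definition scale s a : {nonneg R} := NngNum (scale_ge0 s a).

Definition count_within s (t : R) : nat := #|[set y | reach s y <= t]%SET|.

Lemma card_ball_meet (r : {nonneg R}) s : #|ball_meet r s| = count_within s (Num.sqrt 2 * r%:num).
Proof. by apply: eq_card => y; rewrite ball_meet_reach inE. Qed.

Lemma count_within_mono s t t' : t <= t' -> (count_within s t <= count_within s t')%N.
Proof.
move=> tt'; apply/subset_leq_card/fintype.subsetP => y; rewrite !inE => yt.
exact: le_trans yt tt'.
Qed.

Lemma level_count_gt0 s a : (a < size (levels s))%N -> (0 < count_within s (level s a))%N.
Proof.
by move=> /level_reach[y ->]; rewrite card_gt0; apply/set0Pn; exists y; rewrite inE lexx.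
Qed.

(** At a level that occurs the count is positive, so the predecessor followed
    by the successor does not change it. *)
Definition multiplicity s a : posnat := PosNat (ltn0Sn (count_within s (level s a)).-1).

Lemma multiplicityE s a : (a < size (levels s))%N ->
  multiplicity s a = count_within s (level s a) :> nat.
Proof. by move=> /level_count_gt0 as0; rewrite /= prednK. Qed.

Lemma multiplicity_mono s a b : (a <= b)%N -> (b < size (levels s))%N ->
  (multiplicity s a <= multiplicity s b)%N.
Proof.
move=> ab bs; rewrite !multiplicityE ?(leq_ltn_trans ab)//; apply: count_within_mono.
by move: ab; rewrite leq_eqVlt => /orP[/eqP ->//|ab]; exact/ltW/levels_ltn.
Qed.

(** The levels are the radii at which the number of common points jumps. A
    step pairs such a radius with the number of points reached; the following
    corner keeps that number and takes the next radius. *)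
Definition nerve_step s a : bigrade R := (multiplicity s a, scale s a).
Definition nerve_corner s a : bigrade R := (multiplicity s a, scale s a.+1).
Definition nerve_len s : nat := if (#|s| == j.+1) && (j <= k)%N then size (levels s) else 0.

Lemma nerve_len_lt s a : (a < nerve_len s)%N ->
  [/\ #|s| = j.+1, (j <= k)%N & (a < size (levels s))%N].
Proof. by rewrite /nerve_len; case: ifP => // /andP[/eqP -> ->]. Qed.

Lemma nerve_len_le s : (nerve_len s <= #|X|)%N.
Proof. by rewrite /nerve_len; case: ifP => // _; exact: size_levels. Qed.

Lemma scale_ltn s a b : (a < b)%N -> (b < size (levels s))%N ->
  (scale s a)%:num < (scale s b)%:num.
Proof. by move=> ab bs; rewrite /= ltr_pM2r ?invr_gt0// levels_ltn. Qed.

Lemma scale_leq s a b : (a <= b)%N -> (b < size (levels s))%N ->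
  (scale s a)%:num <= (scale s b)%:num.
Proof. by rewrite leq_eqVlt => /orP[/eqP ->//|ab] bs; exact/ltW/scale_ltn. Qed.

Lemma nerve_step_corner s a : (a.+1 < nerve_len s)%N -> (nerve_step s a < nerve_corner s a)%O.
Proof.
move=> /nerve_len_lt[_ _ as_]; have sa := scale_ltn (ltnSn a) as_.
rewrite lt_neqAle bigrade_le leqnn ltW// !andbT.
by apply/eqP => /(congr1 (fun p : bigrade R => p.2%:num)) E; move: sa; rewrite [ltLHS]E ltxx.
Qed.

Lemma multiplicity_ltn s a : (a.+1 < size (levels s))%N ->
  (multiplicity s a < multiplicity s a.+1)%N.
Proof.
move=> as_; rewrite !multiplicityE ?(ltn_trans (ltnSn a))//.
have la := levels_ltn (ltnSn a) as_; have [y yE] := level_reach as_.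
apply: proper_card; apply/properP; split.
  by apply/fintype.subsetP => z; rewrite !inE => za; exact: le_trans za (ltW la).
by exists y; rewrite !inE -yE ?lexx// -ltNge.
Qed.

Lemma nerve_stepS_corner s a : (a.+1 < nerve_len s)%N -> (nerve_step s a.+1 < nerve_corner s a)%O.
Proof.
move=> /nerve_len_lt[_ _ as_]; have sa := multiplicity_ltn as_.
rewrite lt_neqAle bigrade_le lexx ltnW// !andbT.
by apply/eqP => /(congr1 (fun p : bigrade R => nat_of_posnat p.1)) E; move: sa; rewrite -E ltnn.
Qed.

Lemma nerve_corner_between s a b c p : (a <= c < b)%N -> (b < nerve_len s)%N ->
  (nerve_step s a <= p)%O -> (nerve_step s b <= p)%O -> (nerve_corner s c <= p)%O.
Proof.
move=> /andP[ac cb] /nerve_len_lt[_ _ bs]; rewrite !bigrade_le => /andP[pa _] /andP[_ bp].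
apply/andP; split; last exact: le_trans (scale_leq cb bs) bp.
exact: leq_trans pa (multiplicity_mono ac (ltn_trans cb bs)).
Qed.

(** The number of common points at radius [t] is the count at the largest
    level that is at most [t]. *)
Lemma nerve_step_le s p : #|s| = j.+1 -> (j <= k)%N ->
  (exists2 a, (a < nerve_len s)%N & (nerve_step s a <= p)%O) <-> (p.1 <= #|ball_meet p.2 s|)%N.
Proof.
move=> sj jk; rewrite card_ball_meet /nerve_len sj eqxx jk /=.
have pE a : ((scale s a)%:num <= p.2%:num) = (level s a <= Num.sqrt 2 * p.2%:num).
  by rewrite /= ler_pdivrMr// mulrC.
split=> [[a al]|pc].
  rewrite bigrade_le pE => /andP[pa ap]; apply: leq_trans pa _.
  by rewrite multiplicityE//; exact: count_within_mono.
have /card_gt0P[y0] : (0 < count_within s (Num.sqrt 2 * p.2%:num))%N.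
  exact: leq_trans (posnat_gt0 _) pc.
rewrite inE => y0P.
pose y := [arg max_(y > y0 | reach s y <= Num.sqrt 2 * p.2%:num) reach s y]%O.
have [yP ymax] : reach s y <= Num.sqrt 2 * p.2%:num /\
    forall z, reach s z <= Num.sqrt 2 * p.2%:num -> reach s z <= reach s y.
  by rewrite /y; case: arg_maxP.
have al : (index (reach s y) (levels s) < size (levels s))%N by rewrite index_mem mem_levels.
exists (index (reach s y) (levels s)) => //.
rewrite bigrade_le pE /level nth_index ?mem_levels// yP andbT multiplicityE// /level.
rewrite nth_index ?mem_levels//.
apply: leq_trans pc (subset_leq_card _); apply/fintype.subsetP => z; rewrite !inE; exact: ymax.
Qed.

Let M : pmodule K (bigrade R) := chain_module K (Skel k \oF nerve_model X) j.
Let lab p (v : vertex (skel k (spanned (nerve_family X p)))) : X := val v.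
Let lab_inj p : injective (@lab p). Proof. exact: val_inj. Qed.

Definition nerve_coord p : {linear M p -> {ffun {set X} -> K^o}} :=
  label_coord (K := K) (j := j) (@lab p).

Lemma nerve_coord_inj p : injective (nerve_coord p).
Proof. exact: label_coord_inj. Qed.

Lemma nerve_coord_nat p q (pq : (p <= q)%O) u : nerve_coord q (transition M pq u) = nerve_coord p u.
Proof.
apply: (@label_coord_natural K j X _ _ (@lab p) (@lab q)
  (Defs.fmap (Skel k \oF nerve_model X) pq : simplicial_map _ _) u) => //.
Qed.

Lemma nerve_coord_image p (c : {ffun {set X} -> K^o}) :
  (exists u, nerve_coord p u = c) <->
  (forall s, c s != 0 -> exists2 a, (a < nerve_len s)%N & (nerve_step s a <= p)%O).
Proof.
have imgP := @label_coord_image K j X _ (@lab p) (@lab_inj p) c.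
have simplexP s : #|s| = j.+1 ->
    (exists2 F, F \in simplices (skel k (spanned (nerve_family X p))) & (@lab p @: F)%SET = s) <->
    (j <= k)%N /\ (p.1 <= #|ball_meet p.2 s|)%N.
  move=> sj; split=> [[F]|[jk ps]].
    rewrite inE spannedP => /andP[Fp Fk] FE; move: sj Fp; rewrite -FE card_imset// => Fj.
    by rewrite inE => /andP[_ ?]; split=> //; move: Fk; rewrite Fj ltnS.
  have sp : s \in nerve_set X p by rewrite inE -card_gt0 sj.
  pose F := [set v : vertex (spanned (nerve_family X p)) | val v \in s]%SET.
  have FE : (@lab p @: F)%SET = s.
    apply/setP => x; apply/imsetP/idP => [[v + ->]|xs]; first by rewrite inE.
    have xp : [set x]%SET \in (nerve_family X p : {set {set X}}).
      apply: nerve_sub sp; first by rewrite finset.sub1set.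
      by apply/set0Pn; exists x; rewrite inE.
    by exists (Sub x xp : spanned_vertex _) => //; rewrite inE SubK.
  exists F => //; rewrite inE spannedP FE sp /= -(card_imset F (@lab_inj p)) FE sj ltnS //.
split=> [[u uc] s cs|cP].
  have [sj /(simplexP s sj)[jk ps]] := imgP.1 (ex_intro _ u uc) s cs.
  by apply/nerve_step_le.
apply: imgP.2 => s cs; have [a al ap] := cP s cs; have [sj jk _] := nerve_len_lt al.
split=> //; apply/simplexP => //; split=> //.
by apply/nerve_step_le => //; exists a.
Qed.

Lemma nerve_chains_presented : finitely_presented M.
Proof.
exact: (staircase_presented nerve_len_le nerve_step_corner nerve_stepS_corner
  nerve_corner_between nerve_coord_inj nerve_coord_nat nerve_coord_image).
Qed.

Lemma nerve_chains_betti0 : betti M 0 #|step #|X| nerve_len|.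
Proof.
exact: (staircase_betti0 nerve_len_le nerve_step_corner nerve_stepS_corner nerve_corner_between
  nerve_coord_inj nerve_coord_nat nerve_coord_image).
Qed.

Lemma nerve_chains_betti1 : betti M 1 #|corner #|X| nerve_len|.
Proof.
exact: (staircase_betti1 nerve_len_le nerve_step_corner nerve_stepS_corner nerve_corner_between
  nerve_coord_inj nerve_coord_nat nerve_coord_image).
Qed.

Lemma card_subsets_le (T : finType) m : (#|[set s : {set T} | #|s| == m]| <= #|T| ^ m)%N.
Proof.
rewrite card_draws; apply: (@leq_trans (#|T| ^_ m)).
  by rewrite -bin_ffact leq_pmulr// fact_gt0.
rewrite ffact_prod -[leqRHS](_ : \prod_(i < m) #|T| = _)%N; last by rewrite prod_nat_const card_ord.
by apply: leq_prod => i _; exact: leq_subr.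
Qed.

Lemma card_nerve_steps : (#|step #|X| nerve_len| <= #|X| ^ j.+2)%N.
Proof.
rewrite -(card_imset _ (val_inj : injective (val : step #|X| nerve_len -> _))).
apply: (@leq_trans #|finset.setX [set s : {set X} | #|s| == j.+1] [set: 'I_#|X|]|).
  apply/subset_leq_card/fintype.subsetP => _ /imsetP[i _ ->].
  have [sj _ _] := nerve_len_lt (valP i).
  by rewrite !inE sj eqxx.
by rewrite cardsX cardsT card_ord expnSr leq_mul2r card_subsets_le orbT.
Qed.

Lemma card_nerve_corners : (#|corner #|X| nerve_len| <= #|X| ^ j.+2)%N.
Proof.
apply: leq_trans card_nerve_steps.
rewrite -(card_imset _ (val_inj : injective (val : corner #|X| nerve_len -> _))).
rewrite -(card_imset _ (val_inj : injective (val : step #|X| nerve_len -> _))).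
apply/subset_leq_card/fintype.subsetP => _ /imsetP[i _ ->].
have il : ((val i).2 < nerve_len (val i).1)%N by exact: ltnW (valP i).
by apply/imsetP; exists (Sub (val i) il).
Qed.

Lemma card_nerve_steps_high : (k < j)%N -> #|step #|X| nerve_len| = 0%N.
Proof.
move=> kj; apply: eq_card0 => i; have /nerve_len_lt[_ + _] := valP i.
by rewrite leqNgt kj.
Qed.
End NerveSize.

Lemma nerve_model_size (R : realType) (K : fieldType) (X : finMetricType R) (k : nat) :
  exists2 n : nat, has_size K (Skel k \oF nerve_model X) n & (n <= k.+2 * #|X| ^ k.+2)%N.
Proof.
pose b0 j := #|step #|X| (@nerve_len R X k j)|.
pose b1 := #|corner #|X| (@nerve_len R X k 0)|.
exists (b1 + \sum_(j < k.+1) b0 j)%N.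
  split; first by move=> j; exact: nerve_chains_presented.
  exists b1, b0, k.+1; split=> //.
  - exact: nerve_chains_betti1.
  - by move=> j; exact: nerve_chains_betti0.
  - by move=> j; exact: card_nerve_steps_high.
have pow j : (j <= k)%N -> (#|X| ^ j.+2 <= #|X| ^ k.+2)%N.
  case: #|X| => [|m] jk; first by rewrite !exp0n.
  by rewrite leq_pexp2l.
rewrite mulSn leq_add//; first exact: leq_trans (card_nerve_corners _ _ _) (pow _ _).
rewrite -[leqRHS](_ : \sum_(j < k.+1) (#|X| ^ k.+2) = _)%N; last by rewrite sum_nat_const card_ord.
apply: leq_sum => j _; apply: leq_trans (card_nerve_steps _ _ _) (pow _ _).
by rewrite -ltnS.
Qed.

Theorem corollary1p5 (R : realType) (K : fieldType) :
  (exists J : forall X : finMetricType R, simplicial_functor (bigrade R),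
     (forall X : finMetricType R, is_approximation (sqrt2_ge1 R) (SR X) (J X)) /\
     (forall k : nat, exists C : R, forall X : finMetricType R,
        exists n : nat, has_size K (Skel k \oF J X) n /\
          n%:R <= C * #|X|%:R ^+ (k + 2))) /\
  (exists XX : set (finMetricType R), infinite_set XX /\
     forall (delta : R) (delta_ge1 : 1 <= delta), delta < Num.sqrt 2 ->
       ~ exists q : {poly R}, forall X : finMetricType R, XX X ->
           exists (G : simplicial_functor (bigrade R)) (n : nat),
             [/\ is_approximation delta_ge1 (SR X) G, has_size K G n &
                 n%:R <= q.[#|X|%:R]]).
Proof.
split; last exact: no_polynomial_approximation.
exists (@nerve_model R); split; first exact: nerve_model_approximation.
move=> k; exists k.+2%:R => X; have [n nsize nX] := nerve_model_size K X k.
by exists n; split=> //; rewrite addn2 -natrX -natrM ler_nat.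
Qed.
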